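(* Fix $0<p<1$, $\gamma\in(0,1)\cap\mathbb Q$, and let $W_0=f^\gamma_p$. Let $r\in[p,1]$ and define $t^\gamma_r=\|f^\gamma_r\|_{\mathrm{op}}$. 1. If $(r^2,h_p(r))$ lies on the convex minorant of $x\mapsto h_p(x^{1/2})$, then $t^\gamma_r$ is in the symmetric regime for $W_0$ and $\|\cdot\|_{\mathrm{op}}$. Moreover, $\tilde f^\gamma_r$ is the unique symmetric solution. 2. If $(r^2,h_p(r))$ does not lie on the convex minorant of $x\mapsto h_p(x^{1/2})$, then $t^\gamma_r$ is not in the symmetric regime for $W_0$ and $\|\cdot\|_{\mathrm{op}}$.
   Context: A graphon is a measurable symmetric function $f:[0,1]^2\to[0,1]$; $\mathcal W$ is the set of graphons. $d_\square(f,g)=\sup_{S,T\subseteq[0,1]}\left|\int_{S\times T}(f-g)\right|$ over measurable $S,T$; $\delta_\square(f,g)=\inf_{\phi}d_\square(f,g^\phi)$ over bijective Lebesgue-measure-preserving $\phi:[0,1]\to[0,1]$, where $g^\phi(x,y)=g(\phi(x),\phi(y))$. $\tilde f$ is the class of $f$ under $f\sim g\iff\delta_\square(f,g)=0$, and $\tilde{\mathcal W}=\mathcal W/\!\sim$ with metric $\delta_\square$ (a compact metric space). For $f\in\mathcal W$, $\|f\|_{\mathrm{op}}$ is the operator norm on $L^2([0,1])$ of $(T_fu)(x)=\int_0^1f(x,y)u(y)\,dy$; it is well defined and continuous on $(\tilde{\mathcal W},\delta_\square)$. $f^\gamma_r$ is the graphon equal to $0$ on $[0,\gamma]^2\cup(\gamma,1]^2$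 and $r$ elsewhere. $\mathcal B^{(\gamma,1-\gamma)}$ is the set of graphons constant on each of $[0,\gamma]^2$, $(\gamma,1]^2$, and $([0,\gamma]\times(\gamma,1])\cup((\gamma,1]\times[0,\gamma])$; $\tilde{\mathcal B}^{(\gamma,1-\gamma)}$ is the set of $\tilde f\in\tilde{\mathcal W}$ with $\delta_\square(\tilde f,g)=0$ for some $g\in\mathcal B^{(\gamma,1-\gamma)}$. $h_p(u)=u\log\frac up+(1-u)\log\frac{1-u}{1-p}$ (with $0\log0=0$, $0\log(0/0)=0$, value $+\infty$ if $p\in\{0,1\}$, $u\ne p$). The convex minorant of a function on $[0,1]$ is the largest convex function below it. $I_{W_0}(f)=\frac12\int_{[0,1]^2}h_{W_0(x,y)}(f(x,y))\,dx\,dy$; $\Omega=\{W_0\in(0,1)\}$; $\mathcal W_\Omega$ is the set of graphons equal to $W_0$ a.e. on $\Omega^c$; $\tilde{\mathcal W}_\Omega$ is the set of classes $\tilde f$ with $\delta_\square(\tilde f,g)=0$ for some $g\in\mathcal W_\Omega$. $J_{W_0}(\tilde f)=\sup_{\eta>0}\inf\{I_{W_0}(h):h\in\mathcal W,\delta_\square(\tilde f,h)\le\eta\}$ if $\tilde f\in\tilde{\mathcal W}_\Omega$ and $\infty$ otherwise. For a continuous graph parameter $\tau$ (a $\delta_\square$-continuous function $\tilde{\mathcal W}\to\mathbb R$), a value $t\le\max_{\tilde{\mathcal W}_\Omega}\tau$ is in the symmetric regime for $W_0$ and $\tau$ if all minimizers $\tilde g$ of $\min\{J_{W_0}(\tilde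 f):\tilde f\in\tilde{\mathcal W},\tau(\tilde f)\ge t\}$ satisfy $\tilde g\in\tilde{\mathcal B}^{(\gamma,1-\gamma)}$. The symmetric solution is unique if a unique element of $\tilde{\mathcal W}_\Omega$ attains this minimum. *)

(* Defs.v *)
From HB Require Import structures.
From mathcomp Require Import all_boot all_order all_algebra.
From mathcomp Require Import all_classical all_reals all_analysis.

Set Implicit Arguments.
Unset Strict Implicit.
Unset Printing Implicit Defensive.

Import Order.TTheory GRing.Theory Num.Theory.
Import numFieldNormedType.Exports.

Local Open Scope classical_set_scope.
Local Open Scope ring_scope.

Section Graphons.
Context {R : realType}.

Local Notation mu := (@lebesgue_measure R).
Local Notation mu2 := (mu \x mu)%E.

Definition I01 : set R := `[0, 1]%classic.

(* Functions are total on R * R; only their values on [0,1]^2 are ever used.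
   Measurability is Borel; every Lebesgue measurable graphon agrees a.e. with
   a Borel one, so the classes modulo cut_dist = 0 are unaffected. *)
Definition graphon : set (R * R -> R) :=
  [set f : R * R -> R | [/\ measurable_fun (I01 `*` I01) f,
    (forall x y, I01 x -> I01 y -> f (x, y) = f (y, x)) &
    (forall x y, I01 x -> I01 y -> 0 <= f (x, y) <= 1)]].

(* d_square *)
Definition cut_dist_labelled (f g : R * R -> R) : R :=
  sup [set a | exists S T : set R,
    [/\ measurable S /\ S `<=` I01, measurable T /\ T `<=` I01 &
        a = `| \int[mu2]_(z in S `*` T) (f z - g z) |]].

(* Invertible measure-preserving maps of [0,1].  Measurability of the inverse
   is automatic for a bijective Borel map (Lusin-Souslin). *)
Definition mp_bijection : set (R -> R) :=
  [set phi | [/\ set_bij I01 I01 phi, measurable_fun I01 phi,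
    (forall A, measurable A -> A `<=` I01 -> measurable (phi @` A)) &
    (forall A, measurable A -> A `<=` I01 ->
       mu (I01 `&` phi @^-1` A) = mu A)]].

Definition relabel (g : R * R -> R) (phi : R -> R) : R * R -> R :=
  fun z => g (phi z.1, phi z.2).

(* delta_square *)
Definition cut_dist (f g : R * R -> R) : R :=
  inf [set cut_dist_labelled f (relabel g phi) | phi in mp_bijection].

Definition gclass (f : R * R -> R) : set (R * R -> R) :=
  [set g : R * R -> R | graphon g /\ cut_dist f g = 0].

Definition gspace : set (set (R * R -> R)) := gclass @` graphon.

(* A function of graphons invariant under cut_dist = 0 is transported to
   gspace by evaluation at a chosen representative. *)
Definition grepr (F : set (R * R -> R)) : R * R -> R := xget (cst 0) F.

Definition cut_distc (F : set (R * R -> R)) (g : R * R -> R) : R :=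
  cut_dist (grepr F) g.

Definition kernel_op (f : R * R -> R) (u : R -> R) : R -> R :=
  fun x => \int[mu]_(y in I01) (f (x, y) * u y).

(* L^2([0,1]) is the set of functions on R whose extension by 0 outside [0,1]
   lies in L^2(R). *)
Definition L2norm (u : R -> R) : \bar R := Lnorm mu 2%:E (EFin \o (u \_ I01)).

Definition opnorm (f : R * R -> R) : R :=
  fine (ereal_sup [set L2norm (kernel_op f u) | u in
    [set u | u \_ I01 \in Lfun mu 2%:E /\ (L2norm u <= 1)%E]]).

Definition opnormc (F : set (R * R -> R)) : R := opnorm (grepr F).

(* f^gamma_r *)
Definition bip_graphon (gamma r : R) : R * R -> R :=
  fun z => if (z.1 <= gamma) == (z.2 <= gamma) then 0 else r.

Definition block_graphon (gamma : R) : set (R * R -> R) :=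
  [set g : R * R -> R | graphon g /\ exists a b c : R, forall x y, I01 x -> I01 y ->
    g (x, y) = if (x <= gamma) && (y <= gamma) then a
               else if (gamma < x) && (gamma < y) then b else c].

Definition block_class (gamma : R) : set (set (R * R -> R)) :=
  [set F | gspace F /\ exists2 g, block_graphon gamma g & cut_distc F g = 0].

(* h_p(u) for p, u in [0,1].  As ln 0 = 0 and x / 0 = 0 in the library, the
   conventions 0 log 0 = 0 and 0 log (0/0) = 0 hold by computation. *)
Definition rel_entropy (p u : R) : \bar R :=
  if ((p == 0) || (p == 1)) && (u != p) then +oo%E
  else (u * ln (u / p) + (1 - u) * ln ((1 - u) / (1 - p)))%:E.

(* The pointwise supremum of the convex functions below phi on [0,1] is itself
   convex, hence it is the largest one. *)
Definition convex_minorant (phi : R -> \bar R) (x : R) : \bar R :=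
  ereal_sup [set (g x)%:E | g in [set g : R -> R |
    convex_function (I01 : set (convex_lmodType R^o)) (g : R^o -> R^o) /\
    forall y, I01 y -> ((g y)%:E <= phi y)%E]].

Definition rate_labelled (W0 f : R * R -> R) : \bar R :=
  ((2^-1)%:E * \int[mu2]_(z in I01 `*` I01) rel_entropy (W0 z) (f z))%E.

Definition Omega (W0 : R * R -> R) : set (R * R) :=
  (I01 `*` I01) `&` [set z | 0 < W0 z < 1].

Definition graphon_Omega (W0 : R * R -> R) : set (R * R -> R) :=
  [set f : R * R -> R | graphon f /\
    {ae mu2, forall z, ((I01 `*` I01) `\` Omega W0) z -> f z = W0 z}].

Definition gspace_Omega (W0 : R * R -> R) : set (set (R * R -> R)) :=
  [set F | gspace F /\ exists2 g, graphon_Omega W0 g & cut_distc F g = 0].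

(* J_{W_0} *)
Definition rate (W0 : R * R -> R) (F : set (R * R -> R)) : \bar R :=
  if `[< gspace_Omega W0 F >] then
    ereal_sup [set ereal_inf [set rate_labelled W0 h | h in
                 [set h | graphon h /\ cut_distc F h <= eta]]
              | eta in [set eta : R | 0 < eta]]
  else +oo%E.

Definition is_minimizer (W0 : R * R -> R) (tau : set (R * R -> R) -> R)
    (t : R) (G : set (R * R -> R)) : Prop :=
  [/\ gspace G, t <= tau G &
    forall F, gspace F -> t <= tau F -> (rate W0 G <= rate W0 F)%E].

Definition le_max_Omega (W0 : R * R -> R) (tau : set (R * R -> R) -> R)
    (t : R) : Prop :=
  exists G, [/\ gspace_Omega W0 G,
    (forall F, gspace_Omega W0 F -> tau F <= tau G) & t <= tau G].

Definition symmetric_regime (gamma : R) (W0 : R * R -> R)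
    (tau : set (R * R -> R) -> R) (t : R) : Prop :=
  le_max_Omega W0 tau t /\
  forall G, is_minimizer W0 tau t G -> block_class gamma G.

Definition unique_solution (W0 : R * R -> R) (tau : set (R * R -> R) -> R)
    (t : R) (G : set (R * R -> R)) : Prop :=
  [/\ gspace_Omega W0 G, is_minimizer W0 tau t G &
    forall F, gspace_Omega W0 F -> is_minimizer W0 tau t F -> F = G].

End Graphons.

(* Main.v *)
Require Import Defs.
From mathcomp Require Import all_boot all_order all_algebra.
From mathcomp Require Import all_classical all_reals all_analysis.
From mathcomp Require Import measurable_realfun.
From mathcomp Require Import ring lra.
Set Implicit Arguments.
Unset Strict Implicit.
Unset Printing Implicit Defensive.
Import Order.TTheory GRing.Theory Num.Theory.
Import numFieldNormedType.Exports.

(** Write [A = [0, gamma]], [B = (gamma, 1]] and [G = gamma (1 - gamma)], and call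
    a graphon bipartite when it vanishes on [A x A] and on [B x B].  A graphon of
    finite rate for [W0 = bip_graphon gamma p] vanishes a.e. on the two diagonal
    blocks, and the rate of a bipartite graphon [h] is its entropy, the integral of
    [ent p h] over [A x B].  The rate of a class is therefore an infimum of
    entropies of bipartite graphons approaching it ([rate_approx]); as the operator
    norm is continuous for the cut distance ([opnorm_cont]), a lower bound for the
    entropy of all bipartite graphons whose norm is almost [t] is a lower bound for
    the rate of all competitors ([rate_ge]).

    The symmetric regime.  The norm of a bipartite [h] is at most the Hilbert-Schmidt
    norm of its block, with equality for a constant block, so that
    [t ^ 2 = r ^ 2 G] and any competitor satisfies
    [int_(A x B) h ^ 2 >= r ^ 2 G].  If [(r ^ 2, h_p(r))] is on the convex minorant
    of [x |-> h_p(sqrt x)], then, for [r < 1], this function has a supporting line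
    at [r ^ 2] ([chord_tangent]); its slope is nonnegative because [p <= r], and
    integrating the line over [A x B] bounds the entropy below by [G h_p(r)].  For
    uniqueness one needs to know where the line touches: [contact_one_sided]
    shows that at least one side of [r] is free of contact points, so
    that the excess of entropy and the deficit of the squared norm together control
    the distance of [h] to the constant [r] ([ent_stability]).  Almost optimal
    bipartite graphons are then close in L^1 to [bip_graphon gamma r], and
    every minimizer is its class.  At [r = 1] there is no supporting line, and
    steeper and steeper lines replace it ([ent_minorant_lower]).

    Symmetry breaking.  If [(r ^ 2, h_p(r))] is not on the minorant, then [r < 1] and
    some chord of [h_p(sqrt x)] passes below it.  Splitting [A] in two parts and
    giving the block the two values at the ends of the chord produces a bipartite
    graphon of norm at least [t] and entropy below [G h_p(r)]
    ([params_of_chord_failure]).  On the other hand a class of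
    block graphons which has finite rate is the class of a constant [k] on [A x B],
    and [k >= r] if its norm is at least [t], so its rate is at least [G h_p(r)]
    ([block_rate_lower]).  Hence no minimizer is a block class, and it remains to see
    that there is a minimizer at all, for which a finite-dimensional compactness
    argument suffices.  Given a bipartite [h] and an almost optimal test vector, the
    entropy and the norm are integrals over the rows, and two integral inequalities
    can be realized by a convex combination of two rows ([two_point]); applying
    this to the rows and then to the columns gives a two by two kernel which is
    almost as good as [h] ([two_by_two_reduction]).  These kernels are
    described by finitely many numbers in a compact box, on which the minimum is
    attained ([minimal_params]). *)

(** * Bounded measurable functions on the unit interval and the unit square *)

Section BoundedMeasurable.
Context {R : realType}.
Local Open Scope classical_set_scope.
Local Open Scope ring_scope.

Local Notation mu := (@lebesgue_measure R).
Local Notation mu2 := (mu \x mu)%E.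
Local Notation RR := (measurableTypeR R).
Local Notation I := (@I01 R : set RR).

(** Bounded measurable functions: closed under the algebra below and integrable on
    sets of finite measure, so that no integrability side condition remains. *)
Definition bm d (T : measurableType d) (D : set T) (f : T -> R) : Prop :=
  measurable_fun D f /\ exists M, forall x, D x -> `|f x| <= M.

Definition bm1 (u : R -> R) : Prop := @bm _ RR I u.

Definition bm2 (G : R -> R -> R) : Prop :=
  @bm _ (RR * RR)%type (I `*` I) (fun z => G z.1 z.2).

Definition E1 (u : R -> R) : R := \int[mu]_(x in I) u x.

(** Iterated rather than double, so that facts about [E2] follow from facts about [E1];
    [Fubini12] ties it to the product measure. *)
Definition E2 (G : R -> R -> R) : R := E1 (fun x => E1 (G x)).

Lemma measurable_I01 : measurable I.
Proof. exact: measurable_itv. Qed.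

Lemma mu_I01 : mu I = 1%E.
Proof.
by rewrite /I01 lebesgue_measure_itv/= lte_fin ltr01 oppr0 adde0.
Qed.

Lemma mu_I01_lty : (mu I < +oo)%E.
Proof. by rewrite mu_I01 ltry. Qed.

Lemma I01P x : I x <-> 0 <= x <= 1.
Proof. by rewrite /I01 /= in_itv. Qed.

Lemma measurable_le_ind d (T : measurableType d) (D : set T) (a b : T -> R) :
  measurable_fun D a -> measurable_fun D b ->
  measurable_fun D (fun x => ((a x <= b x)%R)%:R : R).
Proof.
move=> ma mb.
have := @measurable_fun_ifT _ _ bool R (cst 1) (cst 0) id.
move=> /(_ (@measurable_id _ _ _) (@measurable_cst _ _ _ _ _ _) (@measurable_cst _ _ _ _ _ _)).
move=> mif; have := measurableT_comp mif (measurable_fun_ler ma mb).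
by apply: eq_measurable_fun => x _ /=; case: (a x <= b x).
Qed.

Section generic.
Context d (T : measurableType d) (D : set T).
Implicit Types f g : T -> R.

Lemma bm_cst c : bm D (fun=> c).
Proof. by split; [exact: measurable_cst | exists `|c|]. Qed.

Lemma bmD f g : bm D f -> bm D g -> bm D (fun x => f x + g x).
Proof.
move=> [mf [M Mf]] [mg [N Ng]]; split; first exact: measurable_funD.
by exists (M + N) => x Dx; rewrite (le_trans (ler_normD _ _))// lerD ?Mf ?Ng.
Qed.

Lemma bmN f : bm D f -> bm D (fun x => - f x).
Proof.
move=> [mf [M Mf]]; split; first exact: measurable_funN.
by exists M => x Dx; rewrite normrN Mf.
Qed.

Lemma bmB f g : bm D f -> bm D g -> bm D (fun x => f x - g x).
Proof. by move=> bf bg; apply: (bmD bf (bmN bg)). Qed.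

Lemma bmM f g : bm D f -> bm D g -> bm D (fun x => f x * g x).
Proof.
move=> [mf [M Mf]] [mg [N Ng]]; split; first exact: measurable_funM.
by exists (M * N) => x Dx; rewrite normrM ler_pM ?Mf ?Ng.
Qed.

Lemma bmX f n : bm D f -> bm D (fun x => f x ^+ n).
Proof.
move=> [mf [M Mf]]; split; first exact: measurable_funX.
by exists (M ^+ n) => x Dx; rewrite normrX lerXn2r ?nnegrE ?(le_trans _ (Mf _ Dx)) ?Mf.
Qed.

Lemma bm_norm f : bm D f -> bm D (fun x => `|f x|).
Proof.
move=> [mf [M Mf]]; split; first exact: (measurableT_comp (@normr_measurable R setT)).
by exists M => x Dx; rewrite normr_id Mf.
Qed.

Lemma eq_bm f g : (forall x, D x -> f x = g x) -> bm D f -> bm D g.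
Proof.
move=> fg [mf [M Mf]]; split.
  by apply: eq_measurable_fun mf => x /[!inE] Dx; exact: fg.
by exists M => x Dx; rewrite -fg ?Mf.
Qed.

Lemma bm_comp (h : R -> R) f (a b c : R) : measurable_fun setT h ->
  (forall x, D x -> a <= f x <= b) -> (forall y, a <= y <= b -> `|h y| <= c) ->
  bm D f -> bm D (fun x => h (f x)).
Proof.
move=> mh fab hc [mf _]; split; first exact: (measurableT_comp mh).
by exists c => x Dx; apply/hc/fab.
Qed.

Lemma bm_le f g : bm D f -> bm D g -> bm D (fun x => ((f x <= g x)%R)%:R).
Proof.
move=> [mf _] [mg _]; split; first exact: measurable_le_ind.
by exists 1 => x _; case: (f x <= g x); rewrite ?normr1 ?normr0.
Qed.

Lemma bm_indic (A : set T) : measurable A -> bm D (fun x => \1_A x).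
Proof.
move=> mA; split; first exact: measurable_indic.
by exists 1 => x _; rewrite indicE; case: (x \in A); rewrite ?normr1 ?normr0.
Qed.

End generic.

Lemma bm_integrable d (T : measurableType d) (D : set T)
    (m : {measure set T -> \bar R}) f :
  measurable D -> (m D < +oo)%E -> bm D f -> m.-integrable D (EFin \o f).
Proof.
move=> mD mDoo [mf [M Mf]]; apply: measurable_bounded_integrable => //.
exists `|M|; split; first exact: normr_real.
move=> N MN x Dx; apply: (le_trans (Mf _ Dx)).
by rewrite (le_trans (ler_norm M))// ltW.
Qed.

Lemma bm1_int u : bm1 u -> mu.-integrable I (EFin \o u).
Proof.
by move=> bu; apply: bm_integrable => //; [exact: measurable_I01 | exact: mu_I01_lty].
Qed.

Lemma eq_E1 u v : (forall x, I x -> u x = v x) -> E1 u = E1 v.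
Proof. by move=> uv; apply: eq_Rintegral => x /[!inE]; exact: uv. Qed.

Lemma E1D u v : bm1 u -> bm1 v -> E1 (fun x => u x + v x) = E1 u + E1 v.
Proof.
by move=> /bm1_int iu /bm1_int iv; rewrite /E1 RintegralD//; exact: measurable_I01.
Qed.

Lemma E1B u v : bm1 u -> bm1 v -> E1 (fun x => u x - v x) = E1 u - E1 v.
Proof.
by move=> /bm1_int iu /bm1_int iv; rewrite /E1 RintegralB//; exact: measurable_I01.
Qed.

Lemma E1Z c u : bm1 u -> E1 (fun x => c * u x) = c * E1 u.
Proof.
by move=> /bm1_int iu; rewrite /E1 RintegralZl//; exact: measurable_I01.
Qed.

Lemma E1Zr c u : bm1 u -> E1 (fun x => u x * c) = E1 u * c.
Proof.
by move=> /bm1_int iu; rewrite /E1 RintegralZr//; exact: measurable_I01.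
Qed.

Lemma E1_cst c : E1 (fun=> c) = c.
Proof.
rewrite /E1; have /(_ c) := @Rintegral_cst _ _ R mu _ measurable_I01.
by move=> ->; rewrite [X in _ * fine X](_ : _ = 1%E) ?mulr1//; exact: mu_I01.
Qed.

Lemma E1_ge0 u : (forall x, I x -> 0 <= u x) -> 0 <= E1 u.
Proof. exact: (@Rintegral_ge0 _ _ R mu I u). Qed.

Lemma E1_le u v : bm1 u -> bm1 v -> (forall x, I x -> u x <= v x) -> E1 u <= E1 v.
Proof.
by move=> /bm1_int iu /bm1_int iv uv; apply: le_Rintegral => //; exact: measurable_I01.
Qed.

Lemma E1_abs u : bm1 u -> `|E1 u| <= E1 (fun x => `|u x|).
Proof.
by move=> /bm1_int iu; apply: le_normr_Rintegral => //; exact: measurable_I01.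
Qed.

Lemma E1_norm_le u c : bm1 u -> (forall x, I x -> `|u x| <= c) -> `|E1 u| <= c.
Proof.
move=> bu uc; apply: (le_trans (E1_abs bu)); rewrite -[leRHS]E1_cst.
by apply: E1_le => //; [exact: bm_norm | exact: bm_cst].
Qed.

Let Q : set (RR * RR) := I `*` I.

Lemma measurable_Q : measurable Q.
Proof. by apply: measurableX; exact: measurable_I01. Qed.

Lemma mu2_Q : mu2 Q = 1%E.
Proof.
apply: (eq_trans (product_measure1E mu mu measurable_I01 measurable_I01)).
by rewrite [X in (X * X)%E](_ : _ = 1%E) ?mule1//; exact: mu_I01.
Qed.

Lemma mu2_Q_lty : (mu2 Q < +oo)%E.
Proof. by rewrite mu2_Q ltry. Qed.

Lemma bm2_int G : bm2 G -> mu2.-integrable Q (EFin \o (fun z => G z.1 z.2)).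
Proof.
by move=> bu; apply: bm_integrable => //; [exact: measurable_Q | exact: mu2_Q_lty].
Qed.

Lemma bm2_fst u : bm1 u -> bm2 (fun x _ => u x).
Proof.
move=> [mu0 [M Mu]]; split.
  apply: (measurable_comp measurable_I01 _ mu0); last by apply: measurable_funTS; exact: measurable_fst.
  by move=> _ [z [z1 _] <-].
by exists M => z [z1 _]; exact: Mu.
Qed.

Lemma bm2_snd u : bm1 u -> bm2 (fun _ y => u y).
Proof.
move=> [mu0 [M Mu]]; split.
  apply: (measurable_comp measurable_I01 _ mu0); last by apply: measurable_funTS; exact: measurable_snd.
  by move=> _ [z [_ z2] <-].
by exists M => z [_ z2]; exact: Mu.
Qed.

Lemma bm2_swap G : bm2 G -> bm2 (fun x y => G y x).
Proof.
move=> [mG [M MG]]; split.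
  apply: (measurable_comp measurable_Q _ mG (g := fun z : RR * RR => (z.2, z.1))).
    by move=> _ [z [z1 z2] <-]; split.
  by apply: measurable_funTS; exact: measurable_swap.
by exists M => z [z1 z2]; apply: (MG (z.2, z.1)).
Qed.

Lemma bm2_row G x : bm2 G -> I x -> bm1 (G x).
Proof.
move=> [mG [M MG]] Ix; split.
  apply: (measurable_comp measurable_Q _ mG (g := fun y : RR => (x, y) : RR * RR)).
    by move=> _ [y Iy <-]; split.
  by apply: measurable_funTS; exact: pair1_measurable.
by exists M => y Iy; apply: (MG (x, y)).
Qed.

Let GT G : bm2 G -> mu2.-integrable setT (EFin \o ((fun z => G z.1 z.2) \_ Q)).
Proof.
move=> /bm2_int iG; rewrite -restrict_EFin.
exact: (iffLR (integrable_mkcond _ measurable_Q) iG).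
Qed.

Let GTE G x : (\int[mu]_y (EFin \o ((fun z => G z.1 z.2) \_ Q)) (x, y))%E =
  if x \in I then (\int[mu]_(y in I) (G x y)%:E)%E else 0%E.
Proof.
case: ifPn => [xI|xI].
  rewrite [RHS]integral_mkcond; apply: eq_integral => y _ /=.
  by rewrite !patchE in_setX/= xI/=; case: ifP.
by apply: integral0_eq => y _ /=; rewrite patchE in_setX/= (negbTE xI).
Qed.

Lemma bm2_marginal G : bm2 G -> bm1 (fun x => E1 (G x)).
Proof.
move=> bG; split; last first.
  have [_ [M MG]] := bG; exists M => x Ix; apply: E1_norm_le; first exact: bm2_row.
  by move=> y Iy; apply: (MG (x, y)).
have := measurable_fubini_F (GT bG).
move=> /(measurable_funTS (D := I)) mF.
apply: (measurableT_comp (fine_measurable measurableT)).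
apply: eq_measurable_fun mF => x xI.
by rewrite /fubini_F GTE xI.
Qed.

Lemma Fubini12 G : bm2 G -> (\int[mu2]_(z in Q) (G z.1 z.2)%:E = (E2 G)%:E)%E.
Proof.
move=> bG; have := integral12_prod_meas1 (GT bG).
rewrite [in X in _ = X -> _](_ : (EFin \o _) = (EFin \o (fun z => G z.1 z.2)) \_ Q); last first.
  by rewrite restrict_EFin.
rewrite -integral_mkcond => <-.
rewrite /E2 /E1 /fubini_F /Rintegral.
have iE := bm1_int (bm2_marginal bG).
rewrite fineK; last first.
  by apply: integrable_fin_num iE; exact: measurable_I01.
rewrite [RHS]integral_mkcond; apply: eq_integral => x _.
rewrite GTE patchE; case: ifPn => // xI.
rewrite /= fineK//; apply: integrable_fin_num; first exact: measurable_I01.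
by apply: bm1_int; apply: bm2_row => //; rewrite -inE.
Qed.

Lemma E2_swap G : bm2 G -> E2 G = E2 (fun x y => G y x).
Proof.
move=> bG; have bG' := bm2_swap bG.
pose H (F : R -> R -> R) := EFin \o ((fun z => F z.1 z.2) \_ Q).
have H12 F : bm2 F -> (\int[mu2]_z H F z)%E = (E2 F)%:E.
  by move=> bF; rewrite -(Fubini12 bF) [in RHS]integral_mkcond; apply: eq_integral => z _; rewrite /H /= !patchE; case: ifP.
apply: EFin_inj; rewrite -(H12 _ bG) -(H12 _ bG').
apply: (eq_trans (esym (integral12_prod_meas1 (GT bG)))).
apply: (eq_trans _ (integral21_prod_meas1 (GT bG'))).
apply: eq_integral => x _; rewrite /fubini_F /fubini_G; apply: eq_integral => y _.
congr EFin; rewrite !patchE /Q.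
rewrite (_ : ((x, y) \in I `*` I) = ((y, x) \in I `*` I))//.
by rewrite !in_setX /= andbC.
Qed.

Lemma Rintegral_Q G : bm2 G -> \int[mu2]_(z in Q) G z.1 z.2 = E2 G.
Proof. by move=> bG; rewrite /Rintegral Fubini12. Qed.

End BoundedMeasurable.

(** * Integrals and changes of variable *)

(** Closes the boundedness and measurability goals for algebraic combinations of
    hypotheses in context. *)
Ltac bmt := rewrite ?/bm1 ?/bm2; repeat first
  [ assumption | exact: bm_cst | apply: bm2_fst; assumption | apply: bm2_snd; assumption
  | apply: bmX | apply: bmB | apply: bmD | apply: bmN | apply: bmM
  | apply: bm_norm | apply: bm2_fst; rewrite ?/bm1 | apply: bm2_snd; rewrite ?/bm1
  | apply: bm2_marginal; rewrite ?/bm2 ].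

Section Integrals.
Context {R : realType}.
Local Open Scope classical_set_scope.
Local Open Scope ring_scope.

Local Notation mu := (@lebesgue_measure R).
Local Notation RR := (measurableTypeR R).
Local Notation I := (@I01 R : set RR).
Implicit Types (u v : R -> R) (F G : R -> R -> R).

Lemma eq_E2 F G : (forall x y, I x -> I y -> F x y = G x y) -> E2 F = E2 G.
Proof. by move=> FG; apply: eq_E1 => x Ix; apply: eq_E1 => y Iy; exact: FG. Qed.

Lemma E2D F G : bm2 F -> bm2 G -> E2 (fun x y => F x y + G x y) = E2 F + E2 G.
Proof.
move=> bF bG; rewrite /E2 -E1D; [|exact: bm2_marginal..].
by apply: eq_E1 => x Ix; rewrite E1D//; exact: bm2_row.
Qed.

Lemma E2B F G : bm2 F -> bm2 G -> E2 (fun x y => F x y - G x y) = E2 F - E2 G.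
Proof.
move=> bF bG; rewrite /E2 -E1B; [|exact: bm2_marginal..].
by apply: eq_E1 => x Ix; rewrite E1B//; exact: bm2_row.
Qed.

Lemma E2Z c F : bm2 F -> E2 (fun x y => c * F x y) = c * E2 F.
Proof.
move=> bF; rewrite /E2 -E1Z; [|exact: bm2_marginal..].
by apply: eq_E1 => x Ix; rewrite E1Z//; exact: bm2_row.
Qed.

Lemma E2_le F G : bm2 F -> bm2 G -> (forall x y, I x -> I y -> F x y <= G x y) ->
  E2 F <= E2 G.
Proof.
move=> bF bG FG; apply: E1_le; [exact: bm2_marginal..|] => x Ix.
by apply: E1_le; [exact: bm2_row..|] => y Iy; exact: FG.
Qed.

Lemma E2_ge0 F : (forall x y, I x -> I y -> 0 <= F x y) -> 0 <= E2 F.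
Proof. by move=> F0; apply: E1_ge0 => x Ix; apply: E1_ge0 => y Iy; exact: F0. Qed.

Lemma E2_abs F : bm2 F -> `|E2 F| <= E2 (fun x y => `|F x y|).
Proof.
move=> bF; apply: le_trans (E1_abs (bm2_marginal bF)) _.
apply: E1_le => [||x Ix]; first exact/bm_norm/bm2_marginal.
  exact/bm2_marginal/bm_norm.
by apply: E1_abs; exact: bm2_row.
Qed.

Lemma E2_prod u v : bm1 u -> bm1 v -> E2 (fun x y => u x * v y) = E1 u * E1 v.
Proof.
by move=> bu bv; rewrite /E2 -E1Zr//; apply: eq_E1 => x Ix; rewrite E1Z.
Qed.

Lemma E2E F : E2 F = E1 (fun x => E1 (F x)).
Proof. by []. Qed.

Lemma CauchySchwarz u v : bm1 u -> bm1 v ->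
  (E1 (fun x => u x * v x)) ^+ 2 <= E1 (fun x => u x ^+ 2) * E1 (fun x => v x ^+ 2).
Proof.
move=> bu bv; set c := E1 _; set a := E1 _; set b := E1 _.
have a0 : 0 <= a by apply: E1_ge0 => x _; exact: sqr_ge0.
have b0 : 0 <= b by apply: E1_ge0 => x _; exact: sqr_ge0.
have H s t : 0 <= s ^+ 2 * a - (2 * s * t) * c + t ^+ 2 * b.
  rewrite /a /b /c -!E1Z; [|bmt..].
  rewrite -E1B -?E1D; [|bmt..].
  apply: E1_ge0 => x _.
  rewrite (_ : _ + _ = (s * u x - t * v x) ^+ 2) ?sqr_ge0//; ring.
have [b00|b00] := eqVneq b 0; last first.
  have b1 : 0 < b by rewrite lt_neqAle eq_sym b00.
  have : 0 <= b * (a * b - c ^+ 2) by have := H b c; nra.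
  by rewrite pmulr_rge0// subr_ge0.
rewrite b00 mulr0.
have := H 1 ((a + 1) / 2 / c); rewrite b00 mulr0 addr0 expr1n mul1r mulr1.
have [->|c0] := eqVneq c 0; first by rewrite expr0n.
rewrite (_ : 2 * _ * c = a + 1); last by field.
by rewrite opprD addrA subrr sub0r oppr_ge0 ler10.
Qed.

End Integrals.

Section MeasurePreserving.
Context {R : realType}.
Local Open Scope classical_set_scope.
Local Open Scope ring_scope.

Local Notation mu := (@lebesgue_measure R).
Local Notation RR := (measurableTypeR R).
Local Notation I := (@I01 R : set RR).
Implicit Types (u v : R -> R) (F G : R -> R -> R) (phi psi : R -> R).

Lemma mp_I01 phi x : mp_bijection phi -> I x -> I (phi x).
Proof. by move=> [[fI _ _] _ _ _]; exact: fI. Qed.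

Lemma mp_id : mp_bijection (fun x : R => x).
Proof.
split.
- by split=> // x Ix; exists x.
- exact: measurable_id.
- by move=> A mA _; rewrite image_id.
- by move=> A mA AI; congr (mu _); apply/seteqP; split=> [x []//|x Ax]; split=> //; exact: AI.
Qed.

Lemma mp_comp phi psi : mp_bijection phi -> mp_bijection psi ->
  mp_bijection (phi \o psi).
Proof.
move=> mphi mpsi.
have [bphi mf mi pf] := mphi; have [bpsi mg mj pg] := mpsi.
split.
- exact: set_bij_comp bpsi bphi.
- apply: (measurable_comp measurable_I01 _ mf mg).
  by move=> _ [x Ix <-]; exact: mp_I01.
- move=> A mA AI; rewrite -image_comp; apply: mi; first exact: mj.
  by move=> _ [x Ax <-]; apply: mp_I01 => //; exact: AI.
- move=> A mA AI; rewrite -(pf _ mA AI).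
  rewrite -[in RHS]pg; last 2 first.
  + exact: mf measurable_I01 _ mA.
  + by move=> x [].
  congr (mu _); apply/seteqP; split=> [x [Ix Ax]|x [Ix [_ Ax]]]; split=> //.
  by split=> //; exact: mp_I01.
Qed.

(** The inverse is measurable because images of measurable sets under a
    measure-preserving bijection are, by definition, measurable. *)
Lemma mp_inv phi : mp_bijection phi -> exists psi, [/\ mp_bijection psi,
  (forall x, I x -> psi (phi x) = x) & (forall y, I y -> phi (psi y) = y)].
Proof.
move=> mphi; have [[fI finj fsurj] mf mi pf] := mphi.
pose psi y := xget (0 : R) [set x | I x /\ phi x = y].
have psiP y : I y -> I (psi y) /\ phi (psi y) = y.
  move=> Iy; rewrite /psi; case: xgetP => [x -> []//|].
  by have [x Ix xy] := fsurj _ Iy => /(_ x) [].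
have psiK x : I x -> psi (phi x) = x.
  move=> Ix; have [] := psiP _ (fI _ Ix) => I1 I2.
  by apply: finj; rewrite ?inE.
have preim Y : I `&` psi @^-1` Y = phi @` (I `&` Y).
  apply/seteqP; split=> [y [Iy Yy]|_ [x [Ix Yx] <-]].
    by have [? ?] := psiP _ Iy; exists (psi y).
  by split; [exact: fI | rewrite /= psiK].
exists psi; split=> //; last by move=> y /psiP[].
split.
- split.
  + by move=> y Iy; have [] := psiP _ Iy.
  + move=> y1 y2 /[!inE] /psiP[_ e1] /psiP[_ e2] e.
    by rewrite -e1 -e2 e.
  + by move=> x Ix; exists (phi x); [exact: fI | exact: psiK].
- move=> _ Y mY; rewrite preim; apply: mi; last by move=> x [].
  by apply: measurableI => //; exact: measurable_I01.
- move=> A mA AI.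
  rewrite (_ : psi @` A = I `&` phi @^-1` A); first exact: mf measurable_I01 _ mA.
  apply/seteqP; split=> [_ [y Ay <-]|x [Ix Ax]].
    by have [? e] := psiP _ (AI _ Ay); split=> //=; rewrite e.
  by exists (phi x) => //; exact: psiK.
- move=> A mA AI; rewrite preim (setIidr AI) -pf; last 2 first.
  + exact: mi.
  + by move=> _ [x Ax <-]; apply: fI; exact: AI.
  congr (mu _); apply/seteqP; split=> [x [Ix [y Ay e]]|x Ax].
    by rewrite -(finj y x)// inE//; exact: AI.
  by split; [exact: AI | exists x].
Qed.

Lemma bm1_mp phi u : mp_bijection phi -> bm1 u -> bm1 (fun x => u (phi x)).
Proof.
move=> mphi [mu0 [M Mu]]; split.
  have [_ mf _ _] := mphi.
  apply: (measurable_comp measurable_I01 _ mu0 mf).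
  by move=> _ [x Ix <-]; exact: mp_I01.
by exists M => x Ix; apply: Mu; exact: mp_I01.
Qed.

Lemma bm2_mp phi F : mp_bijection phi -> bm2 F -> bm2 (fun x y => F (phi x) (phi y)).
Proof.
move=> mphi [mF [M MF]]; split; last first.
  by exists M => -[x y] [Ix Iy]; apply: (MF (phi x, phi y)); split; exact: mp_I01.
have [_ mf _ _] := mphi.
apply: (measurable_comp measurable_Q _ mF (g := fun z : RR * RR => (phi z.1, phi z.2))).
  by move=> _ [z [z1 z2] <-]; split; exact: mp_I01.
have m1 : @measurable_fun _ _ (RR * RR)%type RR (I `*` I) (fun z => phi z.1).
  apply: (measurable_comp measurable_I01 _ mf); last by apply: measurable_funTS; exact: measurable_fst.
  by move=> _ [z [z1 _] <-].
have m2 : @measurable_fun _ _ (RR * RR)%type RR (I `*` I) (fun z => phi z.2).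
  apply: (measurable_comp measurable_I01 _ mf); last by apply: measurable_funTS; exact: measurable_snd.
  by move=> _ [z [_ z2] <-].
move/(measurable_restrictT _ measurable_Q) in m1.
move/(measurable_restrictT _ measurable_Q) in m2.
have m3 := measurable_funTS (D := I `*` I) (measurable_fun_pair m1 m2).
by apply: eq_measurable_fun m3 => z zQ; rewrite !patchE zQ.
Qed.

(** Change of variables on the whole line, after extending [phi] by the identity outside
    [0,1]: the extension pushes the Lebesgue measure to itself. *)
Lemma E1_mp phi u : mp_bijection phi -> bm1 u -> E1 (fun x => u (phi x)) = E1 u.
Proof.
move=> mphi bu; have [_ mf _ pf] := mphi.
pose f (x : RR) : RR := if x \in I then phi x else x.
have If (x : RR) : (f x \in I) = (x \in I).
  rewrite /f; case: ifPn => // xI.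
    by apply/idP; apply/mem_set; apply: mp_I01 => //; rewrite -inE.
  by rewrite (negbTE xI).
have mff : @measurable_fun _ _ RR RR setT f.
  have m1 := iffLR (measurable_restrictT phi measurable_I01) mf.
  have m2 : @measurable_fun _ _ RR RR setT (id \_ (~` I)).
    apply: (iffLR (measurable_restrictT _ (measurableC measurable_I01))).
    exact: measurable_id.
  apply: eq_measurable_fun (measurable_funD m1 m2) => x _ /=.
  by rewrite /f !patchE in_setC; case: (x \in I); rewrite ?addr0 ?add0r.
have pushE A : measurable A -> mu (f @^-1` A) = mu A.
  move=> mA.
  have -> : f @^-1` A = (I `&` phi @^-1` (A `&` I)) `|` (A `\` I).
    apply/seteqP; split=> x; rewrite /f /=.
      have [xI|xI] := pselect (I x).
        by rewrite (mem_set xI) => Ax; left; split=> //; split=> //; exact: mp_I01.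
      by rewrite (memNset xI) => Ax; right.
    by move=> [[xI [Ax _]]|[Ax /= xI]]; [rewrite mem_set | rewrite memNset].
  have mAI : measurable (A `&` I) by apply: measurableI => //; exact: measurable_I01.
  have mADI : measurable (A `\` I) by apply: measurableD => //; exact: measurable_I01.
  rewrite measureU//; last 2 first.
  - exact: mf measurable_I01 _ mAI.
  - by apply/seteqP; split=> // x [[xI _] [_ /= xnI]].
  rewrite [X in (X + _)%E](_ : _ = mu (A `&` I)); last by apply: pf => // x [].
  by rewrite [RHS](measureDI mu mA measurable_I01) addeC.
pose g : RR -> \bar R := EFin \o (u \_ I).
have mg : measurable_fun setT g.
  apply/measurable_EFinP; apply: (iffLR (measurable_restrictT u measurable_I01)).
  by case: bu.
have gf x : g (f x) = (EFin \o (fun x => u (phi x))) \_ I x.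
  by rewrite /g /= !patchE If /f; case: ifP => //= ->.
have ig : mu.-integrable (f @^-1` setT) (g \o f).
  rewrite preimage_setT.
  rewrite (_ : g \o f = (EFin \o (fun x => u (phi x))) \_ I); last first.
    by apply/funext => x; exact: gf.
  apply: (iffLR (integrable_mkcond _ measurable_I01)).
  by apply: bm1_int; exact: bm1_mp.
have e := integral_pushforward mff mg ig measurableT.
have e2 : (\int[pushforward mu f]_y g y = \int[mu]_y g y)%E.
  by apply: eq_measure_integral => A mA _; exact: pushE.
rewrite /E1 /Rintegral; congr fine.
rewrite [RHS](_ : _ = \int[mu]_x g x)%E; last first.
  by rewrite [LHS]integral_mkcond; apply: eq_integral => x _; rewrite /g /= !patchE; case: ifP.
rewrite -e2 e preimage_setT [LHS]integral_mkcond.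
by apply: eq_integral => x _; rewrite /= gf.
Qed.

End MeasurePreserving.

Lemma kernel_opE {R : realType} (f : R * R -> R) u x :
  kernel_op f u x = E1 (fun y => f (x, y) * u y)%R.
Proof. by []. Qed.

Opaque E1 E2 kernel_op.

(** * The cut distance *)

Section CutDistance.
Context {R : realType}.
Local Open Scope classical_set_scope.
Local Open Scope ring_scope.

Local Notation mu := (@lebesgue_measure R).
Local Notation mu2 := (mu \x mu)%E.
Local Notation RR := (measurableTypeR R).
Local Notation I := (@I01 R : set RR).
Implicit Types (u v : R -> R) (F G : R -> R -> R) (phi psi : R -> R).
Implicit Types (f g h : R * R -> R).

Lemma le_of_eq (a b : R) : a = b -> a <= b.
Proof. by move=> ->. Qed.

Lemma le_norm_eq (a b : R) : a = b -> `|a| <= `|b|.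
Proof. by move=> ->. Qed.

Lemma E2_mp phi F : mp_bijection phi -> bm2 F ->
  E2 (fun x y => F (phi x) (phi y)) = E2 F.
Proof.
move=> mphi bF; rewrite !E2E -(E1_mp mphi (bm2_marginal bF)).
apply: eq_E1 => x Ix; apply: (E1_mp mphi (bm2_row bF _)).
exact: mp_I01.
Qed.

Lemma graphon_bm2 f : graphon f -> bm2 (fun x y => f (x, y)).
Proof.
move=> [mf _ f01]; split.
  by apply: eq_measurable_fun mf => -[x y].
exists 1 => -[x y] [Ix Iy]; have := f01 _ _ Ix Iy => /andP[f0 f1].
by rewrite ger0_norm.
Qed.

Lemma graphon_sub_bm2 f g : graphon f -> graphon g ->
  bm2 (fun x y => f (x, y) - g (x, y)).
Proof. by move=> /graphon_bm2 bf /graphon_bm2 bg; apply: bmB. Qed.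

Lemma graphon_sub_le1 f g x y : graphon f -> graphon g -> I x -> I y ->
  `|f (x, y) - g (x, y)| <= 1.
Proof.
move=> [_ _ f01] [_ _ g01] Ix Iy.
have := f01 _ _ Ix Iy; have := g01 _ _ Ix Iy => /andP[? ?] /andP[? ?].
by rewrite ler_norml; apply/andP; split; lra.
Qed.

Lemma indic01 (S : set RR) x : 0 <= (\1_S x : R) <= 1.
Proof. by rewrite indicE; case: (x \in S); rewrite ?lexx ?ler01. Qed.

Lemma cut_integral f g (S T : set RR) : graphon f -> graphon g ->
  measurable S -> measurable T -> S `<=` I -> T `<=` I ->
  \int[mu2]_(z in S `*` T) (f z - g z) =
  E2 (fun x y => \1_S x * (\1_T y * (f (x, y) - g (x, y)))).
Proof.
move=> gf gg mS mT SI TI.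
have bS : bm1 (\1_S : RR -> R) by exact: bm_indic.
have bT : bm1 (\1_T : RR -> R) by exact: bm_indic.
have bW := graphon_sub_bm2 gf gg.
rewrite -Rintegral_Q; last by bmt.
have -> : S `*` T = (I `*` I) `&` (S `*` T).
  by rewrite setIC; apply/esym/setIidl => z [/SI ? /TI ?].
rewrite Rintegral_mkcondr; apply: eq_Rintegral => -[x y] _ /=.
by rewrite patchE in_setX /= !indicE; case: (x \in S); case: (y \in T);
  rewrite /= ?mul1r ?mul0r.
Qed.

Lemma cut_bound f g (S T : set RR) : graphon f -> graphon g ->
  measurable S -> measurable T ->
  `|E2 (fun x y => \1_S x * (\1_T y * (f (x, y) - g (x, y))))| <=
  E2 (fun x y => `|f (x, y) - g (x, y)|).
Proof.
move=> gf gg mS mT.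
have bS : bm1 (\1_S : RR -> R) by exact: bm_indic.
have bT : bm1 (\1_T : RR -> R) by exact: bm_indic.
have bW := graphon_sub_bm2 gf gg.
apply: (le_trans (E2_abs _)); first by bmt.
apply: E2_le; [by bmt..|] => x y Ix Iy.
rewrite !normrM; have /andP[S0 S1] := indic01 S x; have /andP[T0 T1] := indic01 T y.
by rewrite (ger0_norm S0) (ger0_norm T0) mulrA ler_piMl// mulr_ile1.
Qed.

Lemma E2_sub_le1 f g : graphon f -> graphon g ->
  E2 (fun x y => `|f (x, y) - g (x, y)|) <= 1.
Proof.
move=> gf gg; have bW := graphon_sub_bm2 gf gg.
rewrite [leRHS](_ : 1 = E2 (fun _ _ => 1)); last by rewrite E2E !E1_cst.
by apply: E2_le; [by bmt..|] => x y Ix Iy; exact: graphon_sub_le1.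
Qed.

Lemma cut_dist_labelled_ub f g (S T : set RR) : graphon f -> graphon g ->
  measurable S -> measurable T -> S `<=` I -> T `<=` I ->
  `|E2 (fun x y => \1_S x * (\1_T y * (f (x, y) - g (x, y))))| <=
  cut_dist_labelled f g.
Proof.
move=> gf gg mS mT SI TI; rewrite -cut_integral//.
apply: ub_le_sup; last by exists S, T.
exists 1 => _ [A [B [[mA AI] [mB BI] ->]]].
rewrite [X in `|X|](cut_integral gf gg mA mB AI BI).
exact: (le_trans (cut_bound gf gg mA mB) (E2_sub_le1 gf gg)).
Qed.

Lemma cut_dist_labelled_le f g c : graphon f -> graphon g ->
  (forall S T : set RR, measurable S -> measurable T -> S `<=` I -> T `<=` I ->
  `|E2 (fun x y => \1_S x * (\1_T y * (f (x, y) - g (x, y))))| <= c) ->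
  cut_dist_labelled f g <= c.
Proof.
move=> gf gg H; apply: ge_sup.
  exists (`|\int[mu2]_(z in set0 `*` set0) (f z - g z)|), set0, set0.
  by split=> //; split=> //; exact: measurable0.
move=> _ [A [B [[mA AI] [mB BI] ->]]].
rewrite [X in `|X|](cut_integral gf gg mA mB AI BI); exact: H.
Qed.

Lemma cut_dist_labelled_L1 f g : graphon f -> graphon g ->
  cut_dist_labelled f g <= E2 (fun x y => `|f (x, y) - g (x, y)|).
Proof. by move=> gf gg; apply: cut_dist_labelled_le => // S T *; exact: cut_bound. Qed.

Lemma cut_dist_labelled_ge0 f g : graphon f -> graphon g ->
  0 <= cut_dist_labelled f g.
Proof.
move=> gf gg; apply: le_trans (cut_dist_labelled_ub gf gg measurable0 measurable0 _ _) => //.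
Qed.

Lemma cut_dist_labelled_sym f g : graphon f -> graphon g ->
  cut_dist_labelled f g <= cut_dist_labelled g f.
Proof.
move=> gf gg; apply: cut_dist_labelled_le => // S T mS mT SI TI.
apply: le_trans (cut_dist_labelled_ub gg gf mS mT SI TI).
have bS : bm1 (\1_S : RR -> R) by exact: bm_indic.
have bT : bm1 (\1_T : RR -> R) by exact: bm_indic.
have bW := graphon_sub_bm2 gg gf.
move: (\1_S : RR -> R) (\1_T : RR -> R) bS bT => a b ba bb.
rewrite (_ : E2 _ = -1 * E2 (fun x y => a x * (b y * (g (x, y) - f (x, y))))).
  by rewrite mulN1r normrN lexx.
rewrite -E2Z; last by bmt.
apply: eq_E2 => x y _ _.
by move: (a x) (b y) (f _) (g _) => p q r s; ring.
Qed.

Lemma cut_dist_labelled_trans f g h : graphon f -> graphon g -> graphon h ->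
  cut_dist_labelled f h <= cut_dist_labelled f g + cut_dist_labelled g h.
Proof.
move=> gf gg gh; apply: cut_dist_labelled_le => // S T mS mT SI TI.
have bS : bm1 (\1_S : RR -> R) by exact: bm_indic.
have bT : bm1 (\1_T : RR -> R) by exact: bm_indic.
have b1 := graphon_sub_bm2 gf gg; have b2 := graphon_sub_bm2 gg gh.
apply: le_trans (lerD (cut_dist_labelled_ub gf gg mS mT SI TI)
  (cut_dist_labelled_ub gg gh mS mT SI TI)).
move: (\1_S : RR -> R) (\1_T : RR -> R) bS bT => a b ba bb.
rewrite (_ : E2 _ = E2 (fun x y => a x * (b y * (f (x, y) - g (x, y)))) +
  E2 (fun x y => a x * (b y * (g (x, y) - h (x, y))))); first exact: ler_normD.
rewrite -E2D; [|by bmt..].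
apply: eq_E2 => x y _ _.
by move: (a x) (b y) (f _) (g _) (h _) => p q r s t; ring.
Qed.

Lemma graphon_relabel f phi : mp_bijection phi -> graphon f -> graphon (relabel f phi).
Proof.
move=> mphi gf; have [_ fs f01] := gf.
split.
- have [+ _] := bm2_mp mphi (graphon_bm2 gf).
  by apply: eq_measurable_fun => -[x y].
- by move=> x y Ix Iy; rewrite /relabel /= fs//; exact: mp_I01.
- by move=> x y Ix Iy; rewrite /relabel /= f01//; exact: mp_I01.
Qed.

Lemma cut_dist_labelled_relabel f g phi : mp_bijection phi -> graphon f -> graphon g ->
  cut_dist_labelled (relabel f phi) (relabel g phi) <= cut_dist_labelled f g.
Proof.
move=> mphi gf gg; apply: cut_dist_labelled_le; [exact: graphon_relabel..|].
move=> S T mS mT SI TI.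
have [[fI finj _] _ mi _] := mphi.
have im (A : set RR) : A `<=` I -> phi @` A `<=` I.
  by move=> AI _ [x Ax <-]; apply: fI; exact: AI.
have ind (A : set RR) x : A `<=` I -> I x -> (\1_A x : R) = \1_(phi @` A) (phi x).
  move=> AI Ix; rewrite !indicE; congr (nat_of_bool _)%:R; apply/idP/idP => /set_mem H.
    by apply/mem_set; exists x.
  have [y Ay e] := H; apply/mem_set; rewrite -(_ : y = x)//.
  exact: (finj y x (mem_set (AI _ Ay)) (mem_set Ix) e).
apply: le_trans (cut_dist_labelled_ub gf gg (mi _ mS SI) (mi _ mT TI) (im _ SI) (im _ TI)).
have b1 : bm1 (\1_(phi @` S) : RR -> R) by apply: bm_indic; exact: mi.
have b2 : bm1 (\1_(phi @` T) : RR -> R) by apply: bm_indic; exact: mi.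
have bW := graphon_sub_bm2 gf gg.
rewrite -[X in _ <= `|X|](E2_mp mphi); last by bmt.
apply: le_norm_eq.
by apply: eq_E2 => x y Ix Iy; rewrite /relabel /= -(ind S) -?(ind T).
Qed.

Lemma relabel_id f : relabel f (fun x => x) = f.
Proof. by apply/funext => -[x y]. Qed.

Lemma cut_dist_le f g phi : graphon f -> graphon g -> mp_bijection phi ->
  cut_dist f g <= cut_dist_labelled f (relabel g phi).
Proof.
move=> gf gg mphi; apply: ge_inf; last by exists phi.
exists 0 => _ [psi mpsi <-]; apply: cut_dist_labelled_ge0 => //.
exact: graphon_relabel.
Qed.

Lemma cut_dist_le_labelled f g : graphon f -> graphon g ->
  cut_dist f g <= cut_dist_labelled f g.
Proof.
by move=> gf gg; rewrite -[in leRHS](relabel_id g); apply: cut_dist_le => //; exact: mp_id.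
Qed.

Lemma cut_dist_lt f g c : graphon f -> graphon g -> cut_dist f g < c ->
  exists2 phi, mp_bijection phi & cut_dist_labelled f (relabel g phi) < c.
Proof.
move=> gf gg fgc.
have [|_ [phi mphi <-] H] := inf_lt _ fgc; last by exists phi.
by exists (cut_dist_labelled f (relabel g (fun x => x))), (fun x => x) => //; exact: mp_id.
Qed.

Lemma cut_dist_ge0 f g : graphon f -> graphon g -> 0 <= cut_dist f g.
Proof.
move=> gf gg; apply: lb_le_inf.
  by exists (cut_dist_labelled f (relabel g (fun x => x))), (fun x => x) => //; exact: mp_id.
move=> _ [psi mpsi <-]; apply: cut_dist_labelled_ge0 => //.
exact: graphon_relabel.
Qed.

Lemma cut_dist_sym f g : graphon f -> graphon g -> cut_dist f g = cut_dist g f.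
Proof.
move=> gf gg; wlog suff H : f g gf gg / cut_dist f g <= cut_dist g f.
  by apply/le_anti/andP; split; exact: H.
apply/ler_addgt0Pr => e e0.
have [|phi mphi H] := @cut_dist_lt g f (cut_dist g f + e) gg gf; first by rewrite ltrDl.
have [psi [mpsi K1 K2]] := mp_inv mphi.
apply/(le_trans _ (ltW H))/(le_trans (cut_dist_le gf gg mpsi)).
have gfp := graphon_relabel mphi gf; have ggp := graphon_relabel mpsi gg.
apply: le_trans (cut_dist_labelled_relabel mpsi gg gfp).
apply: le_trans (cut_dist_labelled_sym gf ggp) _.
apply: cut_dist_labelled_le => // S T mS mT SI TI.
apply: le_trans (cut_dist_labelled_ub ggp (graphon_relabel mpsi gfp) mS mT SI TI).
apply: le_norm_eq.
by apply: eq_E2 => x y Ix Iy; rewrite {2 4}/relabel /= /relabel/= !K2.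
Qed.

Lemma cut_dist_trans f g h : graphon f -> graphon g -> graphon h ->
  cut_dist f h <= cut_dist f g + cut_dist g h.
Proof.
move=> gf gg gh; apply/ler_addgt0Pr => e e0.
have [|phi mphi H1] := @cut_dist_lt f g (cut_dist f g + e / 2) gf gg.
  by rewrite ltrDl divr_gt0.
have [|psi mpsi H2] := @cut_dist_lt g h (cut_dist g h + e / 2) gg gh.
  by rewrite ltrDl divr_gt0.
have mc := mp_comp mpsi mphi.
apply: (le_trans (cut_dist_le gf gh mc)).
have ggp := graphon_relabel mphi gg; have ghp := graphon_relabel mpsi gh.
apply: (le_trans (cut_dist_labelled_trans gf ggp (graphon_relabel mc gh))).
(* relabelling by [phi] does not increase the distance of [g] to [h] *)
have H3 : cut_dist_labelled (relabel g phi) (relabel h (psi \o phi)) <=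
    cut_dist_labelled g (relabel h psi) by apply: (cut_dist_labelled_relabel mphi gg ghp).
apply: (le_trans (lerD (ltW H1) (le_trans H3 (ltW H2)))).
by rewrite addrACA -splitr.
Qed.

Lemma cut_dist_refl f : graphon f -> cut_dist f f = 0.
Proof.
move=> gf; apply/le_anti; rewrite cut_dist_ge0// andbT.
apply: le_trans (cut_dist_le_labelled gf gf) _.
apply: le_trans (cut_dist_labelled_L1 gf gf) _.
rewrite (@eq_E2 _ _ (fun _ _ => 0)).
  by rewrite E2E !E1_cst lexx.
by move=> x y _ _; rewrite subrr normr0.
Qed.

(** A linear functional on functions with values in [0,1] is maximal at an indicator: that
    of the set where the density is nonnegative. *)
Lemma E1_mul_le u w : bm1 u -> bm1 w -> (forall x, I x -> 0 <= u x <= 1) ->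
  exists S : set RR, [/\ measurable S, S `<=` I &
    E1 (fun x => u x * w x) <= E1 (fun x => \1_S x * w x)].
Proof.
move=> bu bw u01.
have mS : measurable (I `&` w @^-1` `[0, +oo[).
  by have [mw _] := bw; apply: (mw measurable_I01 _ (measurable_itv _)).
exists (I `&` w @^-1` `[0, +oo[); split; [exact: mS | by move=> x []|].
have bS : bm1 (\1_(I `&` w @^-1` `[0, +oo[) : RR -> R) by exact: bm_indic.
apply: E1_le; [by bmt..|] => x Ix; have /andP[u0 u1] := u01 _ Ix.
rewrite indicE; case: (boolP (x \in _)); last first.
  move=> /negP H; have {}H : w x < 0.
    rewrite ltNge; apply/negP => w0; apply: H; apply/mem_set; split=> //=.
    by rewrite in_itv/= w0.
  by rewrite mul0r mulr_ge0_le0// ltW.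
by move=> /set_mem[_ /=]; rewrite in_itv/= andbT => w0; rewrite mul1r ler_piMl.
Qed.

(** The supremum defining the cut distance may be taken over weights with values in [0,1]
    instead of sets, by replacing one weight at a time by an indicator. *)
Lemma cut_dist_labelled_bilinear f g u v : graphon f -> graphon g ->
  bm1 u -> bm1 v -> (forall x, I x -> 0 <= u x <= 1) -> (forall x, I x -> 0 <= v x <= 1) ->
  E2 (fun x y => u x * (v y * (f (x, y) - g (x, y)))) <= cut_dist_labelled f g.
Proof.
move=> gf gg bu bv u01 v01.
have bW := graphon_sub_bm2 gf gg; have bW' := bm2_swap bW.
have b1 : bm2 (fun x y => v y * (f (x, y) - g (x, y))) by bmt.
have [S [mS SI]] := E1_mul_le bu (bm2_marginal b1) u01.
have bS : bm1 (\1_S : RR -> R) by exact: bm_indic.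
have rowZ w : E1 (fun x => w x * E1 (fun y => v y * (f (x, y) - g (x, y)))) =
    E2 (fun x y => w x * (v y * (f (x, y) - g (x, y)))).
  by rewrite E2E; apply: eq_E1 => x Ix; rewrite E1Z//; exact: bm2_row b1 Ix.
rewrite !rowZ => /le_trans; apply.
rewrite E2_swap; last by bmt.
have b2 : bm2 (fun y x => \1_S x * (f (x, y) - g (x, y))) by bmt; exact: bW'.
have [T [mT TI]] := E1_mul_le bv (bm2_marginal b2) v01.
have bT : bm1 (\1_T : RR -> R) by exact: bm_indic.
have colZ w : E1 (fun y => w y * E1 (fun x => \1_S x * (f (x, y) - g (x, y)))) =
    E2 (fun y x => \1_S x * (w y * (f (x, y) - g (x, y)))).
  rewrite E2E; apply: eq_E1 => y Iy; rewrite -E1Z; last exact: bm2_row b2 Iy.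
  by apply: eq_E1 => x _; rewrite mulrCA.
rewrite !colZ => /le_trans; apply.
rewrite -(E2_swap (G := fun x y => \1_S x * (\1_T y * (f (x, y) - g (x, y))))); last by bmt.
by apply: (le_trans (ler_norm _)); exact: cut_dist_labelled_ub.
Qed.

End CutDistance.
Opaque cut_dist cut_dist_labelled.

(** * The operator norm *)

Section OperatorNorm.
Context {R : realType}.
Local Open Scope classical_set_scope.
Local Open Scope ring_scope.

Local Notation mu := (@lebesgue_measure R).
Local Notation RR := (measurableTypeR R).
Local Notation I := (@I01 R : set RR).
Implicit Types (u v : R -> R) (f g h : R * R -> R).

(** The squared L^2 norm; squares avoid the square root in almost all estimates. *)
Definition nsq u : R := E1 (fun x => u x ^+ 2).

Lemma nsq_ge0 u : 0 <= nsq u.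
Proof. by apply: E1_ge0 => x _; exact: sqr_ge0. Qed.

Lemma graphon_row f x : graphon f -> I x -> bm1 (fun y => f (x, y)).
Proof. by move=> /graphon_bm2/bm2_row; exact. Qed.

Lemma graphon_normM f v x y : graphon f -> I x -> I y -> `|f (x, y) * v y| <= `|v y|.
Proof.
move=> [_ _ f01] Ix Iy; have /andP[f0 f1] := f01 _ _ Ix Iy.
by rewrite normrM ger0_norm// ler_piMl.
Qed.

Lemma bm1_kernel_op f v : graphon f -> bm1 v -> bm1 (kernel_op f v).
Proof.
move=> gf bv; have bf := graphon_bm2 gf.
suff : bm1 (fun x => E1 (fun y => f (x, y) * v y)).
  by apply: eq_bm => x _; rewrite kernel_opE.
by apply: (bm2_marginal (G := fun x y => f (x, y) * v y)); bmt.
Qed.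

Lemma E1_normr_le v : bm1 v -> E1 (fun y => `|v y|) <= (1 + nsq v) / 2.
Proof.
move=> bv; rewrite /nsq -[X in X + _]E1_cst -E1D; [|by bmt..].
rewrite -E1Zr; last by bmt.
apply: E1_le; [by bmt..|] => x _.
have := sqr_ge0 (`|v x| - 1); rewrite sqrrB1 real_normK ?num_real//.
by set a := `|v x|; set b := v x ^+ 2; lra.
Qed.

Lemma kernel_op_le f v x : graphon f -> bm1 v -> I x ->
  `|kernel_op f v x| <= E1 (fun y => `|v y|).
Proof.
move=> gf bv Ix; rewrite kernel_opE; have bx := graphon_row gf Ix.
apply: (le_trans (E1_abs _)); first by bmt.
by apply: E1_le; [by bmt..|] => y Iy; exact: graphon_normM.
Qed.

Lemma nsq_kernel_op_le1 f v : graphon f -> bm1 v -> nsq v <= 1 ->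
  nsq (kernel_op f v) <= 1.
Proof.
move=> gf bv v1; have bk := bm1_kernel_op gf bv.
rewrite /nsq -[leRHS](E1_cst (1 : R)); apply: E1_le; [by bmt..|] => x Ix.
rewrite -real_normK ?num_real// expr_le1//.
apply: (le_trans (kernel_op_le gf bv Ix)); apply: (le_trans (E1_normr_le bv)).
lra.
Qed.

Lemma Lnorm2E u : (Lnorm mu 2%:E (EFin \o (u \_ I)) =
  (\int[mu]_(x in I) (u x ^+ 2)%:E) `^ 2^-1)%E.
Proof.
rewrite unlock /Lnorm; congr (poweR _ _).
rewrite [RHS]integral_mkcond; apply: eq_integral => x _ /=.
rewrite !patchE; case: ifPn => _.
  by rewrite powR_mulrn// real_normK ?num_real.
by rewrite normr0 powR0.
Qed.

Transparent E1.
Lemma L2norm_bm u : bm1 u -> L2norm u = (Num.sqrt (nsq u))%:E.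
Proof.
move=> bu; rewrite /L2norm Lnorm2E.
have i2 : mu.-integrable I (EFin \o (fun x => u x ^+ 2)).
  by apply: bm1_int; bmt.
rewrite -(fineK (integrable_fin_num measurable_I01 i2)).
rewrite poweR_EFin powR12_sqrt//.
exact: nsq_ge0.
Qed.
Opaque E1.

Section unbounded.
Variables (f : R * R -> R) (u : R -> R) (c : R).
Hypotheses (gf : graphon f) (c0 : 0 <= c).
Hypotheses (mu_ : @measurable_fun _ _ RR RR I u)
  (iu2 : mu.-integrable I (EFin \o (fun x => u x ^+ 2)))
  (u1 : \int[mu]_(x in I) (u x ^+ 2) <= 1).
Hypothesis H : forall v, bm1 v -> nsq v <= 1 -> nsq (kernel_op f v) <= c ^+ 2.

Let tr (n : nat) x : R := u x * ((`|u x| <= n.+1%:R)%R)%:R.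

Let mI := @measurable_I01 R.

Let iu : mu.-integrable I (EFin \o u).
Proof.
apply: (@le_integrable _ _ _ mu I mI _ (fun x => ((1 + u x ^+ 2)%:E)%E)).
- exact/measurable_EFinP.
- move=> x Ix /=; rewrite lee_fin [leRHS]ger0_norm; last by rewrite addr_ge0// sqr_ge0.
  have := sqr_ge0 (`|u x| - 1); rewrite sqrrB1 real_normK ?num_real//.
  have := sqr_ge0 (u x); have := normr_ge0 (u x).
  by move: (`|u x|) (u x ^+ 2) => a b; lra.
- have i1 : mu.-integrable I (EFin \o (fun=> 1)) by apply: bm1_int; exact: bm_cst.
  exact: (integrableD mI i1 iu2).
Qed.

Let btr n : bm1 (tr n).
Proof.
split.
  apply: measurable_funM => //.
  apply: measurable_le_ind => //.
  exact: (measurableT_comp (@normr_measurable R setT)).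
exists n.+1%:R => x Ix; rewrite /tr; case: (boolP (`|u _| <= _)) => [?|_] /=.
  by rewrite mulr1.
by rewrite mulr0 normr0.
Qed.

Let tr_le n x : `|tr n x| <= `|u x|.
Proof. by rewrite /tr; case: (boolP (`|u _| <= _)) => _ /=; rewrite ?mulr1 ?mulr0 ?normr0. Qed.

Let tr_diff n x : `|u x - tr n x| <= u x ^+ 2 / n.+1%:R.
Proof.
rewrite /tr; case: (boolP (`|u _| <= _)) => [?|]; rewrite /= ?mulr1 ?mulr0.
  by rewrite subrr normr0 divr_ge0// sqr_ge0.
rewrite -ltNge subr0 => nu; rewrite ler_pdivlMr ?ltr0Sn//.
by rewrite -real_normK ?num_real// expr2 ler_wpM2l// ltW.
Qed.

Transparent E1 kernel_op.
Let nsq_tr n : nsq (tr n) <= 1.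
Proof.
apply: le_trans u1; apply: (le_Rintegral mI) => //.
  by have b := btr n; apply: bm1_int; bmt.
move=> x _; rewrite -(real_normK (num_real (tr n x))) -(real_normK (num_real (u x))).
by rewrite lerXn2r ?nnegrE.
Qed.

Let diff n x : I x -> `|kernel_op f u x - kernel_op f (tr n) x| <= n.+1%:R^-1.
Proof.
move=> Ix; rewrite /kernel_op.
have bx := graphon_row gf Ix.
have i1 : mu.-integrable I (EFin \o (fun y => f (x, y) * u y)).
  apply: (le_integrable mI _ _ iu).
    by apply/measurable_EFinP; apply: measurable_funM => //; case: bx.
  by move=> y Iy /=; rewrite lee_fin; exact: graphon_normM.
have i2 : mu.-integrable I (EFin \o (fun y => f (x, y) * tr n y)).
  by have b := btr n; apply: bm1_int; bmt.
rewrite -RintegralB//.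
have i3 : mu.-integrable I (EFin \o (fun y => f (x, y) * u y - f (x, y) * tr n y)).
  exact: (integrableB mI i1 i2).
apply: (le_trans (le_normr_Rintegral mI i3)).
have i4 : mu.-integrable I (EFin \o (fun y => n.+1%:R^-1 * u y ^+ 2)).
  exact: (integrableZl mI _ iu2).
apply: (@le_trans _ _ (\int[mu]_(y in I) (n.+1%:R^-1 * u y ^+ 2))).
  apply: le_Rintegral => //.
    exact: (integrable_norm i3).
  move=> y Iy; rewrite -mulrBr; apply: (le_trans (graphon_normM (fun y => u y - tr n y) gf Ix Iy)).
  by rewrite mulrC; exact: tr_diff.
by rewrite RintegralZl// ler_piMr// invr_ge0.
Qed.
Opaque E1 kernel_op.

Let bk : bm1 (kernel_op f u).
Proof.
split; last first.
  exists 2 => x Ix; have := diff 0 Ix; rewrite invr1.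
  have := kernel_op_le gf (btr 0) Ix; have := E1_normr_le (btr 0).
  have := nsq_tr 0; set a := kernel_op f u x; set b := kernel_op f _ x => n1 e1 e2 e3.
  rewrite (_ : a = (a - b) + b); last by rewrite subrK.
  apply: (le_trans (ler_normD _ _)); lra.
apply: (@measurable_fun_cvg _ _ _ I (fun n => kernel_op f (tr n))).
  by move=> n; have [] := bm1_kernel_op gf (btr n).
move=> x Ix; apply/cvgrPdist_le => e e0; near=> n.
apply: (le_trans (diff n Ix)).
rewrite -[leRHS]invrK lef_pV2 ?posrE ?ltr0Sn ?invr_gt0//.
rewrite (le_trans (_ : e^-1 <= n%:R))// ?ler_nat//.
near: n; exact: nbhs_infty_ger.
Unshelve. all: by end_near. Qed.

(** The unit ball of L^2 contains unbounded functions, whereas all estimates are made on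
    bounded ones.  The truncations of [u] at height [n + 1] have images converging
    uniformly to that of [u], with error [1 / (n + 1)]. *)
Lemma L2norm_kernel_op_unbounded : (L2norm (kernel_op f u) <= c%:E)%E.
Proof.
rewrite (L2norm_bm bk) lee_fin -[X in _ <= X](ger0_norm c0) -sqrtr_sqr ler_wsqrtr//.
apply/ler_addgt0Pr => e e0.
(* [a ^ 2 <= b ^ 2 + 3 k] when [|b| <= 1] and [|a - b| <= k <= 1] *)
have [n ne] : exists n : nat, 3 / n.+1%:R <= e.
  have e3 : 0 < e / 3 by rewrite divr_gt0.
  have [n _ ne] := near_infty_natSinv_lt (PosNum e3).
  exists n; have := ne n (leqnn n); rewrite /= => {}ne.
  by rewrite mulrC -ler_pdivlMr// ltW.
have b2 := bm1_kernel_op gf (btr n).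
have k1 := E1_normr_le (btr n); have n1 := nsq_tr n.
have inv1 : 0 <= (n.+1%:R^-1 : R) <= 1 by rewrite invr_ge0 ler0n invf_le1// ler1n.
apply: le_trans (_ : nsq (kernel_op f (tr n)) + 3 / n.+1%:R <= _); last first.
  by rewrite lerD// H.
rewrite /nsq -[X in _ <= _ + X]E1_cst -E1D; [|by bmt..].
apply: E1_le; [by bmt..|] => x Ix.
have := diff n Ix; have := kernel_op_le gf (btr n) Ix.
move/le_trans/(_ k1) => k2.
move: inv1 k2; set a := kernel_op f u x; set b := kernel_op f _ x.
move=> /andP[i0 i1] k2; rewrite ler_norml => /andP[d1 d2].
have {}k2 : `|b| <= 1 by apply: (le_trans k2); lra.
move: k2; rewrite ler_norml => /andP[b1 b3].
move: (n.+1%:R^-1) i0 i1 d1 d2 => k i0 i1 d1 d2.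
nra.
Qed.

End unbounded.

Lemma opnorm_sup_le f c : graphon f -> 0 <= c ->
  (forall v, bm1 v -> nsq v <= 1 -> nsq (kernel_op f v) <= c ^+ 2) ->
  (ereal_sup [set L2norm (kernel_op f u) | u in
    [set u | u \_ (@I01 R) \in Lfun mu 2%:E /\ (L2norm u <= 1)%E]] <= c%:E)%E.
Proof.
move=> gf c0 H; apply: ge_ereal_sup => _ [u [uL u1] <-].
have mu_ : @measurable_fun _ _ RR RR I u.
  apply/(measurable_restrictT _ measurable_I01).
  by move: uL; rewrite inE => /andP[/[!inE]].
have iu2 : mu.-integrable I (EFin \o (fun x => u x ^+ 2)).
  apply/(integrable_mkcond _ measurable_I01).
  have -> : (EFin \o (fun x => u x ^+ 2)) \_ I = EFin \o (fun x => (u \_ I) x ^+ 2).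
    by apply/funext => x /=; rewrite !patchE /=; case: ifP => //; rewrite expr0n.
  exact: Lfun2_integrable_sqr.
apply: L2norm_kernel_op_unbounded => //.
move: u1; rewrite /L2norm Lnorm2E -(fineK (integrable_fin_num measurable_I01 iu2)).
rewrite poweR_EFin powR12_sqrt; last by apply: Rintegral_ge0 => x _; exact: sqr_ge0.
by rewrite lee_fin -[X in _ <= X](sqrtr1 R) ler_sqrt.
Qed.

Lemma opnorm_ball v : bm1 v -> nsq v <= 1 ->
  v \_ (@I01 R) \in Lfun mu 2%:E /\ (L2norm v <= 1)%E.
Proof.
move=> bv v1; have L1 : (L2norm v <= 1)%E.
  by rewrite L2norm_bm// lee_fin -[X in _ <= X](sqrtr1 R) ler_sqrt.
split=> //; rewrite inE; apply/andP; split; rewrite inE /=.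
  by apply: (iffLR (measurable_restrictT v measurable_I01)); case: bv.
by rewrite /finite_norm; apply: (le_lt_trans L1); rewrite ltry.
Qed.

Lemma bm1_0 : bm1 (fun=> 0 : R).
Proof. exact: bm_cst. Qed.

Lemma nsq_0 : nsq (fun=> 0 : R) = 0.
Proof. by rewrite /nsq expr0n/= E1_cst. Qed.

Lemma opnorm_sup_ge0 f : graphon f -> (0 <=
  ereal_sup [set L2norm (kernel_op f u) | u in
    [set u | u \_ (@I01 R) \in Lfun mu 2%:E /\ (L2norm u <= 1)%E]])%E.
Proof.
move=> gf; apply: (@le_trans _ _ (L2norm (kernel_op f (fun=> 0)))).
  exact: Lnorm_ge0.
apply: ereal_sup_ubound; exists (fun=> 0) => //.
by apply: opnorm_ball; [exact: bm1_0 | rewrite nsq_0].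
Qed.

(** Bounded test functions suffice to bound the norm from above, by truncation. *)
Lemma opnorm_le f c : graphon f -> 0 <= c ->
  (forall v, bm1 v -> nsq v <= 1 -> nsq (kernel_op f v) <= c ^+ 2) ->
  opnorm f <= c.
Proof.
move=> gf c0 H; rewrite /opnorm -lee_fin fineK; first exact: opnorm_sup_le.
rewrite ge0_fin_numE; last exact: opnorm_sup_ge0.
by apply: le_lt_trans (opnorm_sup_le gf c0 H) _; rewrite ltry.
Qed.

Lemma opnorm_ge0 f : graphon f -> 0 <= opnorm f.
Proof. by move=> gf; rewrite /opnorm fine_ge0//; exact: opnorm_sup_ge0. Qed.

Lemma opnorm_ge1 f v : graphon f -> bm1 v -> nsq v <= 1 ->
  nsq (kernel_op f v) <= opnorm f ^+ 2.
Proof.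
move=> gf bv v1; have bk := bm1_kernel_op gf bv.
have : (L2norm (kernel_op f v) <= (opnorm f)%:E)%E.
  rewrite /opnorm fineK; last first.
    rewrite ge0_fin_numE; last exact: opnorm_sup_ge0.
    apply: le_lt_trans (opnorm_sup_le gf (@ler01 R) _) _; last by rewrite ltry.
    by move=> w bw w1; rewrite expr1n; exact: nsq_kernel_op_le1.
  by apply: ereal_sup_ubound; exists v => //; exact: opnorm_ball.
rewrite (L2norm_bm bk) lee_fin => H.
by rewrite -(sqr_sqrtr (nsq_ge0 _)) lerXn2r ?nnegrE ?sqrtr_ge0 ?opnorm_ge0.
Qed.

Lemma nsqZ c v : bm1 v -> nsq (fun x => c * v x) = c ^+ 2 * nsq v.
Proof.
move=> bv; rewrite /nsq -E1Z; last by bmt.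
by apply: eq_E1 => x _; rewrite exprMn.
Qed.

Lemma kernel_opZ f c v x : graphon f -> bm1 v -> I x ->
  kernel_op f (fun y => c * v y) x = c * kernel_op f v x.
Proof.
move=> gf bv Ix; have bx := graphon_row gf Ix.
rewrite !kernel_opE -E1Z; last by bmt.
by apply: eq_E1 => y _; rewrite mulrCA.
Qed.

(** The unit ball version [opnorm_ge1] rescaled; for [nsq v = 0] arbitrarily large multiples
    of [v] are in the ball, so that the left-hand side vanishes. *)
Lemma opnorm_ge f v : graphon f -> bm1 v ->
  nsq (kernel_op f v) <= opnorm f ^+ 2 * nsq v.
Proof.
move=> gf bv; have bk := bm1_kernel_op gf bv.
have key c : c ^+ 2 * nsq v <= 1 -> c ^+ 2 * nsq (kernel_op f v) <= opnorm f ^+ 2.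
  move=> cv; rewrite -nsqZ//.
  have bcv : bm1 (fun x => c * v x) by bmt.
  have := opnorm_ge1 gf bcv; rewrite nsqZ// => /(_ cv); apply: le_trans.
  rewrite le_eqVlt; apply/orP; left; apply/eqP; apply: eq_E1 => x Ix.
  by rewrite kernel_opZ.
have [v0|v0] := eqVneq (nsq v) 0.
  rewrite v0 mulr0; rewrite leNgt; apply/negP => k0.
  have := key (Num.sqrt ((opnorm f ^+ 2 + 1) / nsq (kernel_op f v))).
  rewrite v0 mulr0 => /(_ (@ler01 R)).
  rewrite sqr_sqrtr; last by rewrite divr_ge0 ?ltW// ltr_wpDl// sqr_ge0.
  by rewrite divfK ?gt_eqF// gerDl ler10.
have vp : 0 < nsq v by rewrite lt_neqAle eq_sym v0 nsq_ge0.
have := key (Num.sqrt (nsq v)^-1).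
rewrite sqr_sqrtr ?invr_ge0 ?nsq_ge0// mulVf// => /(_ (lexx _)).
by rewrite mulrC ler_pdivrMr.
Qed.

End OperatorNorm.
Opaque opnorm.

(** * Continuity of the operator norm for the cut distance *)

Section OperatorNormContinuity.
Context {R : realType}.
Local Open Scope classical_set_scope.
Local Open Scope ring_scope.

Local Notation RR := (measurableTypeR R).
Local Notation I := (@I01 R : set RR).
Implicit Types (u v : R -> R) (f g h : R * R -> R).

Lemma nsq_triangle u v A B : bm1 u -> bm1 v -> 0 <= A -> 0 <= B ->
  nsq u <= A ^+ 2 -> nsq v <= B ^+ 2 -> nsq (fun x => u x + v x) <= (A + B) ^+ 2.
Proof.
move=> bu bv A0 B0 uA vB.
have -> : nsq (fun x => u x + v x) = nsq u + 2 * E1 (fun x => u x * v x) + nsq v.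
  rewrite /nsq -E1Z; last by bmt.
  rewrite -!E1D; [|by bmt..].
  by apply: eq_E1 => x _; rewrite sqrrD mulr_natl.
have uv : E1 (fun x => u x * v x) <= A * B.
  apply: le_trans (ler_norm _) _; rewrite -ler_sqr ?nnegrE ?mulr_ge0//.
  rewrite real_normK ?num_real// exprMn.
  apply: (le_trans (CauchySchwarz bu bv)).
  by apply: ler_pM => //; exact: nsq_ge0.
by rewrite sqrrD -mulr_natl; lra.
Qed.

Lemma opnorm_relabel g phi : graphon g -> mp_bijection phi ->
  opnorm (relabel g phi) <= opnorm g.
Proof.
move=> gg mphi; have [psi [mpsi K1 K2]] := mp_inv mphi.
apply: opnorm_le; [exact: graphon_relabel | exact: opnorm_ge0|] => v bv v1.
have bv' := bm1_mp mpsi bv.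
have e : nsq (kernel_op (relabel g phi) v) = nsq (kernel_op g (fun y => v (psi y))).
  have bk : bm1 (fun x => kernel_op g (fun y => v (psi y)) x ^+ 2).
    by have := bm1_kernel_op gg bv' => ?; bmt.
  rewrite [RHS]/nsq -(E1_mp mphi bk); apply: eq_E1 => x Ix; congr (_ ^+ 2).
  rewrite !kernel_opE.
  have br := graphon_row gg (mp_I01 mphi Ix).
  have bz : bm1 (fun y => g (phi x, y) * v (psi y)) by bmt.
  by rewrite -(E1_mp mphi bz); apply: eq_E1 => y Iy; rewrite K1.
rewrite e; apply: (le_trans (opnorm_ge gg bv')).
apply: (ler_piMr (sqr_ge0 _)); apply: le_trans v1.
have b2 : bm1 (fun x => v x ^+ 2) by bmt.
exact: (le_of_eq (E1_mp mpsi b2)).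
Qed.

Section difference.
Variables (f g : R * R -> R) (d : R).
Hypotheses (gf : graphon f) (gg : graphon g) (fgd : cut_dist_labelled f g <= d).

Let kW v x := E1 (fun y => (f (x, y) - g (x, y)) * v y).

Let bW := graphon_sub_bm2 gf gg.

Let bkW v : bm1 v -> bm1 (kW v).
Proof. by move=> bv; apply: (bm2_marginal (G := fun x y => (f (x, y) - g (x, y)) * v y)); bmt. Qed.

Let kW_le v x : bm1 v -> I x -> `|kW v x| <= E1 (fun y => `|v y|).
Proof.
move=> bv Ix; have br := bm2_row bW Ix.
apply: (le_trans (E1_abs _)); first by bmt.
apply: E1_le; [by bmt..|] => y Iy.
by rewrite normrM ler_piMl//; exact: graphon_sub_le1.
Qed.

(** Splitting [u] and [v] into positive and negative parts leaves four forms in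
    weights with values in [0,1], each at most [d] in absolute value. *)
Let kW_bilinear u v M : bm1 u -> bm1 v -> 0 < M ->
  (forall x, I x -> `|u x| <= 1) -> (forall x, I x -> `|v x| <= M) ->
  E1 (fun x => u x * kW v x) <= 4 * M * d.
Proof.
move=> bu bv M0 u1 vM.
pose pos (w : R -> R) c x := (`|w x| + w x) / 2 / c.
pose neg (w : R -> R) c x := (`|w x| - w x) / 2 / c.
have bpos w c : bm1 w -> bm1 (pos w c) by move=> bw; rewrite /pos; bmt.
have bneg w c : bm1 w -> bm1 (neg w c) by move=> bw; rewrite /neg; bmt.
have pos01 w c x : 0 < c -> `|w x| <= c -> 0 <= pos w c x <= 1.
  move=> c0 wc; rewrite /pos divr_ge0 ?ler_pdivrMr ?(ltW c0)//; last first.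
    by have := ler_norm (- w x); rewrite normrN => ?; apply: divr_ge0 => //; lra.
  by have := ler_norm (w x) => ?; lra.
have neg01 w c x : 0 < c -> `|w x| <= c -> 0 <= neg w c x <= 1.
  move=> c0 wc; rewrite /neg divr_ge0 ?ler_pdivrMr ?(ltW c0)//; last first.
    by have := ler_norm (w x) => ?; apply: divr_ge0 => //; lra.
  by have := ler_norm (- w x); rewrite normrN => ?; lra.
have bil p q : bm1 p -> bm1 q -> (forall x, I x -> 0 <= p x <= 1) ->
    (forall x, I x -> 0 <= q x <= 1) ->
    `|E2 (fun x y => p x * (q y * (f (x, y) - g (x, y))))| <= d.
  move=> bp bq p1 q1; rewrite ler_norml; apply/andP; split; last first.
    by apply: le_trans fgd; exact: cut_dist_labelled_bilinear.
  rewrite lerNl; apply: le_trans fgd.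
  apply: le_trans (cut_dist_labelled_sym gg gf).
  have := cut_dist_labelled_bilinear gg gf bp bq p1 q1; apply: le_trans.
  rewrite -mulN1r -E2Z; last by bmt.
  apply: le_of_eq; apply: eq_E2 => x y _ _.
  by rewrite mulN1r -mulrN -mulrN opprB.
pose B p q := E2 (fun x y => p x * (q y * (f (x, y) - g (x, y)))).
have -> : E1 (fun x => u x * kW v x) = M *
  ((B (pos u 1) (pos v M) - B (pos u 1) (neg v M)) -
   (B (neg u 1) (pos v M) - B (neg u 1) (neg v M))).
  have b1 := bpos _ 1 bu; have b2 := bneg _ 1 bu.
  have b3 := bpos _ M bv; have b4 := bneg _ M bv.
  have bB p q : bm1 p -> bm1 q -> bm2 (fun x y => p x * (q y * (f (x, y) - g (x, y)))).
    by move=> bp bq; bmt.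
  rewrite {1 2}/B -(E2B (bB _ _ b1 b3) (bB _ _ b1 b4)).
  rewrite /B -(E2B (bB _ _ b2 b3) (bB _ _ b2 b4)).
  rewrite -E2B; [|by apply: bmB; exact: bB..].
  rewrite -E2Z; last by apply: bmB; apply: bmB; exact: bB.
  rewrite E2E; apply: eq_E1 => x Ix; have br := bm2_row bW Ix.
  rewrite /kW -E1Z; last by bmt.
  apply: eq_E1 => y _; rewrite /pos /neg; have := lt0r_neq0 M0.
  move: (`|u x|) (`|v y|) (u x) (v y) (f _) (g _) => au av ux vy ff gg0 M00.
  by field.
have b1 := bpos _ 1 bu; have b2 := bneg _ 1 bu.
have b3 := bpos _ M bv; have b4 := bneg _ M bv.
have i1 x : I x -> 0 <= pos u 1 x <= 1 by move=> Ix; apply: pos01 => //; exact: u1.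
have i2 x : I x -> 0 <= neg u 1 x <= 1 by move=> Ix; apply: neg01 => //; exact: u1.
have i3 x : I x -> 0 <= pos v M x <= 1 by move=> Ix; apply: pos01 => //; exact: vM.
have i4 x : I x -> 0 <= neg v M x <= 1 by move=> Ix; apply: neg01 => //; exact: vM.
have := bil _ _ b1 b3 i1 i3; have := bil _ _ b1 b4 i1 i4.
have := bil _ _ b2 b3 i2 i3; have := bil _ _ b2 b4 i2 i4.
rewrite -/(B _ _) -/(B _ _) -/(B _ _) -/(B _ _).
move: (B (pos u 1) (pos v M)) (B (pos u 1) (neg v M)) (B (neg u 1) (pos v M))
  (B (neg u 1) (neg v M)) => A1 A2 A3 A4.
rewrite !ler_norml => /andP[? ?] /andP[? ?] /andP[? ?] /andP[? ?].
rewrite mulrAC -mulrA mulrCA [leRHS]mulrA [leRHS]mulrC -[leRHS]mulrC.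
by rewrite [leRHS](_ : _ = M * (4 * d)); [rewrite ler_pM2l//; lra | ring].
Qed.

(** Split a test function into its truncation at height [M] and the rest.  The cut distance
    controls the difference kernel on the first part, tested against its own image,
    while the second part has L^1 norm at most [1 / M]. *)
Lemma opnorm_sub_le M e : 0 < M -> 0 <= e -> 4 * M * d <= e ^+ 2 ->
  opnorm f <= opnorm g + (e + M^-1).
Proof.
move=> M0 e0 Mde; have og := opnorm_ge0 gg.
have M1 : 0 <= M^-1 by rewrite invr_ge0 ltW.
apply: opnorm_le => //; first by rewrite !addr_ge0.
move=> v bv v1.
pose v1_ x := v x * ((`|v x| <= M)%R)%:R.
pose v2_ x := v x - v1_ x.
have bv1 : bm1 v1_ by rewrite /v1_; bmt; apply: bm_le; bmt.
have bv2 : bm1 v2_ by rewrite /v2_; bmt.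
have v1M x : `|v1_ x| <= M.
  rewrite /v1_; case: (boolP (`|v _| <= _)) => [?|_]; rewrite /= ?mulr1 ?mulr0//.
  by rewrite normr0 ltW.
have v1v x : `|v1_ x| <= `|v x|.
  by rewrite /v1_; case: (boolP (`|v _| <= _)) => _ /=; rewrite ?mulr1 ?mulr0 ?normr0.
have v2M x : `|v2_ x| <= M^-1 * v x ^+ 2.
  rewrite /v2_ /v1_; case: (boolP (`|v _| <= _)) => [?|]; rewrite /= ?mulr1 ?mulr0.
    by rewrite subrr normr0 mulr_ge0// sqr_ge0.
  rewrite -ltNge subr0 => nu; rewrite mulrC ler_pdivlMr//.
  by rewrite -(real_normK (num_real (v x))) expr2 ler_wpM2l// ltW.
have E2v : E1 (fun y => `|v2_ y|) <= M^-1.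
  apply: (@le_trans _ _ (E1 (fun y => M^-1 * v y ^+ 2))).
    by apply: E1_le; [by bmt..|] => y _.
  by rewrite E1Z; [rewrite ler_piMr | bmt].
have k1 : nsq (kW v1_) <= e ^+ 2.
  apply: le_trans Mde.
  have le1 x : I x -> `|kW v1_ x| <= 1.
    move=> Ix; apply: (le_trans (kW_le bv1 Ix)).
    apply: (@le_trans _ _ (E1 (fun y => `|v y|))); last first.
      by have := E1_normr_le bv => /le_trans; apply; lra.
    by apply: E1_le; [by bmt..|] => y _.
  have bb := bkW bv1.
  exact: (kW_bilinear bb bv1 M0 le1 (fun x _ => v1M x)).
have k2 : nsq (kW v2_) <= M^-1 ^+ 2.
  rewrite /nsq -[leRHS]E1_cst; have bb := bkW bv2.
  apply: E1_le; [by bmt..|] => x Ix.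
  rewrite -(real_normK (num_real (kW v2_ x))) lerXn2r ?nnegrE//.
  by apply: (le_trans (kW_le bv2 Ix)).
have kg : nsq (kernel_op g v) <= opnorm g ^+ 2.
  exact: opnorm_ge1.
have bk1 := bkW bv1; have bk2 := bkW bv2; have bkg := bm1_kernel_op gg bv.
have k12 := nsq_triangle bk1 bk2 e0 M1 k1 k2.
have bk12 : bm1 (fun x => kW v1_ x + kW v2_ x) by bmt.
have eM : 0 <= e + M^-1 by exact: addr_ge0.
have := nsq_triangle bkg bk12 og eM kg k12.
rewrite [X in X <= _ -> _](_ : _ = nsq (kernel_op f v))//.
apply: eq_E1 => x Ix; congr (_ ^+ 2).
have br := bm2_row bW Ix; have brf := graphon_row gf Ix; have brg := graphon_row gg Ix.
rewrite !kernel_opE /kW -!E1D; [|by bmt..].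
apply: eq_E1 => y _; rewrite /v2_; move: (f _) (g _) (v1_ y) (v y) => a b c d'.
by ring.
Qed.

End difference.

Lemma opnorm_labelled_cont e : 0 < e -> exists2 d, 0 < d &
  forall f g, graphon f -> graphon g -> cut_dist_labelled f g <= d ->
  opnorm f <= opnorm g + e.
Proof.
(* truncation at height [2 / e] makes both errors equal to [e / 2] *)
move=> e0; exists (e ^+ 3 / 32); first by rewrite divr_gt0// exprn_gt0.
move=> f g gf gg fgd.
have := @opnorm_sub_le f g _ gf gg fgd (2 / e) (e / 2).
move=> /(_ (divr_gt0 (ltr0Sn _ _) e0) (divr_ge0 (ltW e0) (ler0n _ _))); rewrite invf_div -splitr; apply.
apply: le_of_eq; field.
exact: lt0r_neq0.
Qed.

Lemma opnorm_cont e : 0 < e -> exists2 d, 0 < d &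
  forall f g, graphon f -> graphon g -> cut_dist f g < d -> opnorm f <= opnorm g + e.
Proof.
move=> /opnorm_labelled_cont[d d0 H]; exists d => // f g gf gg.
move=> /(cut_dist_lt gf gg)[phi mphi /ltW fgd].
apply: (le_trans (H _ _ gf (graphon_relabel mphi gg) fgd)).
by rewrite lerD2r; exact: opnorm_relabel.
Qed.

Lemma opnorm_cut0_le f g : graphon f -> graphon g -> cut_dist f g = 0 ->
  opnorm f <= opnorm g.
Proof.
move=> gf gg fg0; apply/ler_addgt0Pr => e /opnorm_cont[d d0]; apply; [exact: gf|exact: gg|].
by rewrite fg0.
Qed.

Lemma opnorm_cut0 f g : graphon f -> graphon g -> cut_dist f g = 0 ->
  opnorm f = opnorm g.
Proof.
move=> gf gg fg0; apply/le_anti/andP; split; first exact: opnorm_cut0_le.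
by apply: opnorm_cut0_le; [exact: gg|exact: gf|rewrite cut_dist_sym].
Qed.

Lemma gclass_self f : graphon f -> gclass f f.
Proof. by move=> gf; split; [exact: gf | exact: cut_dist_refl]. Qed.

Lemma cut_dist0_trans f g h : graphon f -> graphon g -> graphon h ->
  cut_dist f g = 0 -> cut_dist g h = 0 -> cut_dist f h = 0.
Proof.
move=> gf gg gh fg0 gh0; apply/le_anti/andP; split; last exact: cut_dist_ge0.
by apply: (le_trans (cut_dist_trans gf gg gh)); rewrite fg0 gh0 addr0.
Qed.

Lemma gclass_eq f g : graphon f -> graphon g -> cut_dist f g = 0 -> gclass f = gclass g.
Proof.
move=> gf gg fg0; have gf0 : cut_dist g f = 0 by rewrite cut_dist_sym.
apply/seteqP; split=> h [gh h0]; split; [exact: gh| |exact: gh|].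
  exact: cut_dist0_trans gg gf gh gf0 h0.
exact: cut_dist0_trans gf gg gh fg0 h0.
Qed.

Lemma grepr_gclass f : graphon f -> gclass f (grepr (gclass f)).
Proof. by move=> gf; apply: (xgetI _ (gclass_self gf)). Qed.

Lemma gspaceP (F : set (R * R -> R)) : gspace F ->
  graphon (grepr F) /\ F = gclass (grepr F).
Proof.
move=> [f gf <-]; have [gr r0] := grepr_gclass gf.
by split; [exact: gr | exact: gclass_eq gf gr r0].
Qed.

End OperatorNormContinuity.

(** * Relative entropy and its tangents *)

Section Entropy.
Context {R : realType}.
Local Open Scope classical_set_scope.
Local Open Scope ring_scope.
Implicit Types (p u c r s x y : R).

Definition xlnx x : R := x * ln x.

(** The value of [rel_entropy p u] for [0 < p < 1], written without quotients inside the
    logarithms so that it is continuous up to [u = 0] and [u = 1]. *)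
Definition ent p u : R := xlnx u + xlnx (1 - u) - u * ln p - (1 - u) * ln (1 - p).

(** The derivative of [ent p] at [c]. *)
Definition ent_slope p c : R := (ln c - ln p) - (ln (1 - c) - ln (1 - p)).

Lemma ln_leB1 x : 0 < x -> ln x <= x - 1.
Proof. by move=> x0; have := @le_ln1Dx R (x - 1); rewrite addrCA subrr addr0; apply; lra. Qed.

Lemma xlnx0 : xlnx 0 = 0. Proof. by rewrite /xlnx mul0r. Qed.
Lemma xlnx1 : xlnx 1 = 0. Proof. by rewrite /xlnx ln1 mulr0. Qed.

Lemma xlnx_ge p u : 0 < p -> 0 <= u -> u * ln p + (u - p) <= xlnx u.
Proof.
move=> p0; rewrite le_eqVlt => /predU1P[<-|u0]; first by rewrite xlnx0; lra.
have := ln_leB1 (divr_gt0 p0 u0); rewrite ln_div ?posrE// => H.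
have : u * (ln p - ln u) <= u * (p / u - 1) by rewrite ler_pM2l.
by rewrite /xlnx mulrBr mulrBr mulrCA divff ?gt_eqF//; lra.
Qed.

Lemma xlnx_le p u : 0 < p -> 0 <= u -> xlnx u <= u * ln p + u * (u / p - 1).
Proof.
move=> p0; rewrite le_eqVlt => /predU1P[<-|u0]; first by rewrite xlnx0; lra.
have := ln_leB1 (divr_gt0 u0 p0); rewrite ln_div ?posrE// => H.
have : u * (ln u - ln p) <= u * (u / p - 1) by rewrite ler_pM2l.
by rewrite /xlnx mulrBr; lra.
Qed.

Lemma xlnx_le0 u : 0 <= u <= 1 -> xlnx u <= 0.
Proof. by move=> /andP[u0 u1]; rewrite /xlnx mulr_ge0_le0 ?ln_le0. Qed.

Lemma continuous_xlnx : continuous xlnx.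
Proof.
move=> a; have [a0|a0|->] := ltgtP a 0.
- have H : \forall x \near a, xlnx x = 0.
    near=> x; rewrite /xlnx ln0 ?mulr0//.
    by apply/ltW; near: x; exact: lt_nbhsl.
  have xa : xlnx a = 0 by rewrite /xlnx ln0 ?mulr0// ltW.
  by rewrite /continuous_at xa; apply: cvg_near_cst.
- by apply: continuousM; [exact: cvg_id | exact: continuous_ln].
- rewrite /continuous_at xlnx0; apply/cvgrPdist_le => e e0.
  have d0 : 0 < Num.min 1 ((e / 2) ^+ 2) by rewrite lt_min ltr01 exprn_gt0// divr_gt0.
  near=> x; rewrite sub0r normrN.
  have : `|0 - x| < Num.min 1 ((e / 2) ^+ 2).
    by near: x; exact: (nbhsx_ballx (0 : R) _ d0).
  rewrite sub0r normrN lt_min => /andP[x1 xe].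
  have [x0|x0] := leP x 0; first by rewrite /xlnx ln0// mulr0 normr0 ltW.
  rewrite gtr0_norm// in x1 xe.
  rewrite ler0_norm; last by apply: xlnx_le0; rewrite !ltW.
  have s0 : 0 < Num.sqrt x by rewrite sqrtr_gt0.
  have xs : x = Num.sqrt x * Num.sqrt x by rewrite -expr2 sqr_sqrtr// ltW.
  have se : Num.sqrt x <= e / 2.
    by rewrite -ler_sqr ?nnegrE ?(ltW s0) ?divr_ge0 ?ltW// sqr_sqrtr ?ltW.
  move: s0 xs se; set t := Num.sqrt x => t0 -> te.
  (* with [x = t ^ 2], the bound [ln (1 / t) <= 1 / t - 1] gives [|x ln x| <= 2 t] *)
  have : 0 < t^-1 by rewrite invr_gt0.
  move=> /ln_leB1; rewrite lnV ?posrE// => H.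
  rewrite /xlnx lnM ?posrE//.
  have H2 : t * (- ln t) <= t * (t^-1 - 1) by rewrite ler_pM2l.
  move: H2; rewrite mulrBr divff ?gt_eqF// mulr1 mulrN => H2.
  have H3 : t * (t * ln t) >= t * (t - 1) by rewrite ler_pM2l//; lra.
  by rewrite -mulrA mulrDr mulrDr; nra.
Unshelve. all: by end_near. Qed.

Lemma continuous_ent p : continuous (ent p).
Proof.
move=> x; rewrite /ent; apply: cvgB; last first.
  by apply: cvgMl; apply: cvgB; [exact: cvg_cst | exact: cvg_id].
apply: cvgB; last by apply: cvgMl; exact: cvg_id.
apply: cvgD; first exact: continuous_xlnx.
apply: (@continuous_comp _ _ _ (fun x => 1 - x) xlnx); last exact: continuous_xlnx.
by apply: cvgB; [exact: cvg_cst | exact: cvg_id].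
Qed.

Lemma rel_entropyE p u : 0 < p < 1 -> 0 <= u <= 1 -> rel_entropy p u = (ent p u)%:E.
Proof.
move=> /andP[p0 p1] /andP[u0 u1]; rewrite /rel_entropy.
rewrite (gt_eqF p0) (lt_eqF p1)/=; congr EFin; rewrite /ent /xlnx.
have e a b : 0 <= a -> 0 < b -> a * ln (a / b) = a * ln a - a * ln b.
  rewrite le_eqVlt => /predU1P[<-|a0] b0; first by rewrite !mul0r subr0.
  by rewrite ln_div ?posrE// mulrBr.
by rewrite !e ?subr_ge0 ?subr_gt0//; lra.
Qed.

Lemma rel_entropy_p0 u : rel_entropy 0 u = (if u == 0%R then 0 else +oo)%E :> \bar R.
Proof.
rewrite /rel_entropy eqxx/=; case: eqP => [->|_] //=.
by rewrite mul0r !subr0 divr1 ln1 mulr0 addr0.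
Qed.

Lemma ent_pp p : ent p p = 0.
Proof. by rewrite /ent /xlnx; lra. Qed.

Lemma ent_ge0 p u : 0 < p < 1 -> 0 <= u <= 1 -> 0 <= ent p u.
Proof.
move=> /andP[p0 p1] /andP[u0 u1]; rewrite /ent.
have := xlnx_ge p0 u0; have := @xlnx_ge (1 - p) (1 - u).
by rewrite subr_gt0 subr_ge0 => /(_ p1 u1); lra.
Qed.

Lemma ent_chi2 p u : 0 < p < 1 -> 0 <= u <= 1 -> ent p u <= (u - p) ^+ 2 / (p * (1 - p)).
Proof.
move=> /andP[p0 p1] /andP[u0 u1]; rewrite /ent.
have := xlnx_le p0 u0; have := @xlnx_le (1 - p) (1 - u).
rewrite subr_gt0 subr_ge0 => /(_ p1 u1) H1 H2.
have -> : (u - p) ^+ 2 / (p * (1 - p)) =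
  u * (u / p - 1) + (1 - u) * ((1 - u) / (1 - p) - 1).
  by field; rewrite (gt_eqF p0) gt_eqF// subr_gt0.
lra.
Qed.

Lemma ent_change p c u : ent p u =
  ent c u + u * (ln c - ln p) + (1 - u) * (ln (1 - c) - ln (1 - p)).
Proof. by rewrite /ent; ring. Qed.

(** The remainder of the first order expansion of [ent p] at [c] is again a relative
    entropy, with reference [c]; hence convexity ([ent_tangent]) and a quadratic upper
    bound come without derivatives. *)
Lemma ent_expand p c u : ent p u = ent c u + ent p c + ent_slope p c * (u - c).
Proof. by rewrite /ent /ent_slope /xlnx; ring. Qed.

Lemma ent_slope_ge0 p c : 0 < p -> p <= c -> c < 1 -> 0 <= ent_slope p c.
Proof.
move=> p0 pc c1; have c0 := lt_le_trans p0 pc.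
have : ln p <= ln c by rewrite ler_ln ?posrE.
have : ln (1 - c) <= ln (1 - p) by rewrite ler_ln ?posrE; lra.
by rewrite /ent_slope; lra.
Qed.

Lemma ent_slope_gt0 p c : 0 < p -> p < c -> c < 1 -> 0 < ent_slope p c.
Proof.
move=> p0 pc c1; have c0 := lt_trans p0 pc.
have : ln p < ln c by rewrite ltr_ln ?posrE.
have : ln (1 - c) < ln (1 - p) by rewrite ltr_ln ?posrE; lra.
by rewrite /ent_slope; lra.
Qed.

Lemma ent_tangent p c u : 0 < c < 1 -> 0 <= u <= 1 ->
  ent p c + ent_slope p c * (u - c) <= ent p u.
Proof. by move=> c01 u01; rewrite (ent_expand p c u); have := ent_ge0 c01 u01; lra. Qed.

Lemma ent_lower p c u : 0 < c < 1 -> 0 <= u <= 1 ->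
  u * (ln c - ln p) + (1 - u) * (ln (1 - c) - ln (1 - p)) <= ent p u.
Proof. by move=> c01 u01; rewrite (ent_change p c u); have := ent_ge0 c01 u01; lra. Qed.

Lemma ent_p1 p : ent p 1 = - ln p.
Proof. by rewrite /ent xlnx1 subrr xlnx0; lra. Qed.

Lemma ent_p0 p : ent p 0 = - ln (1 - p).
Proof. by rewrite /ent xlnx0 subr0 xlnx1; lra. Qed.

(** The convex minorant of [x |-> h_p(sqrt x)] at [r ^ 2] is the infimum of the chords above
    it, so this says that the minorant equals [h_p(r)] there. *)
Definition chord_condition p r : Prop := forall x1 x2 th,
  0 <= x1 <= 1 -> 0 <= x2 <= 1 -> 0 <= th <= 1 ->
  th * x1 + (1 - th) * x2 = r ^+ 2 ->
  ent p r <= th * ent p (Num.sqrt x1) + (1 - th) * ent p (Num.sqrt x2).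

(** The derivative of [x |-> h_p(sqrt x)] at [x = r ^ 2]. *)
Definition tangent_slope p r : R := ent_slope p r / (2 * r).

Definition tangent_condition p r : Prop := forall u, 0 <= u <= 1 ->
  ent p r + tangent_slope p r * (u ^+ 2 - r ^+ 2) <= ent p u.

Lemma sqrt01 x : 0 <= x <= 1 -> 0 <= Num.sqrt x <= 1.
Proof.
by move=> /andP[x0 x1]; rewrite sqrtr_ge0/= -[leRHS]sqrtr1 ler_wsqrtr.
Qed.

Lemma sqr01 x : 0 <= x <= 1 -> 0 <= x ^+ 2 <= 1.
Proof. by move=> /andP[x0 x1]; rewrite sqr_ge0 expr_le1. Qed.

(** Apply the chord inequality to [u ^ 2] and a point [r ^ 2 - t D] so close to [r ^ 2] that
    the weight of [u ^ 2] is of order [t]; the expansion of [ent p] at [r] to first order in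
    [t], with the quadratic error [ent_chi2], leaves the tangent inequality up to [K t]. *)
Lemma chord_tangent p r : 0 < p < 1 -> p <= r < 1 -> chord_condition p r ->
  tangent_condition p r.
Proof.
move=> p01 /andP[pr r1] ch u u01; have /andP[p0 p1] := p01.
have r0 : 0 < r by exact: lt_le_trans pr.
have r01 : 0 < r < 1 by rewrite r0.
have sl0 : 0 <= ent_slope p r by exact: ent_slope_ge0.
set D := u ^+ 2 - r ^+ 2; set s := tangent_slope p r.
have r201 : 0 < r ^+ 2 < 1 by rewrite exprn_gt0//= expr_lt1// ltW.
have D1 : -1 <= D <= 1 by have := sqr01 u01; rewrite /D; lra.
have sE : ent_slope p r = s * (2 * r) by rewrite /s /tangent_slope divfK// mulf_neq0// gt_eqF.
pose K := (r * (1 - r))^-1 / r ^+ 2.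
have K0 : 0 < K by rewrite divr_gt0// ?exprn_gt0// invr_gt0 mulr_gt0// subr_gt0.
have key t : 0 < t -> t <= r ^+ 2 -> t <= 1 - r ^+ 2 ->
    ent p r + s * D <= ent p u + K * t.
  move=> t0 t1 t2; pose x := r ^+ 2 - t * D.
  have x01 : 0 <= x <= 1.
    have : t * -1 <= t * D <= t * 1 by rewrite !ler_pM2l.
    by rewrite /x; lra.
  pose w := Num.sqrt x; have w01 : 0 <= w <= 1 by exact: sqrt01.
  have w2 : w ^+ 2 = r ^+ 2 - t * D by rewrite sqr_sqrtr//; case/andP: x01.
  have t10 : 0 < 1 + t by lra.
  have th01 : 0 <= t / (1 + t) <= 1.
    rewrite ler_pdivrMr// mul1r; apply/andP; split; last lra.
    by apply: divr_ge0; lra.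
  have := ch (u ^+ 2) x (t / (1 + t)) (sqr01 u01) x01 th01.
  rewrite sqrtr_sqr ger0_norm; last by case/andP: u01.
  have -> : t / (1 + t) * u ^+ 2 + (1 - t / (1 + t)) * x = r ^+ 2.
    by rewrite /x /D; field; rewrite gt_eqF.
  move=> /(_ erefl); rewrite -/w => H.
  have {}H : (1 + t) * ent p r <= t * ent p u + ent p w.
    rewrite -(ler_pM2l t10) in H; apply: (le_trans H); apply: le_of_eq.
    by field; rewrite gt_eqF.
  have Hw : ent p w <= (r * (1 - r))^-1 * (w - r) ^+ 2 + ent p r + ent_slope p r * (w - r).
    by rewrite (ent_expand p r w) !lerD2r mulrC ent_chi2.
  have w1 : 2 * r * (w - r) <= - (t * D).
    by have := sqr_ge0 (w - r); nra.
  have w3 : (w - r) ^+ 2 * r ^+ 2 <= t ^+ 2.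
    have /andP[w0 _] := w01.
    apply: (@le_trans _ _ ((w - r) ^+ 2 * (w + r) ^+ 2)).
      by rewrite ler_wpM2l ?sqr_ge0// lerXn2r ?nnegrE//; lra.
    rewrite -exprMn -subr_sqr w2 addrAC subrr add0r sqrrN exprMn.
    by rewrite ler_piMr ?sqr_ge0//; nra.
  have w4 : (r * (1 - r))^-1 * (w - r) ^+ 2 <= K * t ^+ 2.
    rewrite /K -mulrA ler_wpM2l//; first by rewrite invr_ge0 mulr_ge0 ?ltW// subr_gt0.
    by rewrite mulrC ler_pdivlMr// exprn_gt0.
  have w5 : ent_slope p r * (w - r) <= - (s * (t * D)).
    rewrite sE -mulrA -mulrN ler_wpM2l// /s /tangent_slope divr_ge0//.
    by rewrite mulr_ge0 ?ltW.
  rewrite -(ler_pM2l t0); move: (ent p w) (ent p r) (ent p u) H Hw w4 w5 => W A B.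
  by rewrite sE; move: ((_)^-1 * _) (_ * (w - r)) => P Q; nra.
apply/ler_addgt0Pr => e e0.
pose t := Num.min (e / K) (Num.min (r ^+ 2) (1 - r ^+ 2)).
have t0 : 0 < t by rewrite !lt_min divr_gt0//=; lra.
have tK : K * t <= e by rewrite mulrC -ler_pdivlMr// /t ge_min lexx.
have := key t t0; rewrite /t !ge_min !lexx !orbT => /(_ isT isT).
by rewrite -/t; lra.
Qed.

End Entropy.

(** * The convex minorant *)

Section Minorant.
Context {R : realType}.
Local Open Scope classical_set_scope.
Local Open Scope ring_scope.
Implicit Types (p u c r s x y : R).

Definition on_minorant p r : Prop :=
  convex_minorant (fun x => rel_entropy p (Num.sqrt x)) (r ^+ 2) = rel_entropy p r.

Lemma conv_lmodE (t : {i01 R}) (a b : R^o) :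
  conv t (a : convex_lmodType R^o) b = t%:num * a + (1 - t%:num) * b.
Proof. by []. Qed.

Lemma minorant_le p x : I01 x ->
  (convex_minorant (fun x => rel_entropy p (Num.sqrt x)) x <= rel_entropy p (Num.sqrt x))%E.
Proof. by move=> Ix; apply: ge_ereal_sup => _ [g [_ gphi] <-]; exact: gphi. Qed.

(** Every convex function below [h_p(sqrt x)] is below its chords. *)
Lemma minorant_chord p r : 0 < p < 1 -> 0 <= r <= 1 -> on_minorant p r ->
  chord_condition p r.
Proof.
move=> p01 r01 onm x1 x2 th x101 x201 /andP[th0 th1] e.
rewrite -lee_fin -rel_entropyE// -onm; apply: ge_ereal_sup => _ [g [cg gphi] <-].
have Ix1 : @I01 R x1 by apply/I01P.
have Ix2 : @I01 R x2 by apply/I01P.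
have := cg (Itv01 th0 th1) x1 x2 (mem_set Ix1) (mem_set Ix2).
rewrite convRE conv_lmodE /= /unstable.onem e => H.
apply: (@le_trans _ _ (th * g x1 + (1 - th) * g x2)%:E); first by rewrite lee_fin.
rewrite lee_fin lerD// ler_wpM2l ?subr_ge0// -lee_fin -rel_entropyE ?sqrt01//; exact: gphi.
Qed.

(** The supporting line is itself a convex function below [h_p(sqrt x)]. *)
Lemma tangent_minorant p r : 0 < p < 1 -> 0 <= r <= 1 -> tangent_condition p r ->
  on_minorant p r.
Proof.
move=> p01 r01 tg; have /andP[r0 r1] := r01.
apply/le_anti/andP; split.
  have I2 : @I01 R (r ^+ 2) by apply/I01P; exact: sqr01.
  by have := minorant_le p I2; rewrite sqrtr_sqr ger0_norm.
set s := tangent_slope p r in tg *.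
pose g x := ent p r + s * (x - r ^+ 2).
rewrite rel_entropyE//; apply: ereal_sup_ubound; exists g; last first.
  by rewrite /g subrr mulr0 addr0.
split.
  move=> t x y _ _; rewrite convRE conv_lmodE /= /unstable.onem /g.
  by apply: le_of_eq; ring.
move=> y /I01P y01; have /andP[y0 y1] := y01.
rewrite rel_entropyE ?sqrt01// lee_fin /g.
by have := tg (Num.sqrt y) (sqrt01 y01); rewrite sqr_sqrtr.
Qed.

(** At the end point 1 the minorant always touches: the function which is 0 on [0,1) and
    [h_p(1)] at 1 is convex. *)
Lemma minorant_one p : 0 < p < 1 -> on_minorant p 1.
Proof.
move=> p01; apply/le_anti/andP; split.
  have I2 : @I01 R (1 ^+ 2) by apply/I01P; rewrite expr1n; apply/andP; split.
  by have := minorant_le p I2; rewrite expr1n sqrtr1.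
have one01 : 0 <= (1 : R) <= 1 by rewrite ler01 lexx.
pose g x := if x == 1 then ent p 1 else 0.
have e1 := ent_ge0 p01 one01.
have g0 x : 0 <= g x by rewrite /g; case: eqP.
have gle x : g x <= ent p 1 by rewrite /g; case: eqP.
rewrite rel_entropyE// expr1n; apply: ereal_sup_ubound; exists g; last first.
  by rewrite /g eqxx.
split.
  move=> t x y /set_mem/I01P/andP[x0 x1] /set_mem/I01P/andP[y0 y1].
  rewrite convRE conv_lmodE /= /unstable.onem.
  have t0 : 0 <= t%:num by [].
  have t1 : t%:num <= 1 by [].
  move: (t%:num) t0 t1 => a a0 a1.
  have rhs0 : 0 <= a * g x + (1 - a) * g y by rewrite addr_ge0 ?mulr_ge0// subr_ge0.
  rewrite {1}/g; case: eqP => [e|_]//.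
  have ax : a * (1 - x) = 0.
    have h1 : 0 <= a * (1 - x) by rewrite mulr_ge0// subr_ge0.
    have h2 : 0 <= (1 - a) * (1 - y) by rewrite mulr_ge0// subr_ge0.
    by apply/le_anti/andP; split; [lra | exact: h1].
  have ay : (1 - a) * (1 - y) = 0 by lra.
  have gx : a * g x = a * ent p 1.
    move/eqP: ax; rewrite mulf_eq0 subr_eq0 => /orP[/eqP->|]; first by rewrite !mul0r.
    by rewrite eq_sym /g => ->.
  have gy : (1 - a) * g y = (1 - a) * ent p 1.
    move/eqP: ay; rewrite mulf_eq0 [X in _ || X]subr_eq0 => /orP[/eqP->|]; first by rewrite !mul0r.
    by rewrite eq_sym /g => ->.
  by rewrite gx gy -mulrDl subrKC mul1r.
move=> y /I01P y01; rewrite rel_entropyE ?sqrt01// lee_fin /g.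
case: eqP => [->|_]; first by rewrite sqrtr1.
by rewrite ent_ge0// sqrt01.
Qed.

Lemma not_minorant p r : 0 < p < 1 -> p <= r <= 1 -> ~ on_minorant p r ->
  r < 1 /\ ~ chord_condition p r.
Proof.
move=> p01 /andP[pr r1] nm; have /andP[p0 p1] := p01.
have r0 : 0 <= r by lra.
have lr1 : r < 1.
  rewrite lt_neqAle r1 andbT; apply/eqP => e; apply: nm; rewrite e.
  exact: minorant_one.
split=> // ch; apply: nm; apply: tangent_minorant => //; first by rewrite r0.
by apply: chord_tangent => //; rewrite pr.
Qed.

(** For [r < 1] the tangent inequality, even with [d = 0].  At [r = 1] the tangent is
    vertical; the tangent of [ent p] at [c = exp (- d)], a point near 1, loses only [d]. *)
Lemma ent_minorant_lower p r d : 0 < p < 1 -> p <= r <= 1 -> chord_condition p r -> 0 < d ->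
  exists2 D, 0 <= D & forall u, 0 <= u <= 1 ->
    ent p r <= d + ent p u + D * (r ^+ 2 - u ^+ 2).
Proof.
move=> p01 /andP[pr r1] ch d0; have /andP[p0 p1] := p01.
have r0 : 0 < r by exact: lt_le_trans pr.
have [lr1|] := ltP r 1.
  exists (tangent_slope p r).
    by rewrite /tangent_slope divr_ge0 ?ent_slope_ge0// mulr_ge0// ltW.
  move=> u u01; have pr1 : p <= r < 1 by rewrite pr.
  have := chord_tangent p01 pr1 ch u01; lra.
move=> ler1; have -> : r = 1 by apply/le_anti; rewrite r1.
pose c := expR (- d).
have c0 : 0 < c by exact: expR_gt0.
have c1 : c < 1 by rewrite /c -expR0 ltr_expR; lra.
have c01 : 0 < c < 1 by rewrite c0.
exists `|(ln c - ln p) - (ln (1 - c) - ln (1 - p))|; first exact: normr_ge0.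
move=> u u01; have /andP[u0 u1] := u01; rewrite ent_p1.
have := ent_lower p c01 u01.
set a := ln c - ln p; set b := ln (1 - c) - ln (1 - p) => H.
have lc : ln c = - d by rewrite /c expRK.
have H1 : (1 - u) * (a - b) <= `|a - b| * (1 ^+ 2 - u ^+ 2).
  apply: (@le_trans _ _ ((1 - u) * `|a - b|)); first by rewrite ler_wpM2l ?subr_ge0// ler_norm.
  rewrite mulrC ler_wpM2l// expr1n; nra.
have : - d - ln p = a by rewrite /a lc.
move: H1; rewrite mulrBr; lra.
Qed.

End Minorant.

(** * Contact points of the supporting line *)

Section Stability.
Context {R : realType}.
Local Open Scope classical_set_scope.
Local Open Scope ring_scope.
Implicit Types (p u c r s x y : R).

(** The height of [h_p] above the line of slope [s] through [(r ^ 2, h_p(r))], as a function of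
    [u = sqrt x]. *)
Definition gap p r s u := ent p u - ent p r - s * (u ^+ 2 - r ^+ 2).

Lemma is_derive_xlnx x : 0 < x -> is_derive x 1 (@xlnx R) (ln x + 1).
Proof.
move=> x0; have := is_derive1_ln x0 => dl.
have := is_deriveM (is_derive_id x (1 : R)) dl.
move=> H; apply: (is_derive_eq H).
by rewrite /GRing.scale/= divff ?gt_eqF// mulr1 addrC.
Qed.

Lemma is_derive_ent p x : 0 < x < 1 -> is_derive x 1 (ent p) (ent_slope p x).
Proof.
move=> /andP[x0 x1].
have d1 := is_derive_xlnx x0.
have d2 : is_derive x 1 (fun u : R => 1 - u) (- 1).
  by apply: is_derive_eq (is_deriveB (is_derive_cst (1 : R) x 1) (is_derive_id x 1)) _; rewrite sub0r.
have x1' : 0 < 1 - x by rewrite subr_gt0.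
have d3 := @is_derive1_comp R (@xlnx R) (fun u => 1 - u) x _ _ (is_derive_xlnx x1') d2.
have d4 : is_derive x 1 (fun u : R => u * ln p) (ln p).
  by apply: is_derive_eq (is_deriveM (is_derive_id x 1) (is_derive_cst (ln p) x 1)) _;
    rewrite /GRing.scale /= mulr0 add0r mulr1.
have d5 : is_derive x 1 (fun u : R => (1 - u) * ln (1 - p)) (- ln (1 - p)).
  by apply: is_derive_eq (is_deriveM d2 (is_derive_cst (ln (1 - p)) x 1)) _;
    rewrite /GRing.scale /= mulr0 add0r mulrN1.
apply: is_derive_eq (is_deriveB (is_deriveB (is_deriveD d1 d3) d4) d5) _.
by rewrite /ent_slope; lra.
Qed.

Lemma is_derive_gap p r s x : 0 < x < 1 ->
  is_derive x 1 (gap p r s) (ent_slope p x - 2 * s * x).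
Proof.
move=> x01.
have d1 : is_derive x 1 (fun u : R => u ^+ 2) (2 * x).
  by apply: is_derive_eq (is_deriveX 2 (is_derive_id x 1)) _; rewrite /GRing.scale/= mulr1 expr1.
have d2 := is_deriveB d1 (is_derive_cst (r ^+ 2) x 1).
have d3 := is_deriveM (is_derive_cst s x 1) d2.
have d4 := is_deriveB (is_deriveB (is_derive_ent p x01) (is_derive_cst (ent p r) x 1)) d3.
by apply: is_derive_eq d4 _; rewrite /GRing.scale/= !subr0 mulr0 addr0; ring.
Qed.

Lemma is_derive_gap_slope p s x : 0 < x < 1 ->
  is_derive x 1 (fun u => ent_slope p u - 2 * s * u) (x^-1 + (1 - x)^-1 - 2 * s).
Proof.
move=> /andP[x0 x1].
have x1' : 0 < 1 - x by rewrite subr_gt0.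
have d1 := is_derive1_ln x0.
have d2 : is_derive x 1 (fun u : R => 1 - u) (- 1).
  by apply: is_derive_eq (is_deriveB (is_derive_cst (1 : R) x 1) (is_derive_id x 1)) _; rewrite sub0r.
have d3 := @is_derive1_comp R (@ln R) (fun u => 1 - u) x _ _ (is_derive1_ln x1') d2.
have d4 := is_deriveB (is_deriveB d1 (is_derive_cst (ln p) x 1))
  (is_deriveB d3 (is_derive_cst (ln (1 - p)) x 1)).
have d5 := is_deriveM (is_derive_cst (2 * s) x 1) (is_derive_id x 1).
apply: is_derive_eq (is_deriveB d4 d5) _.
by rewrite /GRing.scale/= !subr0 mulr0 addr0 mulrN1 opprK mulr1.
Qed.

Lemma Rolle_on01 (f df : R -> R) a b : 0 < a -> a < b -> b < 1 ->
  (forall x, 0 < x < 1 -> is_derive x 1 f (df x)) -> f a = f b ->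
  exists2 c, a < c < b & df c = 0.
Proof.
move=> a0 ab b1 fd fab.
have dab : {in `[a, b], forall x, derivable f x 1}.
  move=> x; rewrite in_itv/= => /andP[ax xb].
  by have [] : is_derive x 1 f (df x) by apply: fd; rewrite (lt_le_trans a0 ax) (le_lt_trans xb b1).
have dab' : forall x, x \in `]a, b[ -> derivable f x 1.
  by move=> x xab; apply: dab; move: xab; rewrite !in_itv/= => /andP[/ltW -> /ltW ->].
have [c cab dc] := Rolle ab dab' (derivable_within_continuous dab) fab.
exists c; first by move: cab; rewrite in_itv.
move: cab; rewrite in_itv/= => /andP[ac cb].
have dc' : is_derive c 1 f (df c) by apply: fd; rewrite (lt_trans a0 ac) (lt_trans cb b1).
by rewrite -(@derive_val _ _ _ _ _ _ _ dc') (@derive_val _ _ _ _ _ _ _ dc).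
Qed.

(** [1 / x + 1 / (1 - x) = 1 / (x (1 - x))] takes each value at most at two points, which
    are symmetric about 1/2. *)
Lemma inv_sum_eq x y s : 0 < x -> x < y -> y < 1 ->
  x^-1 + (1 - x)^-1 - 2 * s = 0 -> y^-1 + (1 - y)^-1 - 2 * s = 0 -> x + y = 1.
Proof.
move=> x0 xy y1 ex ey.
have x1 : x < 1 by exact: lt_trans y1.
have y0 : 0 < y by exact: lt_trans xy.
have e (z : R) : 0 < z -> z < 1 -> z^-1 + (1 - z)^-1 = (z * (1 - z))^-1.
  by move=> z0 z1; field; rewrite gt_eqF ?subr_gt0//= gt_eqF.
have : (x * (1 - x))^-1 = (y * (1 - y))^-1 by rewrite -!e//; lra.
move=> /invr_inj exy.
have : (y - x) * (1 - (x + y)) = 0 by lra.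
by move/eqP; rewrite mulf_eq0 subr_eq0 (gt_eqF xy)/= subr_eq0 => /eqP.
Qed.

Lemma sqr_diff_le (a b e : R) : 0 <= a -> a <= 1 -> 0 <= b -> b <= 1 -> 0 <= e ->
  a <= b + e -> a ^+ 2 - b ^+ 2 <= 2 * e.
Proof. by move=> *; have [?|?] := leP a b; nra. Qed.

Section contact.
Variables p r : R.
Hypotheses (p01 : 0 < p < 1) (pr : p < r) (r1 : r < 1) (tg : tangent_condition p r).

Let s := tangent_slope p r.
Let g := gap p r s.
Let p0 : 0 < p. Proof. by case/andP: p01. Qed.
Let p1 : p < 1. Proof. by case/andP: p01. Qed.
Let r0 : 0 < r. Proof. exact: lt_trans pr. Qed.

Let s0 : 0 < s.
Proof. by rewrite /s /tangent_slope divr_gt0 ?ent_slope_gt0// mulr_gt0. Qed.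

Let g0 u : 0 <= u <= 1 -> 0 <= g u.
Proof. by move=> u01; have := tg u01; rewrite /g /gap -/s; lra. Qed.

Let gr : g r = 0.
Proof. by rewrite /g /gap; lra. Qed.

Let stationary q : 0 < q < 1 -> g q = 0 -> ent_slope p q - 2 * s * q = 0.
Proof.
move=> q01 gq.
have dg := is_derive_gap p r s q01.
have d0 : is_derive q 1 g 0.
  apply: (@derive1_at_min R g 0 1 q ler01).
  - move=> t; rewrite in_itv/= => t01.
    by have [] := is_derive_gap p r s t01.
  - by rewrite in_itv.
  - move=> t; rewrite in_itv/= gq => /andP[t0 t1]; apply: g0.
    by rewrite !ltW.
by rewrite -(@derive_val _ _ _ _ _ _ _ dg) (@derive_val _ _ _ _ _ _ _ d0).
Qed.

Let g_at0 : 0 < g 0.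
Proof.
have := g0 (_ : 0 <= p <= 1); rewrite /g /gap ent_pp ent_p0 => H.
have : ln (1 - p) < 0 by rewrite ln_lt0// subr_gt0 p1/=; have := p0; lra.
have : 0 < s * p ^+ 2 by rewrite mulr_gt0// exprn_gt0.
have {}H : 0 <= 0 - ent p r - s * (p ^+ 2 - r ^+ 2).
  by apply: H; have := p0; have := p1; lra.
by rewrite expr0n/=; lra.
Qed.

(* The derivative of [gap] tends to infinity at 1, so that [gap] is smaller at [1 - e] than
   at 1 for the explicit [e]; a zero at 1 would make it negative there. *)
Let g_at1 : 0 < g 1.
Proof.
have p1' : 0 < 1 - p by rewrite subr_gt0.
rewrite lt_neqAle g0 ?ler01 ?lexx// andbT eq_sym; apply/eqP => g1.
pose e := (1 - p) * expR (- (2 * s)).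
have e0 : 0 < e by rewrite mulr_gt0// expR_gt0.
have e1 : e < 1.
  have : expR (- (2 * s)) <= 1 by rewrite -[leRHS]expR0 ler_expR; have := s0; lra.
  move=> H; have : e <= (1 - p) * 1 by rewrite ler_wpM2l// ltW.
  by have := p0; lra.
have lne : ln e = ln (1 - p) - 2 * s by rewrite /e lnM ?posrE ?expR_gt0// expRK.
have e01 : 0 <= 1 - e <= 1 by lra.
have := g0 e01; rewrite -[X in X <= _]g1 /g /gap ent_p1 /ent subKr => H.
have H1 := xlnx_le0 e01.
have H2 : xlnx e = e * (ln (1 - p) - 2 * s) by rewrite /xlnx lne.
have H3 : 0 < e * - ln p by rewrite mulr_gt0// oppr_gt0 ln_lt0// p0.
have H4 : 0 < s * e ^+ 2 by rewrite mulr_gt0// exprn_gt0.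
move: H; rewrite H2 expr1n; move: (xlnx (1 - e)) (ln (1 - p)) (ln p) H1 H3 H4 => a b c.
by lra.
Qed.

(** With contact points on both sides of [r], the derivative of [gap] has zeros at the three
    contacts and, by Rolle, one more between the first two; its own derivative then has
    three zeros, two consecutive pairs of which sum to 1 by [inv_sum_eq], a contradiction. *)
Lemma contact_one_sided q1 q3 : 0 <= q1 <= 1 -> 0 <= q3 <= 1 -> q1 < r -> r < q3 ->
  g q1 = 0 -> g q3 = 0 -> False.
Proof.
move=> /andP[q10 q11] /andP[q30 q31] q1r rq3 g1 g3.
have {}q10 : 0 < q1.
  rewrite lt_neqAle q10 andbT; apply/eqP => e; have := g_at0.
  by move: g1; rewrite -e => ->; rewrite ltxx.
have {}q31 : q3 < 1.
  rewrite lt_neqAle q31 andbT; apply/eqP => e; have := g_at1.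
  by move: g3; rewrite e => ->; rewrite ltxx.
have [x /andP[q1x xr] dx] := Rolle_on01 q10 q1r r1 (fun x => @is_derive_gap p r s x)
  (etrans g1 (esym gr)).
have q10' : 0 < q1 < 1 by rewrite q10 (lt_trans q1r r1).
have q30' : 0 < q3 < 1 by rewrite q31 (lt_trans r0 rq3).
have r01 : 0 < r < 1 by rewrite r0.
have s1 := stationary q10' g1; have s3 := stationary q30' g3; have sr := stationary r01 gr.
have x0 := lt_trans q10 q1x; have x1 := lt_trans xr r1.
have [z1 /andP[? ?] d1] := Rolle_on01 q10 q1x x1 (fun x => @is_derive_gap_slope p s x)
  (etrans s1 (esym dx)).
have [z2 /andP[? ?] d2] := Rolle_on01 x0 xr r1 (fun x => @is_derive_gap_slope p s x)
  (etrans dx (esym sr)).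
have [z3 /andP[? ?] d3] := Rolle_on01 r0 rq3 q31 (fun x => @is_derive_gap_slope p s x)
  (etrans sr (esym s3)).
have z12 : z1 < z2 by lra.
have z23 : z2 < z3 by lra.
have z10 : 0 < z1 by lra.
have z20 : 0 < z2 by lra.
have z31 : z3 < 1 by lra.
have z21 : z2 < 1 by lra.
have := inv_sum_eq z10 z12 z21 d1 d2; have := inv_sum_eq z20 z23 z31 d2 d3.
by lra.
Qed.

Lemma continuous_gap : continuous g.
Proof.
move=> x; rewrite /g /gap; apply: cvgB; last first.
  apply: cvgMr; apply: cvgB; last exact: cvg_cst.
  exact: exprn_continuous.
by apply: cvgB; [exact: continuous_ent | exact: cvg_cst].
Qed.

(** A continuous positive function on a compact interval is bounded away from 0. *)
Lemma gap_coercive a b : 0 <= a -> b <= 1 -> (forall u, a <= u <= b -> g u != 0) ->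
  exists2 C, 0 <= C & forall u, a <= u <= b -> 1 <= C * g u.
Proof.
move=> a0 b1 gn0; have [ab|ba] := leP a b; last first.
  by exists 0 => // u /andP[au ub]; exfalso; have := le_lt_trans (le_trans au ub) ba; rewrite ltxx.
have [c] := EVT_min ab (continuous_subspaceT continuous_gap).
rewrite in_itv/= => cab H.
have gc : 0 < g c.
  rewrite lt_neqAle eq_sym gn0//= g0//; case/andP: cab => ac cb.
  by rewrite (le_trans a0 ac) (le_trans cb b1).
exists (g c)^-1; first by rewrite invr_ge0 ltW.
move=> u uab; rewrite mulrC ler_pdivlMr// mul1r; apply: H.
by rewrite in_itv.
Qed.

(** On the side of [r] without contact points, away from [r], the gap is at least a constant
    and so dominates [|u ^ 2 - r ^ 2|]; on the other side the signed difference [r ^ 2 - u ^ 2]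
    has the right sign to do it. *)
Lemma ent_stability_tangent d : 0 < d -> exists C D, [/\ 0 <= C, 0 <= D &
  forall u, 0 <= u <= 1 ->
    `|u - r| <= d + C * (ent p u - ent p r) + D * (r ^+ 2 - u ^+ 2)].
Proof.
move=> d0; pose e := d * r / 4.
have e0 : 0 < e by rewrite !mulr_gt0// invr_gt0.
have E u : 0 <= u -> `|u - r| * r <= `|u ^+ 2 - r ^+ 2|.
  move=> u0; rewrite subr_sqr normrM ler_wpM2l// ger0_norm ?addr_ge0//; last exact: ltW.
  by lra.
have gE u : ent p u - ent p r = g u + s * (u ^+ 2 - r ^+ 2) by rewrite /g /gap; lra.
have sq1 u : 0 <= u <= 1 -> u ^+ 2 <= 1 /\ r ^+ 2 <= 1 /\ 0 <= u ^+ 2 /\ 0 <= r ^+ 2.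
  have r01 : 0 <= r <= 1 by rewrite (ltW r0) (ltW r1).
  by move=> u01; have /andP[? ?] := sqr01 u01; have /andP[? ?] := sqr01 r01.
(* a contact point below [r] excludes those above; otherwise there is none below *)
have [L|L] := pselect (exists2 q1, 0 <= q1 < r & g q1 = 0).
- have {L} [q1 /andP[q10 q1r] g1] := L.
  have [C C0 HC] : exists2 C, 0 <= C & forall u, r + e <= u <= 1 -> 1 <= C * g u.
    apply: gap_coercive => //; first by have := r0; lra.
    move=> u /andP[ru u1]; apply/eqP => gu.
    by apply: (@contact_one_sided q1 u _ _ _ _ g1 gu); have := r0; have := r1; lra.
  exists (2 * C / r), ((2 * C * s + 1) / r).
  have Cr0 : 0 <= 2 * C / r by rewrite !(divr_ge0, mulr_ge0)// ltW.
  have Cs0 : 0 <= C * s by rewrite mulr_ge0// ltW.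
  have Ds0 : 0 <= (2 * C * s + 1) / r by rewrite divr_ge0// ?ltW//; lra.
  split=> // u u01; have /andP[u0 u1] := u01; have [? [? [? ?]]] := sq1 u u01.
  have Cg : 0 <= C * g u by rewrite mulr_ge0// g0.
  have K : u ^+ 2 - r ^+ 2 <= 2 * e + C * g u.
    have [ue|ue] := leP u (r + e); last first.
      by have := HC u; rewrite (ltW ue) u1 => /(_ isT); lra.
    have H : u ^+ 2 - r ^+ 2 <= 2 * e by apply: sqr_diff_le => //; rewrite ltW.
    by lra.
  rewrite -(ler_pM2r r0); apply: (le_trans (E u u0)).
  rewrite [leRHS](_ : _ = 4 * e + 2 * (C * g u) + (r ^+ 2 - u ^+ 2)); last first.
    by rewrite gE /e; field; rewrite gt_eqF.
  by rewrite ler_norml; lra.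
have [C0 C00 HC0] : exists2 C, 0 <= C & forall u, 0 <= u <= r - e -> 1 <= C * g u.
  apply: gap_coercive => //; first by have := r1; lra.
  move=> u /andP[u0 ur]; apply/eqP => gu; apply: L; exists u => //.
  by rewrite u0/=; lra.
pose C := C0 + (2 * s)^-1.
have s20 : 0 < 2 * s by rewrite mulr_gt0.
have C0s : 0 <= C0 * s by rewrite mulr_ge0// ltW.
have Cge : 0 <= C by rewrite addr_ge0// invr_ge0 ltW.
have Cs : 2 * C * s = 2 * (C0 * s) + 1 by rewrite /C; field; rewrite gt_eqF.
exists (2 * C / r), ((2 * C * s - 1) / r).
have Cr0 : 0 <= 2 * C / r by rewrite !(divr_ge0, mulr_ge0)// ltW.
have Ds0 : 0 <= (2 * C * s - 1) / r.
  by apply: divr_ge0; [rewrite Cs; lra | exact: ltW].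
split=> // u u01; have /andP[u0 u1] := u01; have [? [? [? ?]]] := sq1 u u01.
have gu0 := g0 u01.
have Cg : 0 <= C * g u by rewrite mulr_ge0.
have Cg0 : C0 * g u <= C * g u by rewrite ler_wpM2r// /C lerDl invr_ge0 ltW.
have K : r ^+ 2 - u ^+ 2 <= 2 * e + C * g u.
  have [ue|ue] := leP u (r - e).
    by have := HC0 u; rewrite u0 ue => /(_ isT); lra.
  have H : r ^+ 2 - u ^+ 2 <= 2 * e.
    apply: sqr_diff_le => //; try exact: ltW.
    by rewrite -lerBlDr ltW.
  by lra.
rewrite -(ler_pM2r r0); apply: (le_trans (E u u0)).
rewrite [leRHS](_ : _ = 4 * e + 2 * (C * g u) - (r ^+ 2 - u ^+ 2)); last first.
  by rewrite gE /e; field; rewrite gt_eqF.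
by rewrite ler_norml; lra.
Qed.

End contact.

(** Compare with the tangent at the midpoint of [u] and [p], whose slope has the sign of [u - p]. *)
Lemma ent_gt0 p u : 0 < p < 1 -> 0 <= u <= 1 -> u != p -> 0 < ent p u.
Proof.
move=> p01 u01 up; have /andP[p0 p1] := p01.
pose m := (u + p) / 2; have m01 : 0 < m < 1 by rewrite /m; lra.
have /andP[m0 m1] := m01.
have m01' : 0 <= m <= 1 by rewrite (ltW m0) (ltW m1).
have := ent_tangent p m01 u01; have := ent_ge0 p01 m01' => em ?.
have um : u - m = (u - p) / 2 by rewrite /m; lra.
suff : 0 < ent_slope p m * (u - m) by lra.
rewrite um; have [up'|pu] := ltP u p.
  have mp : m < p by rewrite /m; lra.
  have : ent_slope p m < 0.
    have : ln m < ln p by rewrite ltr_ln ?posrE.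
    have : ln (1 - p) < ln (1 - m) by rewrite ltr_ln ?posrE; lra.
    by rewrite /ent_slope; lra.
  by move=> H; rewrite nmulr_rgt0//; lra.
have {}pu : p < u by rewrite lt_neqAle eq_sym up.
have : 0 < ent_slope p m by apply: ent_slope_gt0 => //; rewrite /m; lra.
by move=> H; rewrite pmulr_rgt0//; lra.
Qed.

(** For [r = p] the tangent is horizontal and the entropy alone controls [u - p]. *)
Lemma ent_stability_p p d : 0 < p < 1 -> 0 < d -> exists2 C, 0 <= C &
  forall u, 0 <= u <= 1 -> `|u - p| <= d + C * ent p u.
Proof.
move=> p01 d0; have /andP[p0 p1] := p01.
have side a b : 0 <= a -> b <= 1 -> (forall u, a <= u <= b -> u != p) ->
    exists2 C, 0 <= C & forall u, a <= u <= b -> 1 <= C * ent p u.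
  move=> a0 b1 np; have [ab|ba] := leP a b; last first.
    by exists 0 => // u /andP[au ub]; exfalso; have := le_lt_trans (le_trans au ub) ba; rewrite ltxx.
  have [c] := EVT_min ab (continuous_subspaceT (@continuous_ent R p)).
  rewrite in_itv/= => cab H.
  have gc : 0 < ent p c.
    by apply: ent_gt0 => //; [case/andP: cab => ac cb; rewrite (le_trans a0 ac) (le_trans cb b1) | exact: np].
  exists (ent p c)^-1; first by rewrite invr_ge0 ltW.
  by move=> u uab; rewrite mulrC ler_pdivlMr// mul1r; apply: H; rewrite in_itv.
have [C1 C10 H1] : exists2 C, 0 <= C & forall u, 0 <= u <= p - d -> 1 <= C * ent p u.
  by apply: side => //; [lra | move=> u ud; apply/eqP => e; move: ud; rewrite e; lra].
have [C2 C20 H2] : exists2 C, 0 <= C & forall u, p + d <= u <= 1 -> 1 <= C * ent p u.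
  by apply: side => //; [lra | move=> u ud; apply/eqP => e; move: ud; rewrite e; lra].
exists (C1 + C2); first exact: addr_ge0.
move=> u u01; have /andP[u0 u1] := u01; have E := ent_ge0 p01 u01.
have E1 : 0 <= C1 * ent p u by rewrite mulr_ge0.
have E2 : 0 <= C2 * ent p u by rewrite mulr_ge0.
rewrite mulrDl ler_norml; apply/andP; split.
  have [ud|ud] := leP u (p - d); last lra.
  by have := H1 u; rewrite u0 ud => /(_ isT); lra.
have [ud|ud] := leP (p + d) u; last lra.
by have := H2 u; rewrite u1 ud => /(_ isT); lra.
Qed.

(** The form in which the minorant condition is integrated in [entropy_close]: the terms
    other than [d] average to quantities which are small for almost optimal graphons.  At [r = 1] it
    reduces to [1 - u <= 1 - u ^ 2]. *)
Lemma ent_stability p r d : 0 < p < 1 -> p <= r <= 1 -> chord_condition p r -> 0 < d ->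
  exists C D, [/\ 0 <= C, 0 <= D & forall u, 0 <= u <= 1 ->
    `|u - r| <= d + C * (ent p u - ent p r) + D * (r ^+ 2 - u ^+ 2)].
Proof.
move=> p01 /andP[pr r1] ch d0; have /andP[p0 p1] := p01.
have [lr1|ler1] := ltP r 1; last first.
  have -> : r = 1 by apply/le_anti; rewrite r1.
  exists 0, 1; split=> // u /andP[u0 u1].
  rewrite mul0r addr0 mul1r expr1n ler0_norm ?subr_le0// opprB.
  have H : 0 <= u * (1 - u) by rewrite mulr_ge0 ?subr_ge0.
  by rewrite expr2; lra.
have [e|rp] := eqVneq r p.
  have [C C0 H] := ent_stability_p p01 d0.
  exists C, 0; split=> // u u01; rewrite e ent_pp subr0 mul0r addr0; exact: H.
have {}pr : p < r by rewrite lt_neqAle eq_sym rp.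
apply: ent_stability_tangent => //; apply: chord_tangent => //.
by rewrite ltW.
Qed.

End Stability.

(** * Bipartite graphons and their rate *)

Section Bipartite.
Context {R : realType}.
Local Open Scope classical_set_scope.
Local Open Scope ring_scope.

Local Notation mu := (@lebesgue_measure R).
Local Notation mu2 := (mu \x mu)%E.
Local Notation RR := (measurableTypeR R).
Local Notation I := (@I01 R : set RR).
Implicit Types (u v : R -> R) (f g h : R * R -> R).

Lemma bm1_le_ind (c : R) : bm1 (fun x => ((x <= c)%R)%:R : R).
Proof.
split; first by apply: measurable_le_ind; [exact: measurable_id | exact: measurable_cst].
by exists 1 => x _; case: (x <= c); rewrite ?normr1 ?normr0.
Qed.

Transparent E1.
Lemma E1_le_ind (c : R) : 0 <= c <= 1 -> E1 (fun x => ((x <= c)%R)%:R) = c.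
Proof.
move=> /andP[c0 c1].
have mc : @measurable _ RR `]-oo, c]%classic by exact: measurable_itv.
rewrite (_ : (fun x : R => _) = \1_(`]-oo, c]%classic : set RR)); last first.
  by apply/funext => x; rewrite indicE; congr (nat_of_bool _)%:R;
    apply/idP/idP => [xc|/set_mem]; rewrite ?mem_setE ?in_itv//= in_itv.
rewrite /E1 /Rintegral integral_indic//; last exact: measurable_I01.
rewrite (_ : _ `&` _ = `[0, c]%classic); last first.
  apply/seteqP; split=> x /=; rewrite !in_itv/=.
    by move=> [xc]; rewrite /I01 /= in_itv/= => /andP[-> _].
  by move=> /andP[x0 xc]; split=> //; rewrite /I01 /= in_itv/= x0 (le_trans xc c1).
rewrite [X in fine X](_ : _ = c%:E)//.
apply: (eq_trans (lebesgue_measure_itv _)); rewrite /= lte_fin.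
by case: ltgtP c0 => // [_|<-] _; rewrite ?oppr0 ?adde0 ?sube0.
Qed.
Opaque E1.

Section gamma.
Variable gamma : R.
Hypothesis g01 : 0 < gamma < 1.

Definition iA x : R := ((x <= gamma)%R)%:R.
Definition iB x : R := ((gamma < x)%R)%:R.

Lemma iA_ind x : iA x = ((x <= gamma)%R)%:R.
Proof. by []. Qed.

Lemma iB_ind x : iB x = ((gamma < x)%R)%:R.
Proof. by []. Qed.

Lemma iB_compl x : iB x = 1 - iA x.
Proof. by rewrite /iA /iB ltNge; case: (x <= gamma); rewrite ?subrr ?subr0. Qed.

Lemma bm1_iA : bm1 iA. Proof. exact: bm1_le_ind. Qed.

Lemma bm1_iB : bm1 iB.
Proof.
have bA := bm1_iA; suff : bm1 (fun x => 1 - iA x) by apply: eq_bm => x _; rewrite iB_compl.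
by bmt.
Qed.

Lemma E1_iA : E1 iA = gamma.
Proof. by apply: E1_le_ind; rewrite !ltW; case/andP: g01. Qed.

Lemma E1_iB : E1 iB = 1 - gamma.
Proof.
have bA := bm1_iA; rewrite (@eq_E1 _ _ (fun x => 1 - iA x)); last by move=> x _; rewrite iB_compl.
by rewrite E1B; [rewrite E1_cst E1_iA | bmt..].
Qed.

Lemma iA01 x : 0 <= iA x <= 1.
Proof. by rewrite /iA; case: (x <= gamma); rewrite /= ?lexx ?ler01. Qed.

Lemma iB01 x : 0 <= iB x <= 1.
Proof. by rewrite /iB; case: (gamma < x); rewrite /= ?lexx ?ler01. Qed.

Lemma iA_sqr x : iA x * iA x = iA x.
Proof. by rewrite /iA; case: (x <= gamma); rewrite /= ?mulr1 ?mulr0. Qed.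

Lemma iB_sqr x : iB x * iB x = iB x.
Proof. by rewrite /iB; case: (gamma < x); rewrite /= ?mulr1 ?mulr0. Qed.

Lemma iAB x : iA x * iB x = 0.
Proof. by rewrite iB_compl mulrBr mulr1 iA_sqr subrr. Qed.

Definition EAB (F : R -> R -> R) : R := E2 (fun x y => iA x * (iB y * F x y)).

Lemma bm2_AB F : bm2 F -> bm2 (fun x y => iA x * (iB y * F x y)).
Proof. by move=> bF; have bA := bm1_iA; have bB := bm1_iB; bmt. Qed.

Lemma EAB_le F G : bm2 F -> bm2 G -> (forall x y, I x -> I y -> F x y <= G x y) ->
  EAB F <= EAB G.
Proof.
move=> bF bG FG; apply: E2_le; [exact: bm2_AB..|] => x y Ix Iy.
have /andP[A0 _] := iA01 x; have /andP[B0 _] := iB01 y.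
by rewrite !ler_wpM2l ?FG.
Qed.

Lemma eq_EAB F G : (forall x y, I x -> I y -> x <= gamma -> gamma < y -> F x y = G x y) ->
  EAB F = EAB G.
Proof.
move=> FG; apply: eq_E2 => x y Ix Iy; rewrite /iA /iB.
case: (boolP (x <= gamma)) => xg; last by rewrite !mul0r.
case: (boolP (gamma < y)) => yg; last by rewrite !mul0r.
by rewrite FG.
Qed.

Lemma EABD F G : bm2 F -> bm2 G -> EAB (fun x y => F x y + G x y) = EAB F + EAB G.
Proof.
move=> bF bG; rewrite /EAB -E2D; [|exact: bm2_AB..].
by apply: eq_E2 => x y _ _; rewrite !mulrDr.
Qed.

Lemma EABZ c F : bm2 F -> EAB (fun x y => c * F x y) = c * EAB F.
Proof.
move=> bF; rewrite /EAB -E2Z; last exact: bm2_AB.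
by apply: eq_E2 => x y _ _; rewrite (mulrCA (iB y)) (mulrCA (iA x)).
Qed.

Lemma EAB_cst c : EAB (fun _ _ => c) = c * (gamma * (1 - gamma)).
Proof.
have bA := bm1_iA; have bB := bm1_iB; rewrite /EAB.
rewrite (E2_prod (u := iA) (v := fun y => iB y * c))//; last by bmt.
by rewrite E1Zr// E1_iA E1_iB; ring.
Qed.

Lemma EAB_affine (a b c : R) F G : bm2 F -> bm2 G ->
  EAB (fun x y => a + b * F x y + c * G x y) =
  a * (gamma * (1 - gamma)) + b * EAB F + c * EAB G.
Proof.
move=> bF bG.
have b0 : bm2 (fun _ _ : R => a) by exact: bm_cst.
have b1 : bm2 (fun x y => b * F x y) by bmt.
have b2 : bm2 (fun x y => c * G x y) by bmt.
have b3 : bm2 (fun x y => a + b * F x y) by bmt.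
by rewrite (EABD b3 b2) (EABD b0 b1) (EABZ _ bF) (EABZ _ bG) EAB_cst.
Qed.

Definition bipartite h : Prop := graphon h /\
  forall x y, I x -> I y -> (x <= gamma) = (y <= gamma) -> h (x, y) = 0.

Lemma bipartite_split h x y : bipartite h -> I x -> I y ->
  h (x, y) = iA x * (iB y * h (x, y)) + iB x * (iA y * h (x, y)).
Proof.
move=> [gh h0] Ix Iy; have [e|] := eqVneq (x <= gamma) (y <= gamma).
  by rewrite h0// !mulr0 addr0.
by rewrite /iA /iB !ltNge; case: (x <= gamma); case: (y <= gamma) => //= _;
  rewrite ?(mul1r, mul0r, addr0, add0r).
Qed.

(** The two off-diagonal blocks contribute equally, by symmetry. *)
Lemma E2_bipartite (k : R -> R) h : bipartite h -> k 0 = 0 ->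
  bm2 (fun x y => k (h (x, y))) ->
  E2 (fun x y => k (h (x, y))) = 2 * EAB (fun x y => k (h (x, y))).
Proof.
move=> bh k0 bk; have [gh h0] := bh; have bk' := bm2_swap bk.
have bA := bm1_iA; have bB := bm1_iB.
have -> : E2 (fun x y => k (h (x, y))) =
  EAB (fun x y => k (h (x, y))) + E2 (fun x y => iB x * (iA y * k (h (x, y)))).
  rewrite /EAB -E2D; [|by bmt..]; apply: eq_E2 => x y Ix Iy.
  have [e|] := eqVneq (x <= gamma) (y <= gamma).
    by rewrite h0// k0 !mulr0 addr0.
  by rewrite /iA /iB !ltNge; case: (x <= gamma); case: (y <= gamma) => //= _;
    rewrite ?(mul1r, mul0r, addr0, add0r).
rewrite [X in _ + X]E2_swap; last by bmt.
rewrite [X in _ + X](_ : _ = EAB (fun x y => k (h (x, y)))).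
  by rewrite mulr_natl mulr2n.
by apply: eq_E2 => x y Ix Iy; have [_ hs _] := gh; rewrite hs// mulrCA.
Qed.

Section p.
Variable p : R.
Hypothesis p01 : 0 < p < 1.

Lemma ent_le (u : R) : 0 <= u <= 1 -> ent p u <= - ln p - ln (1 - p).
Proof.
move=> u01; have /andP[u0 u1] := u01; have /andP[p0 p1] := p01.
have := xlnx_le0 u01; have := @xlnx_le0 R (1 - u).
have -> : 0 <= 1 - u <= 1 by lra.
move=> /(_ isT) H1 H2.
have H3 : u * - ln p <= 1 * - ln p by rewrite ler_wpM2r// oppr_ge0 ln_le0// ltW.
have H4 : (1 - u) * - ln (1 - p) <= 1 * - ln (1 - p).
  by rewrite ler_wpM2r ?oppr_ge0 ?ln_le0//; lra.
by rewrite /ent; lra.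
Qed.

Lemma bm_ent d (T : measurableType d) (D : set T) (k : T -> R) :
  (forall x, D x -> 0 <= k x <= 1) -> bm D k -> bm D (fun x => ent p (k x)).
Proof.
move=> k01; apply: (bm_comp _ k01 (c := - ln p - ln (1 - p))).
  exact: continuous_measurable_fun (@continuous_ent R p).
by move=> y y01; rewrite ger0_norm ?ent_le ?ent_ge0.
Qed.

Lemma bm2_ent h : graphon h -> bm2 (fun x y => ent p (h (x, y))).
Proof.
move=> gh; apply: (bm_ent _ (graphon_bm2 gh)) => -[x y] [Ix Iy].
by have [_ _] := gh; apply.
Qed.

Definition offdiag x y : R := iA x * iB y + iB x * iA y.
Definition ondiag x y : R := 1 - offdiag x y.

Lemma offdiagE x y : offdiag x y = ((x <= gamma) != (y <= gamma))%:R.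
Proof.
by rewrite /offdiag /iA /iB !ltNge; case: (x <= gamma); case: (y <= gamma);
  rewrite /= ?(mul1r, mul0r, mulr0, addr0, add0r).
Qed.

Lemma bm2_offdiag : bm2 offdiag.
Proof. by have bA := bm1_iA; have bB := bm1_iB; rewrite /offdiag; bmt. Qed.

Lemma bm2_ondiag : bm2 ondiag.
Proof. by have b := bm2_offdiag; rewrite /ondiag; bmt. Qed.

Let W0 := bip_graphon gamma p.

(** One expression for both cases of the relative entropy, in which [+oo * 0 = 0] makes the
    infinite term disappear off the diagonal; measurability follows from it. *)
Lemma rel_entropy_W0 h x y : graphon h -> I x -> I y ->
  rel_entropy (W0 (x, y)) (h (x, y)) =
  ((offdiag x y * ent p (h (x, y)))%:E + +oo * (ondiag x y * h (x, y))%:E)%E.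
Proof.
move=> gh Ix Iy; have [_ _ h01] := gh; rewrite /W0 /bip_graphon /ondiag offdiagE /=.
case: eqVneq => _ /=.
  rewrite rel_entropy_p0 mul0r subr0 mul1r add0e.
  case: eqVneq => [->|hn0]; first by rewrite mule0.
  rewrite gt0_mulye// lte_fin lt_neqAle eq_sym hn0.
  by have /andP[] := h01 _ _ Ix Iy.
by rewrite rel_entropyE ?h01// mul1r subrr mul0r mule0 adde0.
Qed.

Lemma measurable_rel_entropy_W0 h : graphon h ->
  @measurable_fun _ _ (RR * RR)%type _ (I `*` I) (fun z => rel_entropy (W0 z) (h z)).
Proof.
move=> gh; have bo := bm2_offdiag; have bd := bm2_ondiag; have be := bm2_ent gh.
have bh := graphon_bm2 gh.
have [m1 _] : bm2 (fun x y => offdiag x y * ent p (h (x, y))) by bmt.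
have [m2 _] : bm2 (fun x y => ondiag x y * h (x, y)) by bmt.
have m3 : @measurable_fun _ _ (RR * RR)%type _ (I `*` I)
    (fun z => (offdiag z.1 z.2 * ent p (h (z.1, z.2)))%:E + +oo * (ondiag z.1 z.2 * h (z.1, z.2))%:E)%E.
  apply: emeasurable_funD; first exact/measurable_EFinP.
  by apply: measurable_funeM; exact/measurable_EFinP.
apply: eq_measurable_fun m3 => -[x y] /set_mem[Ix Iy] /=.
by rewrite -rel_entropy_W0.
Qed.

Lemma E2_offdiag h : graphon h -> E2 (fun x y => offdiag x y * ent p (h (x, y))) =
  2 * EAB (fun x y => ent p (h (x, y))).
Proof.
move=> gh; have be := bm2_ent gh; have be' := bm2_swap be.
have bA := bm1_iA; have bB := bm1_iB.
have -> : E2 (fun x y => offdiag x y * ent p (h (x, y))) =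
  EAB (fun x y => ent p (h (x, y))) + E2 (fun x y => iB x * (iA y * ent p (h (x, y)))).
  rewrite /EAB -E2D; [|by bmt..]; apply: eq_E2 => x y _ _.
  by rewrite /offdiag mulrDl !mulrA.
rewrite [X in _ + X]E2_swap; last by bmt.
rewrite [X in _ + X](_ : _ = EAB (fun x y => ent p (h (x, y)))).
  by rewrite mulr_natl mulr2n.
by apply: eq_E2 => x y Ix Iy; have [_ hs _] := gh; rewrite hs// mulrCA.
Qed.

(** The factor 1/2 of the rate compensates for the two off-diagonal blocks. *)
Lemma rate_labelled_bipartite h : bipartite h ->
  rate_labelled W0 h = (EAB (fun x y => ent p (h (x, y))))%:E.
Proof.
move=> bh; have [gh h0] := bh; have bo := bm2_offdiag; have be := bm2_ent gh.
have bod : bm2 (fun x y => offdiag x y * ent p (h (x, y))) by bmt.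
rewrite /rate_labelled.
have -> : (\int[mu2]_(z in I `*` I) rel_entropy (W0 z) (h z) =
  \int[mu2]_(z in I `*` I) (offdiag z.1 z.2 * ent p (h (z.1, z.2)))%:E)%E.
  apply: eq_integral => -[x y] /set_mem[Ix Iy].
  rewrite rel_entropy_W0//= /ondiag offdiagE; case: eqVneq => e /=.
    by rewrite subr0 mul1r h0// mule0 adde0.
  by rewrite subrr mul0r mule0 adde0.
rewrite (Fubini12 bod) -EFinM; congr EFin.
by rewrite E2_offdiag// mulrA mulVf// mul1r.
Qed.

Definition bip_part h : R * R -> R :=
  fun z => if (z.1 <= gamma) == (z.2 <= gamma) then 0 else h z.

Lemma bip_partE h x y : bip_part h (x, y) = offdiag x y * h (x, y).
Proof. by rewrite /bip_part /= offdiagE; case: eqVneq => _ /=; rewrite ?mul0r ?mul1r. Qed.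

Lemma bip_part_bipartite h : graphon h -> bipartite (bip_part h).
Proof.
move=> gh; have [_ hs h01] := gh; split; last first.
  by move=> x y _ _ e; rewrite /bip_part/= e eqxx.
split.
- have bo := bm2_offdiag; have bh := graphon_bm2 gh.
  have [+ _] : bm2 (fun x y => offdiag x y * h (x, y)) by bmt.
  by apply: eq_measurable_fun => -[x y] _; rewrite -bip_partE.
- by move=> x y Ix Iy; rewrite /bip_part/= eq_sym hs.
- move=> x y Ix Iy; rewrite /bip_part/=; case: ifP => _; last exact: h01.
  by rewrite lexx ler01.
Qed.

Lemma ondiag_mul_ge0 h x y : graphon h -> I x -> I y -> 0 <= ondiag x y * h (x, y).
Proof.
move=> [_ _ h01] Ix Iy; have /andP[? _] := h01 _ _ Ix Iy.
by rewrite mulr_ge0// /ondiag offdiagE; case: (_ != _); rewrite /= ?subrr ?subr0.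
Qed.

Lemma cut_dist_bip_part h : graphon h -> E2 (fun x y => ondiag x y * h (x, y)) = 0 ->
  cut_dist_labelled h (bip_part h) = 0.
Proof.
move=> gh d0; have [gh0 _] := bip_part_bipartite gh.
apply/le_anti/andP; split; last exact: cut_dist_labelled_ge0.
apply: (le_trans (cut_dist_labelled_L1 gh gh0)); rewrite -d0; apply: le_of_eq.
apply: eq_E2 => x y Ix Iy; rewrite bip_partE -(ger0_norm (ondiag_mul_ge0 gh Ix Iy)) /ondiag.
by rewrite mulrBl mul1r.
Qed.

(** Replacing the infinite penalty on the diagonal blocks by [N] for every [N] shows that a
    graphon of finite rate has no mass there, so that removing it changes nothing. *)
Lemma rate_labelled_bip_part h c : graphon h -> (rate_labelled W0 h <= c%:E)%E ->
  EAB (fun x y => ent p (bip_part h (x, y))) <= c /\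
  cut_dist_labelled h (bip_part h) = 0.
Proof.
move=> gh hc; have bip := bip_part_bipartite gh; have [gh0 _] := bip.
have [_ _ h01] := gh.
have bo := bm2_offdiag; have bd := bm2_ondiag; have be := bm2_ent gh; have bh := graphon_bm2 gh.
have dh0 := ondiag_mul_ge0 gh.
have key (N : nat) : E2 (fun x y => offdiag x y * ent p (h (x, y)) + N%:R * (ondiag x y * h (x, y)))
    <= 2 * c.
  have bN : bm2 (fun x y => offdiag x y * ent p (h (x, y)) + N%:R * (ondiag x y * h (x, y))) by bmt.
  rewrite -lee_fin -(Fubini12 bN).
  have c2 : (c%:E * 2%:E = (2 * c)%:E)%E by rewrite -EFinM mulrC.
  rewrite -c2; apply: (@le_trans _ _ (\int[mu2]_(z in I `*` I) rel_entropy (W0 z) (h z))%E); last first.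
    move: hc; rewrite /rate_labelled; set J := integral _ _ _ => hc.
    have : (2%:E * ((2^-1)%:E * J) <= 2%:E * c%:E)%E by rewrite lee_pmul2l.
    by rewrite muleA -EFinM divff// mul1e muleC.
  apply: ge0_le_integral.
  - exact: measurable_Q.
  - move=> [x y] [Ix Iy] /=; rewrite lee_fin addr_ge0//; last by rewrite mulr_ge0//; exact: dh0.
    by rewrite mulr_ge0 ?ent_ge0 ?h01// offdiagE.
  - by apply/measurable_EFinP; case: bN.
  - exact: measurable_rel_entropy_W0.
  - move=> [x y] [Ix Iy]; rewrite rel_entropy_W0//= EFinD leeD2l//.
    have := dh0 x y Ix Iy; rewrite le_eqVlt => /predU1P[<-|d0].
      by rewrite mulr0 mule0.
    by rewrite gt0_mulye ?lte_fin// leey.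
have d0 : E2 (fun x y => ondiag x y * h (x, y)) = 0.
  apply/le_anti/andP; split; last by apply: E2_ge0 => x y Ix Iy; exact: dh0.
  rewrite leNgt; apply/negP => d0.
  have e0 : 0 <= E2 (fun x y => offdiag x y * ent p (h (x, y))).
    apply: E2_ge0 => x y Ix Iy; rewrite mulr_ge0 ?ent_ge0 ?h01// offdiagE//.
  set d := E2 (fun x y => ondiag x y * h (x, y)) in d0.
  have := key (Num.bound `|2 * c / d|).
  rewrite E2D; [|by bmt..]; rewrite E2Z; last by bmt.
  have : 2 * c / d < (Num.bound `|2 * c / d|)%:R.
    exact: (le_lt_trans (ler_norm _) (archi_boundP (normr_ge0 _))).
  rewrite ltr_pdivrMr// -/d; move: (_%:R * d) => Nd; lra.
split; last exact: cut_dist_bip_part.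
have := key 0; rewrite (@eq_E2 _ _ (fun x y => offdiag x y * ent p (h (x, y)))); last first.
  by move=> x y _ _; rewrite mul0r addr0.
rewrite E2_offdiag// => H.
have e : EAB (fun x y => ent p (bip_part h (x, y))) = EAB (fun x y => ent p (h (x, y))).
  by apply: eq_EAB => x y Ix Iy xg yg; rewrite /bip_part/= xg leNgt yg.
by rewrite e; have {H} := H; move: (EAB _) => E; lra.
Qed.

End p.
End gamma.
End Bipartite.
Opaque ent.

(** * The operator norm of bipartite graphons *)

Section BipartiteOperator.
Context {R : realType}.
Local Open Scope classical_set_scope.
Local Open Scope ring_scope.

Local Notation RR := (measurableTypeR R).
Local Notation I := (@I01 R : set RR).
Implicit Types (u v : R -> R) (f g h : R * R -> R).

Lemma kernel_op_adjoint h u v : graphon h -> bm1 u -> bm1 v ->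
  E1 (fun x => u x * kernel_op h v x) = E1 (fun x => v x * kernel_op h u x).
Proof.
move=> gh bu bv; have bh := graphon_bm2 gh; have bh' := bm2_swap bh.
have adj a b : bm1 a -> bm1 b -> E1 (fun x => a x * kernel_op h b x) =
    E2 (fun x y => a x * (h (x, y) * b y)).
  move=> ba bb; rewrite E2E; apply: eq_E1 => x Ix.
  have br := graphon_row gh Ix; rewrite kernel_opE E1Z//; by bmt.
have b2 : bm2 (fun x y => u x * (h (x, y) * v y)) by bmt.
rewrite (adj u v bu bv) (adj v u bv bu) (E2_swap b2).
apply: eq_E2 => x y Ix Iy; have [_ hs _] := gh.
by rewrite (hs y x)// mulrC -mulrA mulrCA.
Qed.

Section gamma.
Variable gamma : R.
Hypothesis g01 : 0 < gamma < 1.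

Local Notation iA := (iA gamma).
Local Notation iB := (iB gamma).
Local Notation EAB := (EAB gamma).
Local Notation bipartite := (bipartite gamma).

Let bA : bm1 iA. Proof. exact: bm1_iA. Qed.
Let bB : bm1 iB. Proof. exact: bm1_iB. Qed.

Lemma nsq_iA v : nsq (fun x => iA x * v x) = E1 (fun x => iA x * v x ^+ 2).
Proof. by apply: eq_E1 => x _; rewrite exprMn expr2 iA_sqr. Qed.

Lemma nsq_iB v : nsq (fun x => iB x * v x) = E1 (fun x => iB x * v x ^+ 2).
Proof. by apply: eq_E1 => x _; rewrite exprMn expr2 iB_sqr. Qed.

Lemma nsq_split v : bm1 v ->
  nsq v = E1 (fun x => iA x * v x ^+ 2) + E1 (fun x => iB x * v x ^+ 2).
Proof.
move=> bv; rewrite /nsq -E1D; [|by bmt..].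
by apply: eq_E1 => x _; rewrite iB_compl -mulrDl addrC subrK mul1r.
Qed.

Lemma kernel_op_bipartite h v x : bipartite h -> bm1 v -> I x ->
  kernel_op h v x = iA x * kernel_op h (fun y => iB y * v y) x +
                    iB x * kernel_op h (fun y => iA y * v y) x.
Proof.
move=> bh bv Ix; have [gh h0] := bh; have br := graphon_row gh Ix.
rewrite !kernel_opE -!E1Z; [|by bmt..]; rewrite -E1D; [|by bmt..].
apply: eq_E1 => y Iy; rewrite {1}(bipartite_split bh Ix Iy).
by move: (iA x) (iB x) (iA y) (iB y) (h _) (v y) => a b c d k w; ring.
Qed.

(** A bipartite kernel maps functions on A to functions on B and conversely, and the two
    maps are adjoint to each other; a bound for one of them is a bound for both. *)
Lemma bip_opnorm_le h s : bipartite h -> 0 <= s ->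
  (forall v, bm1 v -> E1 (fun x => iA x * kernel_op h (fun y => iB y * v y) x ^+ 2) <=
    s ^+ 2 * E1 (fun x => iB x * v x ^+ 2)) ->
  opnorm h <= s.
Proof.
move=> bh s0 H; have [gh h0] := bh; apply: opnorm_le => // v bv v1.
have bAv : bm1 (fun x => iA x * v x) by bmt.
have bBv : bm1 (fun x => iB x * v x) by bmt.
have bkA := bm1_kernel_op gh bAv; have bkB := bm1_kernel_op gh bBv.
pose w x := iB x * kernel_op h (fun y => iA y * v y) x.
have bw : bm1 w by rewrite /w; bmt.
have bBw : bm1 (fun x => iB x * w x) by bmt.
have bkw := bm1_kernel_op gh bBw.
have -> : nsq (kernel_op h v) =
    E1 (fun x => iA x * kernel_op h (fun y => iB y * v y) x ^+ 2) + nsq w.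
  rewrite /nsq -E1D; [|by bmt..].
  apply: eq_E1 => x Ix; rewrite kernel_op_bipartite// /w.
  move: (kernel_op h _ x) (kernel_op h _ x) => k1 k2.
  have A2 := iA_sqr gamma x; have B2 := iB_sqr gamma x; have AB := iAB gamma x.
  rewrite sqrrD [X in X + _ + _]exprMn [X in X * _ + _ + _]expr2 A2.
  by rewrite mulrACA AB mul0r mul0rn addr0.
(* [w] is the image on B of the part of [v] on A; since [nsq w] is the pairing of that part
   with the image of [w], Cauchy-Schwarz and the hypothesis on [w] bound it *)
have Ww : nsq w <= s ^+ 2 * E1 (fun x => iA x * v x ^+ 2).
  have wE : nsq w = E1 (fun x => (iA x * v x) * (iA x * kernel_op h (fun y => iB y * w y) x)).
    transitivity (E1 (fun x => (iB x * w x) * kernel_op h (fun y => iA y * v y) x)).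
      apply: eq_E1 => x _; rewrite /w; move: (kernel_op h _ x) => k.
      by rewrite (mulrA (iB x)) iB_sqr exprMn expr2 iB_sqr expr2 mulrA.
    rewrite kernel_op_adjoint//; apply: eq_E1 => x _.
    by rewrite mulrACA iA_sqr mulrA.
  have bAk : bm1 (fun x => iA x * kernel_op h (fun y => iB y * w y) x) by bmt.
  have := CauchySchwarz bAv bAk; rewrite -wE -/(nsq _) -/(nsq _) nsq_iA nsq_iA => CS.
  have w0 := nsq_ge0 w; set a := E1 (fun x => iA x * v x ^+ 2) in CS *.
  have a0 : 0 <= a by rewrite /a -nsq_iA; exact: nsq_ge0.
  have Hw := H w bw.
  have Bw : E1 (fun x => iB x * w x ^+ 2) = nsq w.
    apply: eq_E1 => x _; rewrite /w; move: (kernel_op h _ x) => k.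
    by rewrite exprMn expr2 iB_sqr mulrA iB_sqr.
  rewrite Bw in Hw.
  have {}CS : nsq w ^+ 2 <= a * (s ^+ 2 * nsq w).
    by apply: (le_trans CS); rewrite ler_wpM2l.
  have [->|wn0] := eqVneq (nsq w) 0; first by rewrite mulr_ge0// sqr_ge0.
  have wp : 0 < nsq w by rewrite lt_neqAle eq_sym wn0.
  rewrite -(ler_pM2r wp) -expr2; apply: (le_trans CS).
  by apply: le_of_eq; ring.
apply: (le_trans (lerD (H v bv) Ww)).
by rewrite -mulrDr addrC -nsq_split// ler_piMr// sqr_ge0.
Qed.

(** Cauchy-Schwarz on each row: the right-hand side is the squared Hilbert-Schmidt norm of the
    off-diagonal block. *)
Lemma bip_opnorm_HS h : bipartite h ->
  opnorm h ^+ 2 <= EAB (fun x y => h (x, y) ^+ 2).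
Proof.
move=> bh; have [gh h0] := bh; have b2 := graphon_bm2 gh.
have EH0 : 0 <= EAB (fun x y => h (x, y) ^+ 2).
  apply: E2_ge0 => x y _ _; have /andP[A0 _] := iA01 gamma x; have /andP[B0 _] := iB01 gamma y.
  by apply: mulr_ge0 => //; apply: mulr_ge0 => //; exact: sqr_ge0.
suff H : opnorm h <= Num.sqrt (EAB (fun x y => h (x, y) ^+ 2)).
  rewrite -[leRHS](sqr_sqrtr EH0) lerXn2r ?nnegrE ?sqrtr_ge0//; exact: opnorm_ge0.
apply: bip_opnorm_le; [exact: bh | exact: sqrtr_ge0 |] => v bv.
rewrite sqr_sqrtr//; set b := E1 (fun x => iB x * v x ^+ 2).
have bBv : bm1 (fun x => iB x * v x) by bmt.
have bk := bm1_kernel_op gh bBv.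
have bm : bm1 (fun x => iA x * E1 (fun y => iB y * h (x, y) ^+ 2)) by bmt.
apply: (@le_trans _ _ (E1 (fun x => iA x * E1 (fun y => iB y * h (x, y) ^+ 2) * b))).
  apply: E1_le => [||x Ix]; [by bmt|by bmt|].
  have /andP[A0 _] := iA01 gamma x; rewrite -mulrA ler_wpM2l//.
  have br := graphon_row gh Ix.
  have bBh : bm1 (fun y => iB y * h (x, y)) by bmt.
  have := CauchySchwarz bBh bBv; rewrite -/(nsq _) -/(nsq _) !nsq_iB -/b.
  apply: le_trans; rewrite kernel_opE; apply: le_of_eq; congr (_ ^+ 2); apply: eq_E1 => y _.
  by rewrite mulrACA iB_sqr mulrCA.
rewrite E1Zr//; apply: le_of_eq; congr (_ * _).
rewrite /EAB E2E; apply: eq_E1 => x Ix; rewrite E1Z//.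
by have br := graphon_row gh Ix; bmt.
Qed.

Lemma bip_graphonE (r x y : R) : bip_graphon gamma r (x, y) = offdiag gamma x y * r.
Proof. by rewrite /bip_graphon offdiagE /=; case: eqVneq => _ /=; rewrite ?mul0r ?mul1r. Qed.

Lemma bip_graphon_bipartite (r : R) : 0 <= r <= 1 -> bipartite (bip_graphon gamma r).
Proof.
move=> r01; split; last by move=> x y _ _ e; rewrite /bip_graphon/= e eqxx.
split.
- have bo := bm2_offdiag gamma; have [+ _] : bm2 (fun x y => offdiag gamma x y * r) by bmt.
  by apply: eq_measurable_fun => -[x y] _; rewrite -bip_graphonE.
- by move=> x y _ _; rewrite /bip_graphon/= eq_sym.
- by move=> x y _ _; rewrite /bip_graphon/=; case: ifP => _; rewrite ?lexx ?ler01.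
Qed.

(** The upper bound is [bip_opnorm_HS]; the indicator of A attains it. *)
Lemma opnorm_bip_graphon (r : R) : 0 <= r <= 1 ->
  opnorm (bip_graphon gamma r) ^+ 2 = r ^+ 2 * (gamma * (1 - gamma)).
Proof.
move=> r01; have bh := bip_graphon_bipartite r01; have [gh _] := bh.
have /andP[g0 g1] := g01; apply/le_anti/andP; split.
  apply: (le_trans (bip_opnorm_HS bh)); rewrite -(EAB_cst g01); apply: le_of_eq.
  apply: eq_EAB => x y _ _ xg yg.
  by rewrite /bip_graphon/= xg [y <= gamma]leNgt yg.
have := opnorm_ge gh bA.
have -> : nsq iA = gamma.
  by rewrite -[RHS](E1_iA g01); apply: eq_E1 => x _; rewrite expr2 iA_sqr.
have -> : nsq (kernel_op (bip_graphon gamma r) iA) = (1 - gamma) * (r * gamma) ^+ 2.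
  rewrite -(E1_iB g01) -E1Zr//; apply: eq_E1 => x Ix; rewrite kernel_opE.
  rewrite (@eq_E1 _ _ (fun y => (iB x * r) * iA y)); last first.
    move=> y _; rewrite bip_graphonE /offdiag.
    transitivity (iB x * r * (iA y * iA y) + r * iA x * (iA y * iB y)); first by ring.
    by rewrite iA_sqr iAB mulr0 addr0.
  by rewrite E1Z// (E1_iA g01) -mulrA exprMn expr2 iB_sqr.
move=> H; rewrite -(ler_pM2r g0); apply: le_trans H; apply: le_of_eq; ring.
Qed.

Variable p : R.
Hypothesis p01 : 0 < p < 1.
Let W0 := bip_graphon gamma p.
Local Notation entropy h := (EAB (fun x y => ent p (h (x, y)))).

(** Off [Omega] the reference graphon is 0, and so is a bipartite graphon. *)
Lemma graphon_Omega_bipartite h : bipartite h -> graphon_Omega W0 h.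
Proof.
move=> [gh h0]; split=> //; apply: aeW => -[x y] [[Ix Iy]] /=.
move=> nO; have W00 : (x <= gamma) = (y <= gamma).
  apply/eqP; apply: contrapT => /negP ne; apply: nO; split=> //=.
  by rewrite /W0 /bip_graphon/= (negbTE ne).
by rewrite h0// /W0 /bip_graphon/= W00 eqxx.
Qed.

Lemma gspace_Omega_gclass h : bipartite h -> gspace_Omega W0 (gclass h).
Proof.
move=> bh; have [gh _] := bh; split; first by exists h.
exists h; first exact: graphon_Omega_bipartite.
have [gr r0] := grepr_gclass gh; rewrite /cut_distc cut_dist_sym//.
Qed.

Lemma rate_le h : bipartite h -> (rate W0 (gclass h) <= (entropy h)%:E)%E.
Proof.
move=> bh; have [gh _] := bh; rewrite /rate ifT; last first.
  by apply/asboolP; exact: gspace_Omega_gclass.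
apply: ge_ereal_sup => _ [eta /= eta0 <-].
rewrite -(rate_labelled_bipartite p01 bh).
apply: ereal_inf_lbound; exists h => //; split=> //.
have [gr r0] := grepr_gclass gh; rewrite /cut_distc cut_dist_sym// r0 ltW//.
Qed.

(** A near minimizer in the definition of the rate, stripped of its null diagonal blocks. *)
Lemma rate_approx F c eta : gspace F -> (rate W0 F <= c%:E)%E -> 0 < eta ->
  exists h, [/\ bipartite h, cut_dist (grepr F) h <= eta & entropy h <= c + eta].
Proof.
move=> /gspaceP[gF _]; rewrite /rate; case: ifP => // _ H eta0.
have : (ereal_inf [set rate_labelled W0 h | h in
    [set h | graphon h /\ (cut_distc F h <= eta)%R]] < (c + eta)%:E)%E.
  apply: (@le_lt_trans _ _ c%:E); last by rewrite lte_fin ltrDl.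
  by apply: le_trans H; apply: ereal_sup_ubound; exists eta.
move=> /ereal_inf_lt[_ [h [gh hF] <-]] /ltW hc.
have [e d0] := rate_labelled_bip_part p01 gh hc.
have bh := bip_part_bipartite gamma gh; have [gh0 _] := bh.
exists (bip_part gamma h); split; [exact: bh| |exact: e].
apply: (le_trans (cut_dist_trans gF gh gh0)).
have := cut_dist_le_labelled gh gh0; rewrite d0 => H1.
by rewrite -[eta]addr0 lerD.
Qed.

(** The norm of a class is almost attained by the graphons near it, so a lower bound for
    bipartite graphons with norm almost [t] passes to the rate. *)
Lemma rate_ge F t V : gspace F -> t <= opnormc F ->
  (forall k, 0 < k -> exists2 e, 0 < e & forall h, bipartite h ->
    t - e <= opnorm h -> V - k <= entropy h) ->
  (V%:E <= rate W0 F)%E.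
Proof.
move=> gsF tF H; have [gF _] := gspaceP gsF.
rewrite leNgt; apply/negP => FV.
have [c cV Fc] : exists2 c, c < V & (rate W0 F <= c%:E)%E.
  move: FV; case: (rate W0 F) => [r rV|//|_].
  - by exists r; [rewrite -lte_fin | exact: lexx].
  - by exists (V - 1); [rewrite ltrBlDr ltrDl | exact: leNye].
pose k := (V - c) / 2; have k0 : 0 < k by rewrite divr_gt0// subr_gt0.
have [e e0 He] := H k k0; have [d d0 Hd] := opnorm_cont e0.
pose eta := Num.min (d / 2) (k / 2).
have eta0 : 0 < eta by rewrite lt_min; apply/andP; split; exact: divr_gt0.
have [h [bh hF hc]] := rate_approx gsF Fc eta0; have [gh _] := bh.
have hd : cut_dist (grepr F) h < d.
  apply: (le_lt_trans hF); rewrite /eta gt_min; apply/orP; left.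
  by lra.
have := Hd _ _ gF gh hd; move: tF; rewrite /opnormc => t1 t2.
have th : t - e <= opnorm h by rewrite lerBlDr (le_trans t1).
have := He h bh th.
have ek : eta <= k / 2 by rewrite /eta ge_min lexx orbT.
have kE : V - k = c + k by rewrite /k; lra.
rewrite kE; apply/negP; rewrite -ltNge; apply: (le_lt_trans hc).
rewrite ltrD2l; apply: (le_lt_trans ek).
by move: k0; move: (k) => k'; lra.
Qed.

End gamma.
End BipartiteOperator.

(** * The symmetric regime *)

Section SymmetricRegime.
Context {R : realType}.
Local Open Scope classical_set_scope.
Local Open Scope ring_scope.

Local Notation mu := (@lebesgue_measure R).
Local Notation mu2 := (mu \x mu)%E.
Local Notation RR := (measurableTypeR R).
Implicit Types (u v : R -> R) (f g h : R * R -> R).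

Lemma sqr_deficit_le (a b e : R) : 0 <= a <= 1 -> 0 <= b -> 0 <= e ->
  a - e <= b -> a ^+ 2 - b ^+ 2 <= 2 * e.
Proof. by move=> /andP[a0 a1] b0 e0 ab; have [?|?] := leP a b; nra. Qed.

Lemma le_of_sqr (a b : R) : 0 <= a -> 0 <= b -> a ^+ 2 <= b ^+ 2 -> a <= b.
Proof. by move=> a0 b0; rewrite ler_sqr ?nnegrE. Qed.

Variables gamma p r : R.
Hypotheses (g01 : 0 < gamma < 1) (p01 : 0 < p < 1) (pr1 : p <= r <= 1).

Local Notation EAB := (EAB gamma).
Local Notation bipartite := (bipartite gamma).
Local Notation entropy h := (EAB (fun x y => ent p (h (x, y)))).
Let W0 := bip_graphon gamma p.
Let t := opnorm (bip_graphon gamma r).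
Let G := gamma * (1 - gamma).

Let G01 : 0 < G <= 1.
Proof.
have /andP[g0 g1] := g01; rewrite /G mulr_gt0 ?subr_gt0//=.
have H : 0 < gamma * gamma by rewrite mulr_gt0.
by rewrite mulrBr mulr1; lra.
Qed.

Let r01 : 0 <= r <= 1.
Proof. by move: p01 pr1 => /andP[? ?] /andP[? ?]; lra. Qed.

Let bfr := bip_graphon_bipartite gamma r01.

Let t2 : t ^+ 2 = r ^+ 2 * G.
Proof. exact: opnorm_bip_graphon. Qed.

Let t01 : 0 <= t <= 1.
Proof.
have t0 : 0 <= t by apply: opnorm_ge0; case: bfr.
rewrite t0/= -(@ler_sqr _ t 1) ?nnegrE// t2 expr1n.
have /andP[r20 r21] := sqr01 r01; have /andP[G0 G1] := G01.
by apply: mulr_ile1 => //; exact: ltW.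
Qed.

(** The Hilbert-Schmidt norm of the block dominates the operator norm, which is at least
    [t - e]. *)
Lemma EAB_sqr_deficit h e : bipartite h -> 0 <= e -> t - e <= opnorm h ->
  r ^+ 2 * G - EAB (fun x y => h (x, y) ^+ 2) <= 2 * e.
Proof.
move=> bh e0 th; have [gh _] := bh.
have H := bip_opnorm_HS bh.
apply: (@le_trans _ _ (t ^+ 2 - opnorm h ^+ 2)); first by rewrite t2 lerB.
by apply: sqr_deficit_le => //; exact: opnorm_ge0.
Qed.

Section chord.
Hypothesis ch : chord_condition p r.

(** Integrate the supporting line over A x B: the quadratic term is controlled by the bound on the
    Hilbert-Schmidt norm. *)
Lemma entropy_lower k : 0 < k -> exists2 e, 0 < e & forall h, bipartite h ->
  t - e <= opnorm h -> G * ent p r - k <= entropy h.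
Proof.
move=> k0; have /andP[G0 G1] := G01.
have k20 : 0 < k / 2 by rewrite divr_gt0.
have [D D0 HD] := ent_minorant_lower p01 pr1 ch k20.
exists (k / (4 * (D + 1))); first by rewrite divr_gt0// mulr_gt0// ltr_wpDl.
move=> h bh th; have [gh _] := bh; have [_ _ h01] := gh.
have bh2 := graphon_bm2 gh; have be := bm2_ent p01 gh.
set e := k / _ in th; have e0 : 0 <= e.
  by rewrite divr_ge0 ?ltW// mulr_gt0// ltr_wpDl.
have De : D * (2 * e) <= k / 2.
  rewrite /e (_ : D * _ = (k / 2) * (D / (D + 1))); last by field; rewrite gt_eqF// ltr_wpDl.
  by rewrite ler_piMr ?(ltW k20)// ler_pdivrMr ?ltr_wpDl// mul1r lerDl.
have H := EAB_sqr_deficit bh e0 th.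
have : EAB (fun _ _ => ent p r) <= EAB (fun x y =>
    (k / 2 + D * r ^+ 2) + 1 * ent p (h (x, y)) + - D * h (x, y) ^+ 2).
  apply: EAB_le; [by bmt..|] => x y Ix Iy; have := HD (h (x, y)) (h01 _ _ Ix Iy).
  by move: (ent p r) (ent p _) => a b; lra.
have bhh : bm2 (fun x y => h (x, y) ^+ 2) by bmt.
rewrite (EAB_affine g01 _ _ _ be bhh) EAB_cst// -/G mul1r => K.
have H1 : D * (r ^+ 2 * G - EAB (fun x y => h (x, y) ^+ 2)) <= D * (2 * e).
  by rewrite ler_wpM2l.
have H2 : k / 2 * G <= k / 2 by rewrite ler_piMr// ltW.
move: (EAB (fun x y => ent p _)) (EAB (fun x y => h (x, y) ^+ 2)) K H1 H2 De => E S K H1 H2 De.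
by move: (D * (2 * e)) H1 De => De' H1 De; lra.
Qed.

(** Integrate [ent_stability] over A x B: the result is an L^1 bound, hence one in cut distance. *)
Lemma entropy_close d : 0 < d -> exists e eta, [/\ 0 < e, 0 < eta &
  forall h, bipartite h -> t - e <= opnorm h -> entropy h <= G * ent p r + eta ->
  cut_dist_labelled h (bip_graphon gamma r) <= d].
Proof.
move=> d0; have /andP[G0 G1] := G01.
have d60 : 0 < d / 6 by rewrite divr_gt0.
have [C [D [C0 D0 H]]] := ent_stability p01 pr1 ch d60.
have C1 : 0 < C + 1 by rewrite ltr_wpDl.
have D1 : 0 < D + 1 by rewrite ltr_wpDl.
(* each of the three error terms becomes at most [d / 6] before doubling by symmetry *)
exists (d / (12 * (D + 1))), (d / (6 * (C + 1))).
split; [by rewrite divr_gt0// mulr_gt0|by rewrite divr_gt0// mulr_gt0|].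
set e := d / _; set eta := d / _ => h bh th Eh.
have e0 : 0 <= e by rewrite divr_ge0 ?ltW// mulr_gt0.
have De : D * (2 * e) <= d / 6.
  rewrite /e (_ : D * _ = (d / 6) * (D / (D + 1))); last by field; rewrite gt_eqF.
  by rewrite ler_piMr ?(ltW d60)// ler_pdivrMr// mul1r lerDl.
have Ce : C * eta <= d / 6.
  rewrite /eta (_ : C * _ = (d / 6) * (C / (C + 1))); last by field; rewrite gt_eqF.
  by rewrite ler_piMr ?(ltW d60)// ler_pdivrMr// mul1r lerDl.
have [gh h0] := bh; have [_ hs h01] := gh; have [gr r0] := bfr; have [_ rs rr01] := gr.
have bh2 := graphon_bm2 gh; have br2 := graphon_bm2 gr; have be := bm2_ent p01 gh.
apply: (le_trans (cut_dist_labelled_L1 gh gr)).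
pose q (z : R * R) := `|h z - bip_graphon gamma r z|.
have bq2 : bm2 (fun x y => q (x, y)) by rewrite /q; bmt.
have bq : bipartite q.
  split; last by move=> x y Ix Iy exy; rewrite /q h0// r0// subrr normr0.
  split.
  - by have [+ _] := bq2; apply: eq_measurable_fun => -[].
  - by move=> x y Ix Iy; rewrite /q hs// rs.
  - by move=> x y Ix Iy; rewrite normr_ge0/=; exact: graphon_sub_le1.
rewrite (E2_bipartite (k := id) bq)//.
have : EAB (fun x y => q (x, y)) <= EAB (fun x y =>
    (d / 6 - C * ent p r + D * r ^+ 2) + C * ent p (h (x, y)) + - D * h (x, y) ^+ 2).
  rewrite (@eq_EAB _ _ _ (fun x y => `|h (x, y) - r|)); last first.
    by move=> x y Ix Iy xg yg; rewrite /q /bip_graphon/= xg [y <= gamma]leNgt yg.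
  apply: EAB_le; [by bmt..|] => x y Ix Iy.
  have := H (h (x, y)) (h01 _ _ Ix Iy).
  by move: (ent p r) (ent p _) `|_| => a b c; lra.
have bhh : bm2 (fun x y => h (x, y) ^+ 2) by bmt.
rewrite (EAB_affine g01 _ _ _ be bhh) -/G => K.
have S := EAB_sqr_deficit bh e0 th.
have S1 : D * (r ^+ 2 * G - EAB (fun x y => h (x, y) ^+ 2)) <= D * (2 * e).
  by rewrite ler_wpM2l.
have S2 : C * (entropy h - G * ent p r) <= C * eta by rewrite ler_wpM2l// lerBlDl.
have S3 : d / 6 * G <= d / 6 by rewrite ler_piMr// ltW.
move: K S1 S2 S3 De Ce.
move: (EAB (fun x y => ent p _)) (EAB (fun x y => h (x, y) ^+ 2)) (EAB _) (ent p r).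
move: (D * (2 * e)) (C * eta) => De' Ce' E S0 Q pr0.
by lra.
Qed.

End chord.

Lemma opnormc_gclass h : graphon h -> opnormc (gclass h) = opnorm h.
Proof.
move=> gh; have [gr r0] := grepr_gclass gh.
by rewrite /opnormc; apply/esym/opnorm_cut0.
Qed.

Lemma cut_distc_gclass h : graphon h -> cut_distc (gclass h) h = 0.
Proof. by move=> gh; have [gr r0] := grepr_gclass gh; rewrite /cut_distc cut_dist_sym. Qed.

Lemma entropy_bip_graphon : entropy (bip_graphon gamma r) = G * ent p r.
Proof.
rewrite (@eq_EAB _ _ _ (fun _ _ => ent p r)); first by rewrite EAB_cst// mulrC.
by move=> x y _ _ xg yg; rewrite /bip_graphon/= xg [y <= gamma]leNgt yg.
Qed.

(** Graphons almost realizing the rate of a minimizer [F] are close to [F] and, being almost optimal,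
    to [bip_graphon gamma r]. *)
Lemma minimizer_unique F : chord_condition p r -> is_minimizer W0 opnormc t F ->
  F = gclass (bip_graphon gamma r).
Proof.
move=> ch [gsF tF minF]; have [gF ->] := gspaceP gsF; have [gr _] := bfr.
apply: gclass_eq => //.
apply/le_anti/andP; split; last exact: cut_dist_ge0.
have rF : (rate W0 F <= (G * ent p r)%:E)%E.
  apply: le_trans (minF _ _ _) _.
  - by exists (bip_graphon gamma r).
  - rewrite (opnormc_gclass gr); exact: lexx.
  - by apply: (le_trans (rate_le p01 bfr)); rewrite entropy_bip_graphon lexx.
apply/ler_addgt0Pr => d d0; rewrite add0r.
have d20 : 0 < d / 2 by rewrite divr_gt0.
have [e [eta [e0 eta0 H]]] := entropy_close ch d20.
have [c c0 Hc] := opnorm_cont e0.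
pose eta' := Num.min (Num.min (c / 2) (d / 2)) eta.
have eta'0 : 0 < eta' by rewrite !lt_min d20 eta0 divr_gt0.
have [h [bh Fh Eh]] := rate_approx p01 gsF rF eta'0; have [gh _] := bh.
have Fc : cut_dist (grepr F) h < c.
  by apply: (le_lt_trans Fh); rewrite /eta' !gt_min ltr_pdivrMr// ltr_pMr// ltr1n.
have th : t - e <= opnorm h.
  by rewrite lerBlDr; apply: (le_trans tF); exact: Hc.
have Eh' : entropy h <= G * ent p r + eta.
  by apply: (le_trans Eh); rewrite lerD2l /eta' ge_min lexx orbT.
have := H h bh th Eh' => hr.
apply: (le_trans (cut_dist_trans gF gh gr)).
rewrite (splitr d); apply: lerD; last by apply: le_trans hr; exact: cut_dist_le_labelled.
by apply: (le_trans Fh); rewrite /eta' !ge_min lexx orbT.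
Qed.

Lemma minimizer_bip_graphon : chord_condition p r ->
  is_minimizer W0 opnormc t (gclass (bip_graphon gamma r)).
Proof.
move=> ch; have [gr _] := bfr; split.
- by exists (bip_graphon gamma r).
- rewrite (opnormc_gclass gr); exact: lexx.
- move=> F gsF tF; apply: (@le_trans _ _ (G * ent p r)%:E); last first.
    by apply: (rate_ge p01 gsF tF) => k k0; exact: entropy_lower.
  by apply: (le_trans (rate_le p01 bfr)); rewrite entropy_bip_graphon lexx.
Qed.

Lemma block_class_bip_graphon : block_class gamma (gclass (bip_graphon gamma r)).
Proof.
have [gr _] := bfr; split; first by exists (bip_graphon gamma r).
exists (bip_graphon gamma r); last exact: cut_distc_gclass.
split=> //; exists 0, 0, r => x y _ _; rewrite /bip_graphon/= !ltNge.
by case: (x <= gamma); case: (y <= gamma).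
Qed.

(** A graphon in this class has no mass on the diagonal blocks and is at most 1 on the
    others, so that its block has Hilbert-Schmidt norm at most that of the constant 1. *)
Lemma graphon_Omega_opnorm g : graphon_Omega W0 g ->
  opnorm g <= opnorm (bip_graphon gamma 1).
Proof.
move=> [gg aeg]; have [_ _ gg01] := gg.
have b1 : bipartite (bip_graphon gamma 1).
  by apply: bip_graphon_bipartite; rewrite ler01 lexx.
have bb := bip_part_bipartite gamma gg; have [gb _] := bb.
have bd := bm2_ondiag gamma; have bg := graphon_bm2 gg.
have d0 : E2 (fun x y => ondiag gamma x y * g (x, y)) = 0.
  have bdg : bm2 (fun x y => ondiag gamma x y * g (x, y)) by bmt.
  apply: EFin_inj; rewrite -(Fubini12 bdg).
  rewrite (ae_eq_integral (cst 0%E)).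
  - by rewrite integral0.
  - exact: measurable_Q.
  - by apply/measurable_EFinP; case: bdg.
  - exact: measurable_cst.
  apply: filterS aeg; first exact: (ae_filter_ringOfSetsType mu2).
  move=> -[x y] H [Ix Iy] /=; congr EFin.
  rewrite /ondiag offdiagE; have [e|] := eqVneq (x <= gamma) (y <= gamma); last by rewrite subrr mul0r.
  rewrite subr0 mul1r H /W0 /bip_graphon/= ?e ?eqxx//.
  by split=> //= -[_ /=]; rewrite e eqxx ltxx.
have cb := cut_dist_bip_part gg d0.
have -> : opnorm g = opnorm (bip_part gamma g).
  apply: opnorm_cut0 => //; apply/le_anti/andP; split; last exact: cut_dist_ge0.
  by rewrite -cb; exact: cut_dist_le_labelled.
have [gb1 _] := b1.
apply: (le_of_sqr (opnorm_ge0 gb) (opnorm_ge0 gb1)).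
have one01 : 0 <= (1 : R) <= 1 by rewrite ler01 lexx.
rewrite (opnorm_bip_graphon g01 one01) expr1n.
apply: (le_trans (bip_opnorm_HS bb)); rewrite -(EAB_cst g01).
have bp := graphon_bm2 gb; apply: EAB_le; [by bmt..|] => x y Ix Iy.
have [_ _ b01] := gb; exact: (andP (sqr01 (b01 _ _ Ix Iy))).2.
Qed.

Lemma le_max_Omega_bip_graphon : le_max_Omega W0 opnormc t.
Proof.
have b1 : bipartite (bip_graphon gamma 1).
  by apply: bip_graphon_bipartite; rewrite ler01 lexx.
have [g1 _] := b1; have [gr _] := bfr.
exists (gclass (bip_graphon gamma 1)); rewrite opnormc_gclass//; split.
- exact: gspace_Omega_gclass.
- move=> F [gsF [g gOg F0]]; have [gF _] := gspaceP gsF; have [gg _] := gOg.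
  by rewrite /opnormc (opnorm_cut0 gF gg F0); exact: graphon_Omega_opnorm.
- apply: graphon_Omega_opnorm; exact: graphon_Omega_bipartite.
Qed.

End SymmetricRegime.

(** * Reduction to two by two kernels *)

Section TwoByTwo.
Context {R : realType}.
Local Open Scope classical_set_scope.
Local Open Scope ring_scope.

Local Notation RR := (measurableTypeR R).
Local Notation I := (@I01 R : set RR).
Implicit Types (u v : R -> R) (f g h : R * R -> R).

(** The moments [(E X, E Y)] of a finite measure lie in the cone generated by the points [(X x, Y x)];
    the sign condition [E X > 0 > E Y] is therefore met, weakly, by a
    combination of two points.  If it were not, the slopes [Y / X] over the points with
    [Y <= 0] (where [X < 0]) would all be below those over the points with [X > 0], and
    a separating slope [s] would give [s X <= Y] everywhere, contradicting the signs. *)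
Lemma two_point (P : R -> bool) (X Y : R -> R) :
  bm1 (fun x => (P x)%:R : R) -> bm1 X -> bm1 Y ->
  0 < E1 (fun x => (P x)%:R * X x) -> E1 (fun x => (P x)%:R * Y x) < 0 ->
  exists x1 x2 th, [/\ I x1 /\ P x1, I x2 /\ P x2, 0 <= th <= 1,
    0 <= th * X x1 + (1 - th) * X x2 & th * Y x1 + (1 - th) * Y x2 <= 0].
Proof.
move=> bP bX bY EX EY; apply: contrapT => N.
have N1 x : I x -> P x -> Y x <= 0 -> X x < 0.
  move=> Ix Px Yx; rewrite ltNge; apply/negP => Xx; apply: N.
  by exists x, x, 1; split=> //; rewrite ?ler01 ?lexx// subrr mul0r addr0 mul1r.
have N2 x y : I x -> P x -> Y x <= 0 -> I y -> P y -> 0 < X y -> Y x / X x < Y y / X y.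
  move=> Ix Px Yx Iy Py Xy; have Xx := N1 x Ix Px Yx.
  rewrite ltNge; apply/negP => H; apply: N.
  have D0 : 0 < X y - X x by lra.
  exists x, y, (X y / (X y - X x)); split=> //.
  - by rewrite divr_ge0 ?(ltW D0) ?(ltW Xy)//= ler_pdivrMr// mul1r; lra.
  - by rewrite le_eqVlt; apply/orP; left; apply/eqP; field; rewrite gt_eqF.
  rewrite (_ : _ + _ = (X y * Y x - X x * Y y) / (X y - X x)); last first.
    by field; rewrite gt_eqF.
  rewrite ler_pdivrMr// mul0r.
  have /(ler_wpM2r (ltW Xy)) : Y y / X y <= Y x / X x by [].
  rewrite divfK ?gt_eqF// => H2.
  have := H2; rewrite mulrAC -(ler_nM2r Xx) divfK ?lt_eqF//; lra.
have [n [In Pn Xn]] : exists n, [/\ I n, P n & 0 < X n].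
  apply: contrapT => Hn; have : E1 (fun x => (P x)%:R * X x) <= 0.
    rewrite -[leRHS](E1_cst (0 : R)); apply: E1_le => [||x Ix]; [by bmt|by bmt|].
    case: (boolP (P x)) => Px; rewrite ?mul0r// mul1r leNgt; apply/negP => Xx.
    by apply: Hn; exists x.
  by rewrite leNgt EX.
have [q [Iq Pq Yq]] : exists q, [/\ I q, P q & Y q <= 0].
  apply: contrapT => Hn; have : 0 <= E1 (fun x => (P x)%:R * Y x).
    apply: E1_ge0 => x Ix.
    case: (boolP (P x)) => Px; rewrite ?mul0r// mul1r leNgt; apply/negP => Yx.
    by apply: Hn; exists x; split=> //; rewrite ltW.
  by rewrite leNgt EY.
pose S : set R := [set a | exists x, [/\ I x, P x, Y x <= 0 & a = Y x / X x]].
have ubS y : I y -> P y -> 0 < X y -> ubound S (Y y / X y).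
  by move=> Iy Py Xy _ [x [Ix Px Yx ->]]; rewrite ltW// N2.
have Sq : S (Y q / X q) by exists q.
have hS : has_ubound S by exists (Y n / X n); exact: ubS.
pose s := sup S.
have s0 : 0 <= s.
  apply: le_trans (ub_le_sup hS Sq).
  by rewrite mulr_le0// invr_le0 ltW// N1.
have K x : I x -> P x -> s * X x <= Y x.
  move=> Ix Px; have [Yx|Yx] := leP (Y x) 0.
    have Xx := N1 x Ix Px Yx.
    have : Y x / X x <= s by apply: ub_le_sup => //; exists x.
    by rewrite -(ler_nM2r Xx) divfK ?lt_eqF.
  have [Xx|Xx] := leP (X x) 0.
    by apply: le_trans (ltW Yx); rewrite mulr_ge0_le0.
  rewrite -ler_pdivlMr//; apply: ge_sup; [by exists (Y q / X q) | exact: ubS].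
have : 0 <= E1 (fun x => (P x)%:R * Y x - s * ((P x)%:R * X x)).
  apply: E1_ge0 => x Ix; case: (boolP (P x)) => Px; rewrite ?mul0r ?mulr0 ?subr0// !mul1r.
  by rewrite subr_ge0 K.
rewrite E1B; [|by bmt..]; rewrite E1Z; last by bmt.
have : 0 <= s * E1 (fun x => (P x)%:R * X x) by rewrite mulr_ge0// ltW.
by move: (s * _) EY; move: (E1 _) => a b; lra.
Qed.

Lemma unit_circle_coord (a b : R) : a ^+ 2 + b ^+ 2 = 1 -> -1 <= a <= 1.
Proof.
move=> ab; rewrite -ler_norml -(@ler_sqr _ _ 1) ?nnegrE// expr1n real_normK ?num_real//.
by have := sqr_ge0 b; lra.
Qed.

(** A two by two kernel on a product of two probability spaces with two points each: values
    [k11], [k12], [k21], [k22], masses [wrow] and [1 - wrow] of the rows, [wcol] and [1 - wcol] of the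
    columns, and a test vector [(m1, m2)] on the rows, normalized so that its squared norm
    is [m1 ^ 2 + m2 ^ 2].  Nested pairs carry the product topology. *)
Definition params : Type := ((R * R) * (R * R)) * ((R * R) * (R * R)).
Definition mkparams (k11 k12 k21 k22 th ps m1 m2 : R) : params :=
  (((k11, k12), (k21, k22)), ((th, ps), (m1, m2))).
Definition k11 (z : params) := z.1.1.1.
Definition k12 (z : params) := z.1.1.2.
Definition k21 (z : params) := z.1.2.1.
Definition k22 (z : params) := z.1.2.2.
Definition wrow (z : params) := z.2.1.1.
Definition wcol (z : params) := z.2.1.2.
Definition m1 (z : params) := z.2.2.1.
Definition m2 (z : params) := z.2.2.2.

(** The squared norm of the image of the test vector; at unit test vectors it bounds the
    squared operator norm from below. *)
Definition gain z : R :=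
  wcol z * (Num.sqrt (wrow z) * m1 z * k11 z + Num.sqrt (1 - wrow z) * m2 z * k21 z) ^+ 2 +
  (1 - wcol z) * (Num.sqrt (wrow z) * m1 z * k12 z + Num.sqrt (1 - wrow z) * m2 z * k22 z) ^+ 2.

(** The entropy of the kernel. *)
Definition cost p z : R :=
  wcol z * (wrow z * ent p (k11 z) + (1 - wrow z) * ent p (k21 z)) +
  (1 - wcol z) * (wrow z * ent p (k12 z) + (1 - wrow z) * ent p (k22 z)).

Definition msq z : R := m1 z ^+ 2 + m2 z ^+ 2.

Definition box z : Prop :=
  [/\ 0 <= k11 z <= 1, 0 <= k12 z <= 1, 0 <= k21 z <= 1 & 0 <= k22 z <= 1] /\
  [/\ 0 <= wrow z <= 1, 0 <= wcol z <= 1, -1 <= m1 z <= 1 & -1 <= m2 z <= 1].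

Section gamma.
Variables gamma p : R.
Hypotheses (g01 : 0 < gamma < 1) (p01 : 0 < p < 1).
Local Notation iA := (iA gamma).
Local Notation iB := (iB gamma).
Local Notation EAB := (EAB gamma).
Local Notation bipartite := (bipartite gamma).
Local Notation entropy h := (EAB (fun x y => ent p (h (x, y)))).
Let G := gamma * (1 - gamma).

(** Choose [v] on B almost attaining the norm and let [w] be its image on A.  [two_point]
    on A finds two rows for which the mean of [w ^ 2] is still large and the mean entropy
    of the rows still small.  Pairing [w] on these two rows with [h] gives a function
    [zz] on B, whose square has large mean by Cauchy-Schwarz against [v]; [two_point] on B
    then finds two columns. *)
Lemma two_by_two_reduction h s e : bipartite h -> 0 < s -> s < opnorm h -> 0 < e ->
  exists z, [/\ box z, msq z <= 1, (s ^+ 2 - e) / G <= gain z &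
    cost p z <= (entropy h + 2 * e) / G].
Proof.
move=> bh s0 sh e0; have [gh _] := bh; have [_ _ h01] := gh.
have /andP[g0 g1] := g01; have g1' : 0 < 1 - gamma by rewrite subr_gt0.
have G0 : 0 < G by rewrite mulr_gt0.
have bA : bm1 iA := bm1_iA gamma; have bB : bm1 iB := bm1_iB gamma.
have [v [bv Hv]] : exists v, bm1 v /\ s ^+ 2 * E1 (fun x => iB x * v x ^+ 2) <
    E1 (fun x => iA x * kernel_op h (fun y => iB y * v y) x ^+ 2).
  apply: contrapT => N; have : opnorm h <= s.
    apply: (bip_opnorm_le bh (ltW s0)) => v bv; rewrite leNgt; apply/negP => H.
    by apply: N; exists v.
  by rewrite leNgt sh.
have bBv : bm1 (fun x => iB x * v x) by bmt.
have bw := bm1_kernel_op gh bBv.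
set w := kernel_op h _ in Hv bw; set be := E1 (fun x => iB x * v x ^+ 2) in Hv.
set al := E1 _ in Hv.
have be0 : 0 <= be by rewrite /be -nsq_iB; exact: nsq_ge0.
have s20 : 0 < s ^+ 2 by rewrite exprn_gt0.
have sbe0 : 0 <= s ^+ 2 * be by rewrite mulr_ge0// ltW.
have bent := bm2_ent p01 gh.
have bBent : bm2 (fun x y => iB y * ent p (h (x, y))) by bmt.
pose ee x := E1 (fun y => iB y * ent p (h (x, y))).
have bee : bm1 ee by exact: (bm2_marginal bBent).
have Eee : E1 (fun x => iA x * ee x) = entropy h.
  rewrite /EAB E2E; apply: eq_E1 => x Ix; rewrite /ee -E1Z//.
  exact: (bm2_row bBent).
set Eh := entropy h in Eee *.
have [x1 [x2 [t [[Ix1 Px1] [Ix2 Px2] t01 HX HY]]]] : exists x1 x2 t,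
    [/\ I x1 /\ x1 <= gamma, I x2 /\ x2 <= gamma, 0 <= t <= 1,
    0 <= t * (w x1 ^+ 2 - (al + s ^+ 2 * be) / 2 / gamma) +
      (1 - t) * (w x2 ^+ 2 - (al + s ^+ 2 * be) / 2 / gamma) &
    t * (ee x1 - (Eh + e) / gamma) + (1 - t) * (ee x2 - (Eh + e) / gamma) <= 0].
  (* the threshold for [w ^ 2] is halfway between the guaranteed and the actual value of [E w ^ 2] *)
  apply: (@two_point (fun x => x <= gamma) (fun x => w x ^+ 2 - (al + s ^+ 2 * be) / 2 / gamma)
    (fun x => ee x - (Eh + e) / gamma)) => //; [by bmt|by bmt| |].
  - rewrite -/(iA) (@eq_E1 _ _ (fun x => iA x * w x ^+ 2 - iA x * ((al + s ^+ 2 * be) / 2 / gamma))).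
      rewrite E1B; [|by bmt..]; rewrite E1Zr// E1_iA// -/al [X in _ - X]mulrC divfK ?gt_eqF//.
      by move: (s ^+ 2 * be) Hv => q Hv; lra.
    by move=> x _; rewrite -mulrBr.
  - rewrite (@eq_E1 _ _ (fun x => iA x * ee x - iA x * ((Eh + e) / gamma))).
      rewrite E1B; [|by bmt..]; rewrite E1Zr// E1_iA// Eee [X in _ - X]mulrC divfK ?gt_eqF//.
      by lra.
    by move=> x _; rewrite -mulrBr.
have /andP[t0 t1] := t01.
have b1 := graphon_row gh Ix1; have b2 := graphon_row gh Ix2.
have be1 := bm2_row bent Ix1; have be2 := bm2_row bent Ix2.
pose n := t * w x1 ^+ 2 + (1 - t) * w x2 ^+ 2.
have n1 : (al + s ^+ 2 * be) / 2 / gamma <= n.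
  by move: HX; rewrite /n; move: (_ / gamma) => q; lra.
have n0 : 0 < n.
  by apply: lt_le_trans n1; rewrite !divr_gt0//; lra.
have n2 : s ^+ 2 * be / gamma <= n.
  by apply: le_trans n1; rewrite ler_pM2r ?invr_gt0//; lra.
pose zz y := t * w x1 * h (x1, y) + (1 - t) * w x2 * h (x2, y).
have bzz : bm1 zz by rewrite /zz; bmt.
have Ezv : E1 (fun y => (iB y * zz y) * (iB y * v y)) = n.
  rewrite (@eq_E1 _ _ (fun y => t * w x1 * (h (x1, y) * (iB y * v y)) +
      (1 - t) * w x2 * (h (x2, y) * (iB y * v y)))).
    rewrite E1D; [|by bmt..]; rewrite !E1Z; [|by bmt..].
    by rewrite -!kernel_opE -/w /n !expr2 !mulrA.
  move=> y _; rewrite /zz mulrACA iB_sqr.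
  by move: (h _) (h _) (iB y) (v y) (w x1) (w x2) => a b c d q q'; ring.
have bBz : bm1 (fun y => iB y * zz y) by bmt.
have CS : n ^+ 2 <= E1 (fun y => iB y * zz y ^+ 2) * be.
  have := CauchySchwarz bBz bBv; rewrite Ezv -/(nsq _) -/(nsq _) !nsq_iB; exact.
set Ez := E1 (fun y => iB y * zz y ^+ 2) in CS.
have bep : 0 < be.
  rewrite lt_neqAle be0 andbT; apply/eqP => E; move: CS; rewrite -E mulr0.
  by rewrite leNgt exprn_gt0.
have Ezn : n * s ^+ 2 / gamma <= Ez.
  rewrite -(ler_pM2r bep); apply: le_trans CS; rewrite expr2 -!mulrA ler_pM2l//.
  by apply: le_trans n2; apply: le_of_eq; ring.
have Hee : t * ee x1 + (1 - t) * ee x2 <= (Eh + e) / gamma.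
  by move: HY; move: (_ / gamma) => q; lra.
have [y1 [y2 [q [[Iy1 Py1] [Iy2 Py2] q01 HX2 HY2]]]] : exists y1 y2 q,
    [/\ I y1 /\ gamma < y1, I y2 /\ gamma < y2, 0 <= q <= 1,
    0 <= q * (zz y1 ^+ 2 - n * ((s ^+ 2 - e) / G)) + (1 - q) * (zz y2 ^+ 2 - n * ((s ^+ 2 - e) / G)) &
    q * ((t * ent p (h (x1, y1)) + (1 - t) * ent p (h (x2, y1))) - (Eh + 2 * e) / G) +
    (1 - q) * ((t * ent p (h (x1, y2)) + (1 - t) * ent p (h (x2, y2))) - (Eh + 2 * e) / G) <= 0].
  apply: (@two_point (fun y => gamma < y) (fun y => zz y ^+ 2 - n * ((s ^+ 2 - e) / G))
    (fun y => (t * ent p (h (x1, y)) + (1 - t) * ent p (h (x2, y))) - (Eh + 2 * e) / G)) => //;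
    [by bmt|by bmt| |].
  - rewrite (@eq_E1 _ _ (fun y => iB y * zz y ^+ 2 - iB y * (n * ((s ^+ 2 - e) / G)))).
      rewrite E1B; [|by bmt..]; rewrite E1Zr// E1_iB// -/Ez.
      have -> : (1 - gamma) * (n * ((s ^+ 2 - e) / G)) = n * s ^+ 2 / gamma - n * e / gamma.
        by rewrite /G; field; rewrite !gt_eqF.
      have : 0 < n * e / gamma by rewrite !divr_gt0// mulr_gt0.
      by move: (_ / gamma) (_ / gamma) Ezn => a b; lra.
    by move=> x _; rewrite -mulrBr.
  - rewrite (@eq_E1 _ _ (fun y => (t * (iB y * ent p (h (x1, y))) + (1 - t) * (iB y * ent p (h (x2, y)))) -
        iB y * ((Eh + 2 * e) / G))).
      rewrite E1B; [|by bmt..]; rewrite E1D; [|by bmt..]; rewrite !E1Z; [|by bmt..].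
      rewrite E1Zr// E1_iB// -/(ee x1) -/(ee x2).
      have -> : (1 - gamma) * ((Eh + 2 * e) / G) = (Eh + e) / gamma + e / gamma.
        by rewrite /G; field; rewrite !gt_eqF.
      have : 0 < e / gamma by rewrite divr_gt0.
      by move: (_ / gamma) (_ / gamma) Hee => a b; lra.
    by move=> y _; rewrite mulrBr mulrDr !(mulrCA (iB y)).
have /andP[q0 q1] := q01.
pose sn := Num.sqrt n; have sn0 : 0 < sn by rewrite sqrtr_gt0.
have sn2 : sn ^+ 2 = n by rewrite sqr_sqrtr// ltW.
pose st := Num.sqrt t; have st2 : st ^+ 2 = t by rewrite sqr_sqrtr.
pose st' := Num.sqrt (1 - t); have st2' : st' ^+ 2 = 1 - t by rewrite sqr_sqrtr// subr_ge0.
(* the test vector is [w] on the two rows, normalized by its norm [sn] *)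
have ms : (st * w x1 / sn) ^+ 2 + (st' * w x2 / sn) ^+ 2 = 1.
  rewrite !expr_div_n !exprMn st2 st2' sn2 -mulrDl -/n divff// gt_eqF//.
have zE y : st * (st * w x1 / sn) * h (x1, y) + st' * (st' * w x2 / sn) * h (x2, y) = zz y / sn.
  by rewrite /zz -{1}st2 -st2'; field; rewrite gt_eqF.
exists (mkparams (h (x1, y1)) (h (x1, y2)) (h (x2, y1)) (h (x2, y2)) t q
  (st * w x1 / sn) (st' * w x2 / sn)); split.
- by split; split; rewrite /k11 /k12 /k21 /k22 /wrow /wcol /m1 /m2 /= ?h01//;
    [exact: unit_circle_coord ms | apply: (@unit_circle_coord _ (st * w x1 / sn)); rewrite addrC].
- by rewrite /msq /m1 /m2 /= ms.
- rewrite /gain /k11 /k12 /k21 /k22 /wrow /wcol /m1 /m2 /= -/st -/st' !zE !expr_div_n sn2.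
  rewrite -(ler_pM2l n0).
  have -> : n * (q * (zz y1 ^+ 2 / n) + (1 - q) * (zz y2 ^+ 2 / n)) =
      q * zz y1 ^+ 2 + (1 - q) * zz y2 ^+ 2 by field; rewrite gt_eqF.
  by move: HX2; move: (n * _) => a; lra.
- rewrite /cost /k11 /k12 /k21 /k22 /wrow /wcol /=.
  by move: HY2; move: (_ / G) => a; lra.
Qed.

End gamma.
End TwoByTwo.

(** * Graphons with a two by two block *)

Section Realization.
Context {R : realType}.
Local Open Scope classical_set_scope.
Local Open Scope ring_scope.

Local Notation RR := (measurableTypeR R).
Local Notation I := (@I01 R : set RR).
Implicit Types (u v : R -> R) (f g h : R * R -> R).

Lemma sqr_mul_div (s m : R) : s ^+ 2 * (m / s) = s * m.
Proof.
have [->|s0] := eqVneq s 0; first by rewrite expr0n/= !mul0r.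
by field.
Qed.

Lemma sqr_div_le (s m : R) : (m / s) ^+ 2 * s ^+ 2 <= m ^+ 2.
Proof.
have [->|s0] := eqVneq s 0; first by rewrite expr0n/= mulr0 sqr_ge0.
by apply: le_of_eq; field.
Qed.

Variables gamma p : R.
Hypotheses (g01 : 0 < gamma < 1) (p01 : 0 < p < 1).
Local Notation iA := (iA gamma).
Local Notation EAB := (EAB gamma).
Local Notation bipartite := (bipartite gamma).
Local Notation entropy h := (EAB (fun x y => ent p (h (x, y)))).
Let G := gamma * (1 - gamma).

Section blocks.
Variable z : @params R.
Hypotheses (bz : box z) (mz : msq z <= 1).

Let c1 := wrow z * gamma.
Let c3 := gamma + wcol z * (1 - gamma).
Let a1 x : R := ((x <= c1)%R)%:R.
Let a2 x : R := iA x - a1 x.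
Let b1 x : R := ((x <= c3)%R)%:R - iA x.
Let b2 x : R := 1 - ((x <= c3)%R)%:R.

Let c123 : 0 <= c1 /\ c1 <= gamma /\ gamma <= c3 /\ c3 <= 1.
Proof.
have [_ [/andP[t0 t1] /andP[p0 p1] _ _]] := bz; have /andP[g0 g1] := g01.
have H1 : c1 <= 1 * gamma by rewrite ler_wpM2r// ltW.
have H2 : 0 <= c1 by rewrite mulr_ge0// ltW.
have H3 : 0 <= wcol z * (1 - gamma) by rewrite mulr_ge0// subr_ge0 ltW.
have H4 : wcol z * (1 - gamma) <= 1 * (1 - gamma) by rewrite ler_wpM2r// subr_ge0 ltW.
by rewrite /c3; lra.
Qed.

Let ba1 : bm1 a1. Proof. exact: bm1_le_ind. Qed.
Let ba2 : bm1 a2. Proof. by have bA := bm1_iA gamma; rewrite /a2; bmt. Qed.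
Let bc3 : bm1 (fun x => ((x <= c3)%R)%:R : R). Proof. exact: bm1_le_ind. Qed.
Let bb1 : bm1 b1. Proof. by have bA := bm1_iA gamma; rewrite /b1; bmt. Qed.
Let bb2 : bm1 b2. Proof. by rewrite /b2; bmt. Qed.

Let Ea1 : E1 a1 = wrow z * gamma.
Proof. by rewrite E1_le_ind//; have [? [? [? ?]]] := c123; have /andP[? ?] := g01; lra. Qed.

Let Ea2 : E1 a2 = (1 - wrow z) * gamma.
Proof. by have bA := bm1_iA gamma; rewrite E1B// E1_iA// Ea1; ring. Qed.

Let Ec3 : E1 (fun x => ((x <= c3)%R)%:R : R) = c3.
Proof. by rewrite E1_le_ind//; have [? [? [? ?]]] := c123; have /andP[? ?] := g01; lra. Qed.

Let Eb1 : E1 b1 = wcol z * (1 - gamma).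
Proof. by have bA := bm1_iA gamma; rewrite E1B// E1_iA// Ec3 /c3; ring. Qed.

Let Eb2 : E1 b2 = (1 - wcol z) * (1 - gamma).
Proof. by rewrite E1B; [rewrite E1_cst Ec3 /c3; ring | bmt..]. Qed.

Let Eb c c' : E1 (fun y => b1 y * c + b2 y * c') =
  wcol z * (1 - gamma) * c + (1 - wcol z) * (1 - gamma) * c'.
Proof.
rewrite (E1D (bmM bb1 (bm_cst _ c)) (bmM bb2 (bm_cst _ c'))).
by rewrite (E1Zr c bb1) (E1Zr c' bb2) Eb1 Eb2.
Qed.

Let Ea c c' : E1 (fun y => c * a1 y + c' * a2 y) =
  c * (wrow z * gamma) + c' * ((1 - wrow z) * gamma).
Proof.
rewrite (E1D (bmM (bm_cst _ c) ba1) (bmM (bm_cst _ c') ba2)).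
by rewrite (E1Z c ba1) (E1Z c' ba2) Ea1 Ea2.
Qed.

Let pos x : [\/ [/\ a1 x = 1, a2 x = 0, b1 x = 0, b2 x = 0 & x <= gamma],
               [/\ a1 x = 0, a2 x = 1, b1 x = 0, b2 x = 0 & x <= gamma],
               [/\ a1 x = 0, a2 x = 0, b1 x = 1, b2 x = 0 & gamma < x] |
               [/\ a1 x = 0, a2 x = 0, b1 x = 0, b2 x = 1 & gamma < x]].
Proof.
have [_ [c1g [gc3 _]]] := c123; rewrite /a2 /b1 /b2 /a1 !iA_ind.
have [xc1|xc1] := leP x c1.
  have xg := le_trans xc1 c1g; have xc3 := le_trans xg gc3.
  by constructor 1; rewrite xg xc3 !subrr.
have [xg|xg] := leP x gamma.
  by constructor 2; rewrite (le_trans xg gc3) !subrr subr0.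
have [xc3|xc3] := leP x c3.
  by constructor 3; rewrite !subr0 subrr.
by constructor 4; rewrite !subr0.
Qed.

Let kk x y := k11 z * a1 x * b1 y + k12 z * a1 x * b2 y +
              k21 z * a2 x * b1 y + k22 z * a2 x * b2 y.
Let h (w : R * R) : R := kk w.1 w.2 + kk w.2 w.1.

Let hE x y : h (x, y) = kk x y + kk y x. Proof. by []. Qed.

Let bkk : bm2 kk.
Proof. by rewrite /kk; bmt. Qed.

Let bip_h : bipartite h.
Proof.
have [[K1 K2 K3 K4] _] := bz; split; first split.
- have bkk' := bm2_swap bkk; have [+ _] : bm2 (fun x y => kk x y + kk y x) by bmt.
  by apply: eq_measurable_fun => -[].
- by move=> x y _ _; rewrite !hE addrC.
- move=> x y _ _; rewrite hE /kk.
  by have [] := pos x => -[-> -> -> -> _]; have [] := pos y => -[-> -> -> -> _];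
    rewrite ?(mulr0, mulr1, addr0, add0r) ?lexx ?ler01.
- move=> x y _ _; rewrite hE /kk.
  by have [] := pos x => -[-> -> -> -> xg]; have [] := pos y => -[-> -> -> -> yg] e;
    rewrite ?(mulr0, mulr1, addr0, add0r)//; move: e;
    rewrite ?xg ?yg ?[x <= _]leNgt ?[y <= _]leNgt ?xg ?yg.
Qed.

Let entropy_h : entropy h = G * cost p z.
Proof.
have be1 : bm1 (fun y => b1 y * ent p (k11 z) + b2 y * ent p (k12 z)) by bmt.
have be2 : bm1 (fun y => b1 y * ent p (k21 z) + b2 y * ent p (k22 z)) by bmt.
transitivity (E2 (fun x y => a1 x * (b1 y * ent p (k11 z) + b2 y * ent p (k12 z)) +
    a2 x * (b1 y * ent p (k21 z) + b2 y * ent p (k22 z)))).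
  apply: eq_E2 => x y _ _; rewrite hE /kk iA_ind iB_ind.
  by have [] := pos x => -[-> -> -> -> xg]; have [] := pos y => -[-> -> -> -> yg];
    rewrite ?ltNge ?xg ?yg ?[x <= _]leNgt ?[y <= _]leNgt ?xg ?yg /=;
    rewrite ?(mulr0, mulr1, addr0, add0r, mul1r, mul0r).
rewrite (E2D (bmM (bm2_fst ba1) (bm2_snd be1)) (bmM (bm2_fst ba2) (bm2_snd be2))).
rewrite (E2_prod ba1 be1) (E2_prod ba2 be2).
rewrite !Eb Ea1 Ea2 /cost /G.
by move: (ent p _) (ent p _) (ent p _) (ent p _) => A B C D; ring.
Qed.

Let opnorm_h : G * gain z <= opnorm h ^+ 2.
Proof.
have [gh _] := bip_h; have /andP[g0 g1] := g01.
have [_ [/andP[t0 t1] _ _ _]] := bz.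
(* a row of zero mass contributes nothing: then [s1] or [s2] is 0 and so is the quotient *)
pose s1 := Num.sqrt (wrow z) * Num.sqrt gamma.
pose s2 := Num.sqrt (1 - wrow z) * Num.sqrt gamma.
have s12 : s1 ^+ 2 = wrow z * gamma by rewrite exprMn !sqr_sqrtr// ltW.
have s22 : s2 ^+ 2 = (1 - wrow z) * gamma by rewrite exprMn !sqr_sqrtr ?subr_ge0// ltW.
pose al1 := m1 z / s1; pose al2 := m2 z / s2.
pose v x := al1 * a1 x + al2 * a2 x.
have bv : bm1 v by rewrite /v; bmt.
have nv : nsq v <= 1.
  rewrite /nsq (@eq_E1 _ _ (fun x => al1 ^+ 2 * a1 x + al2 ^+ 2 * a2 x)); last first.
    move=> x _; rewrite /v.
    by have [] := pos x => -[-> -> _ _ _]; rewrite ?(mulr0, mulr1, addr0, add0r)// expr0n.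
  rewrite Ea -s12 -s22.
  by apply: le_trans mz; rewrite /msq lerD// sqr_div_le.
pose C1 := k11 z * (s1 * m1 z) + k21 z * (s2 * m2 z).
pose C2 := k12 z * (s1 * m1 z) + k22 z * (s2 * m2 z).
have kv y : I y -> kernel_op h v y = b1 y * C1 + b2 y * C2.
  move=> Iy; rewrite kernel_opE.
  rewrite (@eq_E1 _ _ (fun x => ((b1 y * k11 z + b2 y * k12 z) * al1) * a1 x +
      ((b1 y * k21 z + b2 y * k22 z) * al2) * a2 x)); last first.
    move=> x _; rewrite hE /kk /v.
    by have [] := pos x => -[-> -> -> -> _]; have [] := pos y => -[-> -> -> -> _];
      rewrite ?(mulr0, mulr1, addr0, add0r, mul1r, mul0r).
  rewrite Ea -s12 -s22 /C1 /C2.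
  rewrite -(sqr_mul_div s1) -(sqr_mul_div s2) -/al1 -/al2.
  by move: (s1 ^+ 2) (s2 ^+ 2) => A B; ring.
have nk : nsq (kernel_op h v) = G * gain z.
  rewrite /nsq (@eq_E1 _ _ (fun y => b1 y * C1 ^+ 2 + b2 y * C2 ^+ 2)); last first.
    move=> y Iy; rewrite kv//.
    by have [] := pos y => -[_ _ -> -> _];
      rewrite ?(mulr0, mulr1, addr0, add0r, mul1r, mul0r)// expr0n.
  rewrite Eb /gain /C1 /C2 /s1 /s2 /G.
  have sg : Num.sqrt gamma ^+ 2 = gamma by rewrite sqr_sqrtr// ltW.
  rewrite -[X in _ = X * _ * _]sg.
  by move: (Num.sqrt gamma) (Num.sqrt _) (Num.sqrt _) => A B C; ring.
rewrite -nk; apply: (le_trans (opnorm_ge gh bv)).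
by rewrite ler_piMr// sqr_ge0.
Qed.

(** Cut A and B into two intervals each, in the proportions [wrow] and [wcol]. *)
Lemma params_realize : exists h, [/\ bipartite h, entropy h = G * cost p z &
  G * gain z <= opnorm h ^+ 2].
Proof. by exists h. Qed.

End blocks.
End Realization.

(** * Optimal two by two kernels *)

Section Compactness.
Context {R : realType}.
Local Open Scope classical_set_scope.
Local Open Scope ring_scope.
Local Notation params := (@params R).

Lemma ctsD (T : topologicalType) (f g : T -> R) :
  continuous f -> continuous g -> continuous (fun x => f x + g x).
Proof. by move=> cf cg x; exact: cvgD (cf x) (cg x). Qed.

Lemma ctsB (T : topologicalType) (f g : T -> R) :
  continuous f -> continuous g -> continuous (fun x => f x - g x).
Proof. by move=> cf cg x; exact: cvgB (cf x) (cg x). Qed.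

Lemma ctsM (T : topologicalType) (f g : T -> R) :
  continuous f -> continuous g -> continuous (fun x => f x * g x).
Proof. by move=> cf cg x; exact: cvgM (cf x) (cg x). Qed.

Lemma cts_cst (T : topologicalType) (c : R) : continuous (fun _ : T => c).
Proof. by move=> x; exact: cvg_cst. Qed.

Lemma cts_comp (T : topologicalType) (f : R -> R) (g : T -> R) :
  continuous f -> continuous g -> continuous (fun x => f (g x)).
Proof. by move=> cf cg x; apply: continuous_comp; [exact: cg | exact: cf]. Qed.

Lemma cts_params : [/\ continuous (@k11 R), continuous (@k12 R), continuous (@k21 R) &
    continuous (@k22 R)] /\
  [/\ continuous (@wrow R), continuous (@wcol R), continuous (@m1 R) & continuous (@m2 R)].
Proof.
have c2 (T : topologicalType) (f : T -> R * R) : continuous f ->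
    continuous (fun x => (f x).1) /\ continuous (fun x => (f x).2).
  by move=> cf; split=> x; apply: continuous_comp; [exact: cf|exact: cvg_fst|exact: cf|exact: cvg_snd].
have c4 (T : topologicalType) (f : T -> (R * R) * (R * R)) : continuous f ->
    continuous (fun x => (f x).1) /\ continuous (fun x => (f x).2).
  by move=> cf; split=> x; apply: continuous_comp; [exact: cf|exact: cvg_fst|exact: cf|exact: cvg_snd].
have [f1 f2] : continuous (fun z : params => z.1) /\ continuous (fun z : params => z.2).
  by split=> x; [exact: cvg_fst | exact: cvg_snd].
have [g1 g2] := c4 _ _ f1; have [g3 g4] := c4 _ _ f2.
have [? ?] := c2 _ _ g1; have [? ?] := c2 _ _ g2.
have [? ?] := c2 _ _ g3; have [? ?] := c2 _ _ g4.
by split; split.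
Qed.

Let posp (x : R) : R := (`|x| + x) / 2.

Let posp_ge0 x : 0 <= posp x.
Proof. by rewrite /posp; have := ler_norm (- x); rewrite normrN => ?; apply: divr_ge0 => //; lra. Qed.

Let posp_ge x : x <= posp x.
Proof. by rewrite /posp; have := ler_norm x; lra. Qed.

Let posp_le0 x : x <= 0 -> posp x = 0.
Proof. by move=> x0; rewrite /posp ler0_norm// addNr mul0r. Qed.

Let posp_le x e : 0 <= e -> x <= e -> posp x <= e.
Proof.
move=> e0 xe; rewrite /posp; have [x0|x0] := leP 0 x; first by rewrite ger0_norm//; lra.
by rewrite ltr0_norm//; lra.
Qed.

Let cts_posp : continuous posp.
Proof.
rewrite /posp; apply: ctsM; last exact: cts_cst.
apply: ctsD; last by move=> x; exact: cvg_id.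
exact: norm_continuous.
Qed.

Variable p : R.

Lemma cts_gain : continuous (@gain R).
Proof.
have [[? ? ? ?] [? ? ? ?]] := cts_params.
have s1 : continuous (fun z : params => Num.sqrt (wrow z)).
  by apply: cts_comp => //; exact: sqrt_continuous.
have s2 : continuous (fun z : params => Num.sqrt (1 - wrow z)).
  by apply: cts_comp; [exact: sqrt_continuous | apply: ctsB => //; exact: cts_cst].
rewrite /gain; apply: ctsD; apply: ctsM => //.
- by apply: ctsM; apply: ctsD; do 2 apply: ctsM => //.
- by apply: ctsB => //; exact: cts_cst.
- by apply: ctsM; apply: ctsD; do 2 apply: ctsM => //.
Qed.

Lemma cts_cost : continuous (cost p).
Proof.
have [[? ? ? ?] [? ? ? ?]] := cts_params.
have ce := @continuous_ent R p.
have c1 : continuous (fun z : params => 1 - wrow z) by apply: ctsB => //; exact: cts_cst.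
have c2 : continuous (fun z : params => 1 - wcol z) by apply: ctsB => //; exact: cts_cst.
by rewrite /cost; apply: ctsD; apply: ctsM => //; apply: ctsD; apply: ctsM => //; apply: cts_comp.
Qed.

Lemma cts_msq : continuous (@msq R).
Proof.
have [_ [_ _ ? ?]] := cts_params.
by rewrite /msq; apply: ctsD; apply: ctsM.
Qed.

Lemma compact_box : compact [set z : params | box z].
Proof.
have c01 := @segment_compact R 0 1; have c11 := @segment_compact R (-1) 1.
have := compact_setX (compact_setX (compact_setX c01 c01) (compact_setX c01 c01))
  (compact_setX (compact_setX c01 c01) (compact_setX c11 c11)).
congr compact; apply/seteqP; split=> -[[[a b] [c d]] [[e f] [g h]]]; rewrite /= !in_itv/=.
  by move=> [[[? ?] [? ?]] [[? ?] [? ?]]]; split; split.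
by move=> [[? ? ? ?] [? ? ? ?]].
Qed.

Variable rho : R.

Let pen c z : R := posp (msq z - 1) + posp (rho - gain z) + posp (cost p z - c).

Let pen_min c : (exists z : params, box z) ->
  exists2 z, box z & forall z', box z' -> pen c z <= pen c z'.
Proof.
move=> [z0 bz0].
have cp : continuous (pen c).
  rewrite /pen; apply: ctsD; first apply: ctsD.
  - by apply: cts_comp => //; apply: ctsB; [exact: cts_msq | exact: cts_cst].
  - by apply: cts_comp => //; apply: ctsB; [exact: cts_cst | exact: cts_gain].
  - by apply: cts_comp => //; apply: ctsB; [exact: cts_cost | exact: cts_cst].
have [|z /set_mem bz H] := compact_EVT_min _ compact_box (continuous_subspaceT cp).
  by exists z0.
by exists z => // z' bz'; apply: H; exact: mem_set.
Qed.

Hypothesis p01 : 0 < p < 1.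

Let cost_ge0 z : box z -> 0 <= cost p z.
Proof.
move=> [[K1 K2 K3 K4] [/andP[t0 t1] /andP[p0 p1] _ _]].
have t0' : 0 <= 1 - wrow z by rewrite subr_ge0.
have p0' : 0 <= 1 - wcol z by rewrite subr_ge0.
have c x y : 0 <= x <= 1 -> 0 <= y <= 1 -> 0 <= wrow z * ent p x + (1 - wrow z) * ent p y.
  move=> x01 y01; have ex := ent_ge0 p01 x01; have ey := ent_ge0 p01 y01.
  by apply: addr_ge0; apply: mulr_ge0.
have c1 := c _ _ K1 K3; have c2 := c _ _ K2 K4.
by rewrite /cost; apply: addr_ge0; apply: mulr_ge0.
Qed.

Definition feasible z : Prop := [/\ box z, msq z <= 1 & rho <= gain z].

(** Feasible parameters form a compact set, so the cost has a minimum; and relaxing the gain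
    constraint slightly does not lower the minimum by much, again by compactness.  Both
    statements are obtained by minimizing the penalty [pen], which vanishes exactly at the
    feasible points of cost at most [c]. *)
Lemma minimal_params : (exists z, feasible z) -> exists2 z, feasible z &
  forall k, 0 < k -> exists2 e, 0 < e & forall z', box z' -> msq z' <= 1 ->
    rho - e <= gain z' -> cost p z - k <= cost p z'.
Proof.
move=> [z0 [bz0 mz0 cz0]]; have ne : exists z : params, box z by exists z0.
pose S : set R := [set cost p z | z in feasible].
have lbS : has_lbound S by exists 0 => _ [z [bz _ _] <-]; exact: cost_ge0.
pose V := inf S.
have VS z : feasible z -> V <= cost p z by move=> fz; apply: ge_inf => //; exists z.
have pen0 c z : box z -> pen c z <= 0 -> feasible z /\ cost p z <= c.
  move=> bz; rewrite /pen => H.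
  have := posp_ge0 (msq z - 1); have := posp_ge0 (rho - gain z); have := posp_ge0 (cost p z - c).
  have := posp_ge (msq z - 1); have := posp_ge (rho - gain z); have := posp_ge (cost p z - c).
  move: H; move: (posp _) (posp _) (posp _) => A B C *.
  by split; [split=> //; lra | lra].
have [z bz Hz] := pen_min V ne.
have pz : pen V z <= 0.
  apply/ler_addgt0Pr => e e0; rewrite add0r.
  have [|_ [z1 [bz1 mz1 cz1] <-] z1V] := @inf_adherent R S e e0.
    by split=> //; exists (cost p z0), z0.
  apply: (le_trans (Hz _ bz1)); rewrite /pen.
  have -> : posp (msq z1 - 1) = 0 by apply: posp_le0; lra.
  have -> : posp (rho - gain z1) = 0 by apply: posp_le0; lra.
  rewrite !add0r.
  by apply: posp_le; [exact: ltW | move: z1V; rewrite -/V; move: (cost p z1) => q; lra].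
have [fz oz] := pen0 _ _ bz pz; exists z => // k k0.
have [z1 bz1 Hz1] := pen_min (V - k) ne.
have m0 : 0 < pen (V - k) z1.
  rewrite ltNge; apply/negP => /(pen0 _ _ bz1)[fz1 oz1].
  by have := VS _ fz1; lra.
exists (pen (V - k) z1 / 2); first by rewrite divr_gt0.
move=> z' bz' mz' cz'; have := Hz1 _ bz'; rewrite leNgt => H; rewrite leNgt; apply/negP => ok.
move: H; apply/negP; rewrite negbK {1}/pen.
have -> : posp (msq z' - 1) = 0 by apply: posp_le0; lra.
have -> : posp (cost p z' - (V - k)) = 0.
  apply: posp_le0; have := VS _ fz; move: ok oz; move: (cost p z) (cost p z') => a b; lra.
rewrite add0r addr0; apply: (@le_lt_trans _ _ (pen (V - k) z1 / 2)); last first.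
  by move: m0; move: (pen _ _) => a; lra.
apply: posp_le; first by rewrite divr_ge0// ltW.
by move: cz'; move: (pen _ _) => a; lra.
Qed.

End Compactness.

(** * Symmetry breaking *)

Section Breaking.
Context {R : realType}.
Local Open Scope classical_set_scope.
Local Open Scope ring_scope.

Local Notation RR := (measurableTypeR R).
Local Notation I := (@I01 R : set RR).
Implicit Types (u v : R -> R) (f g h : R * R -> R).

(** The rows carry the values [sqrt x1] and [sqrt x2] with the weights of the chord, and a
    test vector proportional to them, so that the gain is exactly [r ^ 2]; the second
    column has mass 0. *)
Lemma params_of_chord_failure (p r : R) : 0 < r -> ~ chord_condition p r ->
  exists z : @params R, feasible (r ^+ 2) z /\ cost p z < ent p r.
Proof.
move=> r0 nch; apply: contrapT => N; apply: nch => x1 x2 l x101 x201 l01 e.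
rewrite leNgt; apply/negP => H; apply: N; have /andP[l0 l1] := l01.
pose a := Num.sqrt x1; pose b := Num.sqrt x2; pose s := Num.sqrt l; pose s' := Num.sqrt (1 - l).
have a01 : 0 <= a <= 1 by exact: sqrt01.
have b01 : 0 <= b <= 1 by exact: sqrt01.
have a2 : a ^+ 2 = x1 by rewrite sqr_sqrtr//; case/andP: x101.
have b2 : b ^+ 2 = x2 by rewrite sqr_sqrtr//; case/andP: x201.
have s2 : s ^+ 2 = l by rewrite sqr_sqrtr.
have s'2 : s' ^+ 2 = 1 - l by rewrite sqr_sqrtr ?subr_ge0.
have ms : (s * a / r) ^+ 2 + (s' * b / r) ^+ 2 = 1.
  by rewrite !expr_div_n !exprMn a2 b2 s2 s'2 -mulrDl e divff// expf_neq0// gt_eqF.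
have ms' : (s' * b / r) ^+ 2 + (s * a / r) ^+ 2 = 1 by rewrite addrC.
have one01 : 0 <= (1 : R) <= 1 by rewrite ler01 lexx.
exists (mkparams a a b b l 1 (s * a / r) (s' * b / r)).
split; first split.
- by split; split=> //=; [exact: unit_circle_coord ms | exact: unit_circle_coord ms'].
- by rewrite /msq /m1 /m2 /= ms.
- rewrite /gain /k11 /k12 /k21 /k22 /wrow /wcol /m1 /m2 /= -/s -/s'.
  rewrite subrr mul0r addr0 mul1r (_ : _ + _ = r) ?lexx//.
  rewrite (_ : _ + _ = (s ^+ 2 * a ^+ 2 + s' ^+ 2 * b ^+ 2) / r); last by field; rewrite gt_eqF.
  by rewrite a2 b2 s2 s'2 e expr2 mulfK// gt_eqF.
- rewrite /cost /k11 /k12 /k21 /k22 /wrow /wcol /= subrr mul0r addr0 mul1r.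
  exact: H.
Qed.

Variables gamma p r : R.
Hypotheses (g01 : 0 < gamma < 1) (p01 : 0 < p < 1) (pr1 : p <= r < 1).

Local Notation iA := (iA gamma).
Local Notation iB := (iB gamma).
Local Notation EAB := (EAB gamma).
Local Notation bipartite := (bipartite gamma).
Local Notation entropy h := (EAB (fun x y => ent p (h (x, y)))).
Let W0 := bip_graphon gamma p.
Let t := opnorm (bip_graphon gamma r).
Let G := gamma * (1 - gamma).

Let r0 : 0 < r.
Proof. by move: p01 pr1 => /andP[? ?] /andP[? ?]; lra. Qed.

Let r1 : r < 1.
Proof. by case/andP: pr1. Qed.

Let r01 : 0 <= r <= 1.
Proof. by rewrite !ltW. Qed.

Let G0 : 0 < G.
Proof. by have /andP[g0 g1] := g01; rewrite /G mulr_gt0 ?subr_gt0. Qed.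

Let G1 : G <= 1.
Proof. by rewrite /G; have := sqr_ge0 gamma; case/andP: g01 => *; nra. Qed.

Let t2 : t ^+ 2 = r ^+ 2 * G.
Proof. exact: opnorm_bip_graphon. Qed.

Let t0 : 0 < t.
Proof.
have [gr _] := bip_graphon_bipartite gamma r01.
rewrite lt_neqAle (opnorm_ge0 gr) andbT; apply/eqP => e.
by have := t2; rewrite -e expr0n/= => /esym/eqP; rewrite mulf_eq0 expf_eq0/= !gt_eqF.
Qed.

Let t1 : t <= 1.
Proof.
apply: le_of_sqr; [exact: ltW | exact: ler01 |].
have /andP[r20 r21] := sqr01 r01; rewrite t2 expr1n.
by apply: mulr_ile1 => //; exact: ltW.
Qed.

(** The optimal two by two kernel is realized by a graphon; any competitor, by [rate_ge] and
    [two_by_two_reduction], has at least the cost of almost feasible parameters. *)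
Lemma minimizer_of_chord_failure : ~ chord_condition p r ->
  exists F c, [/\ is_minimizer W0 opnormc t F, (rate W0 F <= c%:E)%E & c < G * ent p r].
Proof.
move=> /(params_of_chord_failure r0)[z [fz oz]].
have [zs [bs ms cs] Hs] := minimal_params p01 (ex_intro _ z fz).
have os : cost p zs < ent p r.
  have k0 : 0 < (ent p r - cost p z) / 2 by rewrite divr_gt0// subr_gt0.
  have [e e0 He] := Hs _ k0; have [bz mz cz] := fz.
  have /(He _ bz mz) : r ^+ 2 - e <= gain z by lra.
  by move: oz; move: (cost p z) (cost p zs) (ent p r) => a b c; lra.
have [h [bh eh oh]] := params_realize p g01 bs ms; have [gh _] := bh.
exists (gclass h), (G * cost p zs); split.
- split.
  + by exists h.
  + rewrite (opnormc_gclass gh); apply: le_of_sqr; [exact: ltW | exact: opnorm_ge0 |].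
    by apply: le_trans oh; rewrite t2 mulrC ler_pM2l.
  + move=> F gsF tF; apply: (le_trans (rate_le p01 bh)); rewrite eh.
    apply: (rate_ge p01 gsF tF) => k k0.
    have k20 : 0 < k / 2 by rewrite divr_gt0.
    have [e e0 He] := Hs _ k20; have Ge0 : 0 < G * e by rewrite mulr_gt0.
    (* [d] and [e'] keep the loss of gain below [e] and the loss of entropy below [k] *)
    pose d := Num.min (G * e / 8) (t / 4); pose e' := Num.min (G * e / 2) (k / 4).
    have d0 : 0 < d by rewrite lt_min !divr_gt0.
    have e'0 : 0 < e' by rewrite lt_min !divr_gt0.
    have dG : d <= G * e / 8 by rewrite ge_min lexx.
    have dt : d <= t / 4 by rewrite ge_min lexx orbT.
    have e'G : e' <= G * e / 2 by rewrite ge_min lexx.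
    have e'k : e' <= k / 4 by rewrite ge_min lexx orbT.
    exists d => // h' bh' th'.
    have s0 : 0 < t - 2 * d by lra.
    have sh' : t - 2 * d < opnorm h' by lra.
    have [z' [bz' mz' cz' oz']] := two_by_two_reduction g01 p01 bh' s0 sh' e'0.
    have : r ^+ 2 - e <= gain z'.
      apply: le_trans cz'; rewrite ler_pdivlMr// -/G mulrBl -t2.
      have td : t * d <= d by rewrite ler_piMl// ltW.
      have d2 := sqr_ge0 d.
      rewrite (_ : (t - 2 * d) ^+ 2 = t ^+ 2 - 4 * (t * d) + 4 * d ^+ 2); last by ring.
      move: Ge0 dG e'G td d2; rewrite [e * G]mulrC.
      by move: (G * e) (t ^+ 2) (t * d) (d ^+ 2) => q1 q2 q3 q4; lra.
    move=> /(He _ bz' mz') H; move: oz'; rewrite ler_pdivlMr// -/G => oz'.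
    have H1 : G * (cost p zs - k / 2) <= cost p z' * G by rewrite mulrC ler_pM2r.
    have H2 : G * (k / 2) <= k / 2 by rewrite ler_piMl// ltW.
    move: H1 H2 oz'; rewrite mulrBr; move: (G * (k / 2)) (G * cost p zs) (cost p z' * G) => a b c.
    by move: (EAB _) => E; lra.
- by apply: (le_trans (rate_le p01 bh)); rewrite eh.
- by rewrite ltr_pM2l.
Qed.

(** The bipartite [h] vanishes on A x A and B x B, and [u x * u y] has at least half of its
    integral on these two blocks, as [(X + Y) ^ 2 <= 2 (X ^ 2 + Y ^ 2)]. *)
Lemma diagonal_mass h f a u d : bipartite h -> graphon f -> bm1 u ->
  (forall x y, I x -> I y -> a * (u x * u y) <= f (x, y)) ->
  0 <= a -> cut_dist_labelled f h <= d -> a * E1 u ^+ 2 <= 4 * d.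
Proof.
move=> [gh h0] gf bu uf a0 fd.
have bf := graphon_bm2 gf; have bh := graphon_bm2 gh.
have bA := bm1_iA gamma; have bB := bm1_iB gamma.
have key w : bm1 w -> (forall x, I x -> 0 <= w x <= 1) ->
    (forall x y, I x -> I y -> w x * (w y * h (x, y)) = 0) ->
    a * E1 (fun x => w x * u x) ^+ 2 <= d.
  move=> bw w01 wh; apply: (le_trans _ fd).
  apply: le_trans (cut_dist_labelled_bilinear gf gh bw bw w01 w01).
  have bwu : bm1 (fun x => w x * u x) by bmt.
  have bawu : bm1 (fun x => a * (w x * u x)) by bmt.
  rewrite expr2 mulrA -(E1Z a bwu) -(E2_prod bawu bwu).
  have bL := bmM (bm2_fst bawu) (bm2_snd bwu).
  have bR : bm2 (fun x y => w x * (w y * (f (x, y) - h (x, y)))) by bmt.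
  apply: (E2_le bL bR) => x y Ix Iy.
  rewrite (_ : w x * (w y * (_ - _)) = w x * (w y * f (x, y))); last first.
    by rewrite -[RHS]subr0 -(wh x y Ix Iy) -!mulrBr.
  have /andP[wx _] := w01 _ Ix; have /andP[wy _] := w01 _ Iy.
  rewrite (_ : _ * _ * _ = w x * (w y * (a * (u x * u y)))); last first.
    by move: (w x) (w y) (u x) (u y) => q1 q2 q3 q4; ring.
  by rewrite ler_wpM2l// ler_wpM2l// uf.
have X := key _ bA (fun x _ => iA01 gamma x) _.
have Y := key _ bB (fun x _ => iB01 gamma x) _.
have {}X : a * E1 (fun x => iA x * u x) ^+ 2 <= d.
  apply: X => x y Ix Iy; rewrite !iA_ind.
  case: (boolP (x <= gamma)) => xg; last by rewrite mul0r.
  case: (boolP (y <= gamma)) => yg; last by rewrite mul0r mulr0.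
  by rewrite h0 ?mulr0// xg yg.
have {}Y : a * E1 (fun x => iB x * u x) ^+ 2 <= d.
  apply: Y => x y Ix Iy; rewrite !iB_ind.
  case: (boolP (gamma < x)) => xg; last by rewrite mul0r.
  case: (boolP (gamma < y)) => yg; last by rewrite mul0r mulr0.
  by rewrite h0 ?mulr0// leNgt xg leNgt yg.
have -> : E1 u = E1 (fun x => iA x * u x) + E1 (fun x => iB x * u x).
  rewrite -E1D; [|by bmt..]; apply: eq_E1 => x _.
  by rewrite iB_compl -mulrDl addrC subrK mul1r.
move: (E1 (fun x => iA x * u x)) (E1 (fun x => iB x * u x)) X Y => A B X Y.
have K : 0 <= a * (A - B) ^+ 2 by rewrite mulr_ge0// sqr_ge0.
have -> : a * (A + B) ^+ 2 = 2 * (a * A ^+ 2) + 2 * (a * B ^+ 2) - a * (A - B) ^+ 2 by ring.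
by move: (a * A ^+ 2) (a * B ^+ 2) (a * (A - B) ^+ 2) X Y K => q1 q2 q3; lra.
Qed.

Lemma le_of_eps (x y K : R) : 0 <= K -> (forall e, 0 < e -> x <= y + K * e) -> x <= y.
Proof.
move=> K0 H; apply/ler_addgt0Pr => e e0.
have K1 : 0 < K + 1 by rewrite ltr_wpDl.
apply: (le_trans (H (e / (K + 1)) _)); first by rewrite divr_gt0.
by rewrite lerD2l mulrCA ler_piMr ?(ltW e0)// ler_pdivrMr// mul1r lerDl.
Qed.

(** Bipartite graphons close to a relabelling of [g] exist because the rate is finite; by
    [diagonal_mass] the values of [g] on its own diagonal blocks are 0.  The common value [k]
    on the rest satisfies [k >= r] by the norm constraint, and since the mean over A x B passes
    to the limit, the tangent of [ent p] at [r] bounds the entropy. *)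
Lemma block_rate_lower F g c : gspace F -> (rate W0 F <= c%:E)%E ->
  block_graphon gamma g -> cut_distc F g = 0 -> t <= opnorm g -> G * ent p r <= c.
Proof.
move=> gsF rF [gg [a [b [k gE]]]] Fg tg; have [gF _] := gspaceP gsF.
have /andP[g0 g1] := g01; have [_ _ gg01] := gg.
have I0 : @I01 R 0 by apply/I01P; rewrite lexx ler01.
have I1 : @I01 R 1 by apply/I01P; rewrite lexx ler01.
have n1 : (1 <= gamma) = false by apply/negbTE; rewrite -ltNge.
have n0 : (gamma < 0) = false by apply/negbTE; rewrite -leNgt ltW.
have a0 : 0 <= a by have := gg01 _ _ I0 I0; rewrite gE// (ltW g0) => /andP[].
have b0 : 0 <= b by have := gg01 _ _ I1 I1; rewrite gE// n1 g1 => /andP[].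
have k01 : 0 <= k <= 1.
  by have := gg01 _ _ I0 I1; rewrite gE// (ltW g0) n1 n0.
have /andP[k0 k1] := k01.
have app e : 0 < e -> exists h phi, [/\ bipartite h, mp_bijection phi,
    cut_dist_labelled (relabel g phi) h <= 2 * e & entropy h <= c + e].
  move=> e0; have [h [bh Fh Eh]] := rate_approx p01 gsF rF e0; have [gh _] := bh.
  have hg : cut_dist h g < 2 * e.
    apply: (le_lt_trans (cut_dist_trans gh gF gg)).
    rewrite cut_dist_sym//; move: Fg; rewrite /cut_distc => ->.
    by apply: (le_lt_trans (lerD Fh (lexx _))); rewrite addr0; lra.
  have [phi mphi H] := cut_dist_lt gh gg hg.
  exists h, phi; split=> //; apply: le_trans (ltW H).
  by apply: cut_dist_labelled_sym => //; exact: graphon_relabel.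
have bA := bm1_iA gamma; have bB := bm1_iB gamma.
(* a nonnegative value [q] of [g] on a diagonal block of positive size vanishes *)
have diag w q m : bm1 w -> 0 <= q -> E1 w = m -> 0 < m ->
    (forall x y, I x -> I y -> q * (w x * w y) <= g (x, y)) -> q = 0.
  move=> bw q0 Ew m0 wg; apply/le_anti; rewrite q0 andbT -(ler_pM2r (exprn_gt0 2 m0)) mul0r.
  apply: (@le_of_eps _ _ 8) => // e /app[h [phi [bh mphi hg _]]].
  have bwp := bm1_mp mphi bw; have gp := graphon_relabel mphi gg.
  have := @diagonal_mass h (relabel g phi) q (fun x => w (phi x)) _ bh gp bwp _ q0 hg.
  rewrite (E1_mp mphi bw) Ew add0r => H; apply: (le_trans (H _)); last first.
    by apply: le_of_eq; ring.
  by move=> x y Ix Iy; apply: wg; [exact: mp_I01|exact: mp_I01].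
have az : a = 0.
  apply: (diag iA a gamma bA a0 (E1_iA g01) g0) => x y Ix Iy; rewrite gE// !iA_ind.
  have /andP[q0 _] := gg01 _ _ Ix Iy; move: q0; rewrite gE//.
  by case: (x <= gamma); case: (y <= gamma); rewrite /= ?mul0r ?mulr0// !mulr1.
have bz : b = 0.
  have g1' : 0 < 1 - gamma by rewrite subr_gt0.
  apply: (diag iB b (1 - gamma) bB b0 (E1_iB g01) g1') => x y Ix Iy; rewrite gE// !iB_ind.
  have /andP[q0 _] := gg01 _ _ Ix Iy; move: q0; rewrite gE// !ltNge.
  by case: (x <= gamma); case: (y <= gamma); rewrite /= ?mul0r ?mulr0// !mulr1.
have bg : bipartite g.
  split=> // x y Ix Iy; rewrite gE// az bz !ltNge.
  by case: (x <= gamma); case: (y <= gamma).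
have gk x y : I x -> I y -> x <= gamma -> gamma < y -> g (x, y) = k.
  by move=> Ix Iy xg yg; rewrite gE// xg [y <= gamma]leNgt yg/= ltNge xg.
have rk : r <= k.
  apply: le_of_sqr => //; first exact: ltW.
  rewrite -(ler_pM2r G0) -t2; apply: (@le_trans _ _ (opnorm g ^+ 2)).
    by have t0' := ltW t0; rewrite !expr2; exact: (ler_pM t0' t0' tg tg).
  apply: (le_trans (bip_opnorm_HS bg)); rewrite -(EAB_cst g01); apply: le_of_eq.
  by apply: eq_EAB => x y Ix Iy xg yg; rewrite gk.
have r01' : 0 < r < 1 by rewrite r0.
have sl0 : 0 <= ent_slope p r by apply: ent_slope_ge0 => //; [case/andP: p01|case/andP: pr1].
apply: (@le_of_eps _ _ (1 + ent_slope p r)); first by rewrite addr_ge0// ler01.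
move=> e e0; have [h [phi [bh mphi hg Eh]]] := app e e0; have [gh _] := bh.
have gp := graphon_relabel mphi gg; have [_ _ h01] := gh.
have bg2 := graphon_bm2 gg; have bp2 := graphon_bm2 gp; have bh2 := graphon_bm2 gh.
have be := bm2_ent p01 gh.
have b1 : bm1 (fun=> 1 : R) by exact: bm_cst.
have one01 x : I x -> 0 <= (1 : R) <= 1 by rewrite ler01 lexx.
have mass : r * G - e <= EAB (fun x y => h (x, y)).
  have := cut_dist_labelled_bilinear gp gh b1 b1 one01 one01.
  rewrite (@eq_E2 _ _ (fun x y => relabel g phi (x, y) - h (x, y))); last first.
    by move=> x y _ _; rewrite !mul1r.
  rewrite (E2B bp2 bh2) (E2_mp (F := fun x y => g (x, y)) mphi bg2).
  rewrite (E2_bipartite (k := id) bg)// (E2_bipartite (k := id) bh)//.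
  rewrite (@eq_EAB _ _ (fun x y => g (x, y)) (fun _ _ => k))// (EAB_cst g01) -/G.
  have : r * G <= k * G by rewrite ler_pM2r.
  by move: hg; move: (cut_dist_labelled _ _) (k * G) (r * G) (EAB _) => q1 q2 q3 q4; lra.
have : EAB (fun x y => (ent p r - ent_slope p r * r) + ent_slope p r * h (x, y) + 0 * h (x, y))
    <= entropy h.
  apply: EAB_le; [by bmt..|exact: be|] => x y Ix Iy.
  have := ent_tangent p r01' (h01 _ _ Ix Iy).
  by move: (ent p r) (ent p _) (ent_slope p r) => q1 q2 q3; lra.
rewrite (EAB_affine g01 _ _ _ bh2 bh2) mul0r addr0 -/G => tang.
have : ent_slope p r * (r * G - e) <= ent_slope p r * EAB (fun x y => h (x, y)).
  by rewrite ler_wpM2l.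
move: tang Eh; move: (EAB (fun x y => ent p _)) (EAB _) (ent p r) (ent_slope p r) => q1 q2 q3 q4.
by move: (q4 * q2) => q5; lra.
Qed.

Lemma not_symmetric_regime : ~ chord_condition p r ->
  ~ symmetric_regime gamma W0 opnormc t.
Proof.
move=> nch [_ sym]; have [F [c [minF rF cG]]] := minimizer_of_chord_failure nch.
have [gsF tF _] := minF; have [_ [g bg Fg]] := sym _ minF.
have [gF _] := gspaceP gsF; have [gg _] := bg.
have tg : t <= opnorm g by rewrite -(opnorm_cut0 gF gg Fg).
by have := block_rate_lower gsF rF bg Fg tg; rewrite leNgt cG.
Qed.

End Breaking.

(** * The two regimes *)

Local Open Scope ring_scope.

(* The conjunct le_max_Omega records that t is a value to which the notion of
   symmetric regime applies, so that part 2 denies only the statement about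
   minimizers. *)
Theorem theorem1p28 (R : realType) (p gamma r : R)
    (hp : 0 < p < 1) (hgamma : 0 < gamma < 1)
    (hgammaQ : exists q : rat, gamma = ratr q) (hr : p <= r <= 1) :
  let W0 := bip_graphon gamma p in
  let t := opnorm (bip_graphon gamma r) in
  let on_minorant :=
    convex_minorant (fun x => rel_entropy p (Num.sqrt x)) (r ^+ 2)
      = rel_entropy p r in
  le_max_Omega W0 opnormc t /\
  (on_minorant ->
     symmetric_regime gamma W0 opnormc t /\
     unique_solution W0 opnormc t (gclass (bip_graphon gamma r))) /\
  (~ on_minorant -> ~ symmetric_regime gamma W0 opnormc t).
Proof.
move=> W0 t onm; have /andP[p0 p1] := hp; have /andP[pr r1] := hr.
have r01 : 0 <= r <= 1 by rewrite r1 (le_trans (ltW p0) pr).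
have lem := le_max_Omega_bip_graphon hgamma hp hr.
split; [exact: lem|split].
- move=> /(minorant_chord hp r01) ch.
  have minr := minimizer_bip_graphon hgamma hp hr ch.
  split; split=> //.
  + move=> F minF; rewrite (minimizer_unique hgamma hp hr ch minF).
    exact: block_class_bip_graphon hp hr.
  + by apply: gspace_Omega_gclass => //; exact: bip_graphon_bipartite.
  + by move=> F _ minF; exact: (minimizer_unique hgamma hp hr ch minF).
- move=> /(not_minorant hp hr)[lr1 nch].
  by apply: not_symmetric_regime nch => //; rewrite pr.
Qed.
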